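(* Let $\Gamma<\mathrm{PSL}_2(\mathbb{C})$ be a torsion-free geometrically finite Kleinian group containing rank-$1$ parabolic subgroups. Suppose $x\in \mathrm{RFM}$ is such that $\overline{xA}=\mathrm{RFM}$. Then the set of return times $$R(x)=\{t\in\mathbb{R}: xu_t\in \mathrm{RFM}\}$$ is not $K$-thick for any $K>1$.
   Context: $G=\mathrm{PSL}_2(\mathbb{C})\cong\mathrm{Isom}^+(\mathbb{H}^3)$ acts simply transitively on the bundle $\mathrm{F}\mathbb{H}^3$ of oriented orthonormal $3$-frames, and $G$ is identified with $\mathrm{F}\mathbb{H}^3$. For a frame $x\in\mathrm{F}\mathbb{H}^3$, $x^+$ (resp. $x^-$) denotes the forward (resp. backward) endpoint in $\partial\mathbb{H}^3=\mathbb{C}\cup\{\infty\}$ of the geodesic tangent to the first vector of $x$. The identification is normalized so that for $x=g\in G$ one has $x^-=g(\infty)$ and $x^+=g(0)$. Let $u_t=\begin{pmatrix}1&t\\0&1\end{pmatrix}$, $a_t=\begin{pmatrix}e^{t/2}&0\\0&e^{-t/2}\end{pmatrix}$, $U=\{u_t:t\in\mathbb{R}\}$, $A=\{a_t:t\in\mathbb{R}\}$, acting by right multiplication; thus $(xu_t)^-=x^-$ and, for $x=g$, $(xu_t)^+=g(t)$. A Kleinian group is a discrete subgroup $\Gamma<G$; it is geometrically finite if its action on $\mathbb{H}^3$ admits a finite-sided fundamental domain. Its limit set is $\Lambda=\overline{\Gamma o}\cap\partial\mathbb{H}^3$ for any $o\in\mathbb{H}^3$. A point $\sigma\in\Lambda$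 is a parabolic fixed point if its stabilizer $\Gamma_\sigma$ in $\Gamma$ is nontrivial and conjugate in $G$ to a subgroup of $N=\left\{\begin{pmatrix}1&z\\0&1\end{pmatrix}:z\in\mathbb{C}\right\}$; its rank is the rank ($1$ or $2$) of the abelian group $\Gamma_\sigma$. ''Containing rank-$1$ parabolic subgroups'' means that there is a parabolic fixed point of rank $1$. $\mathrm{RFM}\subset\Gamma\backslash\mathrm{F}\mathbb{H}^3$ is the set of frames any lift $x$ of which satisfies $x^+,x^-\in\Lambda$. For $K>1$, a set $T\subseteq\mathbb{R}$ is $K$-thick if for all $t>0$, $T\cap\left([-Kt,-t]\cup[t,Kt]\right)\neq\emptyset$. *)

(* Defs.v *)
From HB Require Import structures.
From mathcomp Require Import all_boot all_order all_algebra.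
From mathcomp Require Import all_classical all_reals all_analysis.
From mathcomp Require Import ring complex.

Set Implicit Arguments.
Unset Strict Implicit.
Unset Printing Implicit Defensive.

Import Order.TTheory GRing.Theory Num.Theory.
Import numFieldNormedType.Exports.

Local Open Scope classical_set_scope.
Local Open Scope quotient_scope.
Local Open Scope ring_scope.
Local Open Scope complex_scope.

(* The library equips abstract numFieldTypes, but not R[i], with the topology
   of the norm. *)
HB.instance Definition _ (R : rcfType) := NormedModule.copy R[i] R[i]^o.

Section SL2.
Variable R : realType.

Definition mx2 (a b c d : R[i]) : 'M[R[i]]_2 :=
  \matrix_(i, j) if i == 0 then (if j == 0 then a else b)
                 else (if j == 0 then c else d).

Lemma det_mx2 a b c d : \det (mx2 a b c d) = a * d - b * c.
Proof.
rewrite (expand_det_row _ ord0) !big_ord_recl big_ord0 /cofactor.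
rewrite !(expand_det_row _ ord0) !big_ord_recl !big_ord0 /cofactor !det_mx00.
by rewrite !mxE /=; ring.
Qed.

Definition SL2_set : set 'M[R[i]]_2 := [set A | \det A = 1].

(* The topology is the subspace topology of 'M[R[i]]_2. *)
Definition SL2 : Type := set_type SL2_set.

HB.instance Definition _ := Topological.on SL2.

Lemma SL2_det (A : SL2) : \det (\val A) = 1.
Proof. by case: A => A /= /set_mem. Qed.

Definition toSL2 (A : 'M[R[i]]_2) (detA : \det A = 1) : SL2 :=
  exist _ A (mem_set detA).

Definition SL2_one : SL2 := toSL2 (det1 _ 2).

Lemma SL2_mul_subproof (A B : SL2) : \det (\val A *m \val B) = 1.
Proof. by rewrite det_mulmx !SL2_det mulr1. Qed.
Definition SL2_mul (A B : SL2) : SL2 := toSL2 (SL2_mul_subproof A B).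

Lemma SL2_inv_subproof (A : SL2) : \det (invmx (\val A)) = 1.
Proof. by rewrite det_inv SL2_det invr1. Qed.
Definition SL2_inv (A : SL2) : SL2 := toSL2 (SL2_inv_subproof A).

Lemma SL2_unit (A : SL2) : \val A \in unitmx.
Proof. by rewrite unitmxE SL2_det unitr1. Qed.

Fact SL2_mulA : associative SL2_mul.
Proof. by move=> A B C; apply: val_inj; rewrite /= mulmxA. Qed.
Fact SL2_mul1g : left_id SL2_one SL2_mul.
Proof. by move=> A; apply: val_inj; rewrite /= mul1mx. Qed.
Fact SL2_mulg1 : right_id SL2_one SL2_mul.
Proof. by move=> A; apply: val_inj; rewrite /= mulmx1. Qed.
Fact SL2_mulVg : left_inverse SL2_one SL2_inv SL2_mul.
Proof. by move=> A; apply: val_inj; rewrite /= mulVmx ?SL2_unit. Qed.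
Fact SL2_mulgV : right_inverse SL2_one SL2_inv SL2_mul.
Proof. by move=> A; apply: val_inj; rewrite /= mulmxV ?SL2_unit. Qed.

HB.instance Definition _ :=
  isGroup.Build SL2 SL2_mulA SL2_mul1g SL2_mulg1 SL2_mulVg SL2_mulgV.

Definition pm_rel (A B : SL2) : bool :=
  (\val A == \val B) || (\val A == - \val B).

Fact pm_rel_equiv : equiv_class_of pm_rel.
Proof.
split=> [A|A B|B A C]; rewrite /pm_rel ?eqxx //.
  by rewrite [\val A == \val B]eq_sym [\val A == - _]eq_sym eqr_oppLR.
by case/orP=> /eqP-> /orP[/eqP->|/eqP->]; rewrite ?opprK ?eqxx ?orbT.
Qed.
Canonical pm_rel_equiv_rel := EquivRelPack pm_rel_equiv.

End SL2.

Section PSL2.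
Variable R : realType.

(* PSL_2(C) = SL_2(C) / {1, -1}, with the quotient topology. *)
Definition PSL2 : Type := quotient_topology {eq_quot (@pm_rel_equiv_rel R)}.

HB.instance Definition _ := Topological.on PSL2.
HB.instance Definition _ := Quotient.on PSL2.

Definition psl (A : SL2 R) : PSL2 := \pi_PSL2 A.

Lemma pslP (A B : SL2 R) :
  psl A = psl B <-> \val A = \val B \/ \val A = - \val B.
Proof.
split=> [/(@eqmodP _ (@pm_rel_equiv_rel R))|AB].
  by case/orP=> /eqP; [left|right].
apply/(@eqmodP _ (@pm_rel_equiv_rel R))/orP.
by case: AB => ->; rewrite eqxx; [left|right].
Qed.

Lemma repr_psl (A : SL2 R) :
  \val (repr (psl A)) = \val A \/ \val (repr (psl A)) = - \val A.
Proof. by apply/pslP; rewrite /psl reprK. Qed.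

Definition PSL2_mul (g h : PSL2) : PSL2 := psl (repr g * repr h)%g.
Definition PSL2_inv (g : PSL2) : PSL2 := psl (repr g)^-1%g.

Lemma psl_mul (A B : SL2 R) : PSL2_mul (psl A) (psl B) = psl (A * B)%g.
Proof.
apply/pslP => /=.
by case: (repr_psl A) => ->; case: (repr_psl B) => ->;
  rewrite ?mulNmx ?mulmxN ?opprK; auto.
Qed.

Lemma psl_inv (A : SL2 R) : PSL2_inv (psl A) = psl A^-1%g.
Proof.
apply/pslP => /=.
by case: (repr_psl A) => ->; [left|right; rewrite -invrN].
Qed.

Lemma psl_surj (g : PSL2) : exists A, g = psl A.
Proof. by exists (repr g); rewrite /psl reprK. Qed.

Fact PSL2_mulA : associative PSL2_mul.
Proof.
move=> g h k; have [A ->] := psl_surj g; have [B ->] := psl_surj h.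
by have [C ->] := psl_surj k; rewrite !psl_mul mulgA.
Qed.
Fact PSL2_mul1g : left_id (psl 1%g) PSL2_mul.
Proof. by move=> g; have [A ->] := psl_surj g; rewrite psl_mul mul1g. Qed.
Fact PSL2_mulg1 : right_id (psl 1%g) PSL2_mul.
Proof. by move=> g; have [A ->] := psl_surj g; rewrite psl_mul mulg1. Qed.
Fact PSL2_mulVg : left_inverse (psl 1%g) PSL2_inv PSL2_mul.
Proof.
by move=> g; have [A ->] := psl_surj g; rewrite psl_inv psl_mul mulVg.
Qed.
Fact PSL2_mulgV : right_inverse (psl 1%g) PSL2_inv PSL2_mul.
Proof.
by move=> g; have [A ->] := psl_surj g; rewrite psl_inv psl_mul mulgV.
Qed.

HB.instance Definition _ := isGroup.Build PSL2
  PSL2_mulA PSL2_mul1g PSL2_mulg1 PSL2_mulVg PSL2_mulgV.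

(* A representative in SL_2(C), determined up to sign; every formula below that
   uses its entries is invariant under A |-> - A. *)
Definition lift_mx (g : PSL2) : 'M[R[i]]_2 := \val (repr g).

Fact upper_subproof (z : R[i]) : \det (mx2 1 z 0 1) = 1.
Proof. by rewrite det_mx2 mulr1 mulr0 subr0. Qed.
Definition upper (z : R[i]) : PSL2 := psl (toSL2 (upper_subproof z)).

Fact diag_subproof (t : R) :
  \det (mx2 (expR (t / 2))%:C 0 0 (expR (- (t / 2)))%:C) = 1.
Proof. by rewrite det_mx2 mul0r subr0 -rmorphM /= -expRD subrr expR0. Qed.

Definition u_ (t : R) : PSL2 := upper t%:C.
Definition a_ (t : R) : PSL2 := psl (toSL2 (diag_subproof t)).

Definition A_ : set PSL2 := range a_.
Definition N_ : set PSL2 := range upper.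

(* The sphere at infinity is C together with the point None at infinity. *)
Definition boundary : Type := option R[i].

Definition mobius_mx (A : 'M[R[i]]_2) (xi : boundary) : boundary :=
  let a := A 0 0 in let b := A 0 1 in let c := A 1 0 in let d := A 1 1 in
  if xi is Some z then
    if c * z + d == 0 then None else Some ((a * z + b) / (c * z + d))
  else if c == 0 then None else Some (a / c).

Definition mobius (g : PSL2) : boundary -> boundary := mobius_mx (lift_mx g).

Lemma mobius_psl (A : SL2 R) : mobius (psl A) = mobius_mx (\val A).
Proof.
rewrite /mobius /lift_mx; case: (repr_psl A) => -> //.
apply/funext => -[z|]; rewrite /mobius_mx !mxE.
  by rewrite !mulNr -!opprD oppr_eq0 invrN mulrNN.
by rewrite oppr_eq0 invrN mulrNN.
Qed.

(* Upper half-space model of hyperbolic 3-space inside C x R. *)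
Definition H3 : set (R[i] * R) := [set p | 0 < p.2].

Definition sqnorm (z : R[i]) : R := complex.Re z ^+ 2 + complex.Im z ^+ 2.

(* Poincare extension of the Moebius action to the upper half-space. *)
Definition act_mx (A : 'M[R[i]]_2) (p : R[i] * R) : R[i] * R :=
  let a := A 0 0 in let b := A 0 1 in let c := A 1 0 in let d := A 1 1 in
  let: (z, t) := p in
  let D := sqnorm (c * z + d) + sqnorm c * t ^+ 2 in
  (((a * z + b) * (c * z + d)^*%C + a * c^*%C * (t ^+ 2)%:C) / D%:C, t / D).

Definition act (g : PSL2) : R[i] * R -> R[i] * R := act_mx (lift_mx g).

Lemma sqnormN z : sqnorm (- z) = sqnorm z.
Proof. by case: z => x y; rewrite /sqnorm /= !sqrrN. Qed.

Lemma act_psl (A : SL2 R) : act (psl A) = act_mx (\val A).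
Proof.
rewrite /act /lift_mx; case: (repr_psl A) => -> //.
apply/funext => -[z t]; rewrite /act_mx !mxE.
rewrite !mulNr -!opprD !sqnormN !rmorphN !mulrNN.
by rewrite mulrN mulNr opprK.
Qed.

End PSL2.

Arguments A_ R : clear implicits.
Arguments N_ R : clear implicits.
Arguments H3 R : clear implicits.

Section Kleinian.
Variables (R : realType) (Gamma : groupClosed (PSL2 R)).

Definition discrete_subgroup : Prop := [set` Gamma] `<=` isolated [set` Gamma].

Definition torsion_free : Prop :=
  forall (g : PSL2 R) (n : nat),
    g \in Gamma -> (0 < n)%N -> (g ^+ n = 1)%g -> g = 1%g.

(* H^3 together with its sphere at infinity is the closed upper half-space with
   a point at infinity; it is viewed inside the one-point compactification of
   C x R, from which it inherits its topology. *)
Definition boundary_point (xi : boundary R) :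
    one_point_compactification (R[i] * R) :=
  if xi is Some z then Some (z, 0) else None.

(* Accumulation at infinity of an orbit does not depend on the orbit, so the
   limit set is defined with the orbit of (0, 1). *)
Definition base_point : R[i] * R := (0, 1).

Definition orbit_H3 (o : R[i] * R) : set (R[i] * R) :=
  [set act g o | g in [set` Gamma]].

Definition limit_set : set (boundary R) :=
  [set xi | closure
     ((Some : _ -> one_point_compactification (R[i] * R)) @`
        orbit_H3 base_point)
     (boundary_point xi)].

(* Every closed half-space of H^3 is the preimage of {Re z >= 0} under an
   orientation-preserving isometry. *)
Definition half_space (g : PSL2 R) : set (R[i] * R) :=
  [set p | 0 <= complex.Re (act g p).1].

Definition polyhedron (s : seq (PSL2 R)) : set (R[i] * R) :=
  [set p | H3 R p /\ forall g, g \in s -> half_space g p].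

Record fundamental_domain (P : set (R[i] * R)) : Prop := FundamentalDomain {
  fundamental_cover :
    H3 R `<=` \bigcup_(g in [set` Gamma]) (act g @` P);
  fundamental_disjoint : forall g, g \in Gamma -> g != 1%g ->
    P° `&` (act g @` P°) = set0;
  fundamental_locally_finite : forall p, H3 R p ->
    exists2 V, nbhs p V &
      finite_set [set g | g \in Gamma /\ V `&` (act g @` P) !=set0]
}.

Definition geometrically_finite : Prop :=
  exists s, fundamental_domain (polyhedron s).

Definition stabilizer (sigma : boundary R) : set (PSL2 R) :=
  [set g | g \in Gamma /\ mobius g sigma = sigma].

Record parabolic_fixed_point (sigma : boundary R) : Prop :=
  ParabolicFixedPoint {
  parabolic_limit : limit_set sigma;
  parabolic_nontrivial : exists2 g, stabilizer sigma g & g != 1%g;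
  parabolic_conj :
    exists h : PSL2 R, [set (g ^ h)%g | g in stabilizer sigma] `<=` N_ R
}.

End Kleinian.

Section Rank.
Variable G : groupType.

Definition expgz (x : G) (k : int) : G :=
  match k with Posz n => x ^+ n | Negz n => x ^- n.+1 end%g.

Definition Z_independent (n : nat) (e : 'I_n -> G) : Prop :=
  forall k : 'I_n -> int,
    (\prod_(i < n) expgz (e i) (k i))%g = 1%g -> forall i, k i = 0.

(* Only meaningful when the elements of S commute. *)
Definition abelian_rank (S : set G) (r : nat) : Prop :=
  (exists2 e : 'I_r -> G, (forall i, S (e i)) & Z_independent e) /\
  (forall n (e : 'I_n -> G), (forall i, S (e i)) -> Z_independent e ->
    (n <= r)%N).

End Rank.

Definition has_rank1_parabolic (R : realType) (Gamma : groupClosed (PSL2 R)) :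
    Prop :=
  exists2 sigma, parabolic_fixed_point Gamma sigma &
    abelian_rank (stabilizer Gamma sigma) 1.

Section Frames.
Variables (R : realType) (Gamma : groupClosed (PSL2 R)).

(* Frames of H^3 are identified with the elements of PSL_2(C). *)
Definition fwd (x : PSL2 R) : boundary R := mobius x (Some 0).
Definition bwd (x : PSL2 R) : boundary R := mobius x None.

(* Gamma x = Gamma y *)
Definition coset_rel (x y : PSL2 R) : bool := (x * y^-1)%g \in Gamma.

Fact coset_rel_equiv : equiv_class_of coset_rel.
Proof.
split=> [x|x y|y x z]; rewrite /coset_rel.
- by rewrite mulgV gpred1.
- by rewrite -[RHS]gpredV invgM invgK.
- by move=> xy yz; have := gpredM _ _ xy yz; rewrite mulgA mulgVK.
Qed.
Canonical coset_rel_equiv_rel := EquivRelPack coset_rel_equiv.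

(* The frame bundle Gamma \ F H^3 with the quotient topology. *)
Definition frame_bundle : Type :=
  quotient_topology {eq_quot coset_rel_equiv_rel}.

HB.instance Definition _ := Topological.on frame_bundle.
HB.instance Definition _ := Quotient.on frame_bundle.

Definition frame_proj (x : PSL2 R) : frame_bundle := \pi_frame_bundle x.

Definition right_act (x : frame_bundle) (g : PSL2 R) : frame_bundle :=
  frame_proj (repr x * g)%g.

Lemma frame_projP (x y : PSL2 R) :
  frame_proj x = frame_proj y <-> (x * y^-1)%g \in Gamma.
Proof. exact: rwP (@eqmodP _ coset_rel_equiv_rel x y). Qed.

Lemma right_act_proj (x g : PSL2 R) :
  right_act (frame_proj x) g = frame_proj (x * g)%g.
Proof.
apply/frame_projP; rewrite invgM mulgA mulgK; apply/frame_projP.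
by rewrite /frame_proj reprK.
Qed.

Definition RFM : set frame_bundle :=
  [set X | forall x, frame_proj x = X ->
     limit_set Gamma (fwd x) /\ limit_set Gamma (bwd x)].

Definition return_times (x : frame_bundle) : set R :=
  [set t : R | RFM (right_act x (u_ t))].

End Frames.

Arguments RFM {R} Gamma.

Definition thick (R : realType) (K : R) (T : set R) : Prop :=
  forall t : R, 0 < t ->
    T `&` (`[- (K * t), - t]%classic `|` `[t, K * t]%classic) !=set0.

(* Main.v *)
From HB Require Import structures.
Require Import Defs.
From mathcomp Require Import all_boot all_order all_algebra.
From mathcomp Require Import all_classical all_reals all_analysis.
From mathcomp Require Import measurable_realfun.
From mathcomp Require Import zify ring lra complex.

(** The idea. Suppose that a frame A, with both endpoints in the limit set, has the
    property that no point A(r) with r real and |r| >= r0 is a limit point. If the return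
    times of x were K-thick then so would be those of every x a_s, because (x a_s)(r) is
    the boundary point x(e^s r); each x a_s would then have a return time r with
    r0 <= |r| <= K r0. Having no such return time is an open condition on frames, A
    satisfies it, and A belongs to RFM, the closure of the orbit of x: a contradiction
    ([open_avoiding] and the last proof).

    Such a frame is built from a rank one parabolic fixed point k(oo), where k is chosen so
    that the stabiliser of oo in S = k^-1 Gamma k consists of real translations and contains
    z |-> z + 1 ([cusp_frame]). The classical fact behind the construction is that the limit
    set of S lies in a strip |Im z| <= C ([strip]). Take A with backward endpoint k(oo) and
    forward endpoint a limit point k(z), rotated so that A(r) = k(z + i r): these points
    leave the strip as soon as |r| is large ([avoid_frame]).

    The strip comes from the finite-sided polyhedron P. One must know that, high above
    the cusp oo, only those tiles g^-1 P occur which have oo as an ideal vertex ([flux]).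
    Ideal vertices of P of this kind are finite in number, and two tiles with the same
    vertex at oo differ by a real translation, so up to real translations finitely many
    tiles are seen there. The sides of such a tile are vertical or are
    hemispheres of bounded size, hence above a point z with |Im z| large the whole vertical
    line lies in one tile ([column]). Near z finitely many tiles occur in this way, each with
    finitely many points of an orbit, so z is not a limit point ([off_strip]).

    [flux] is proved by a volume argument. Points of H^3 are represented by positive
    definite Hermitian forms up to scaling, ideal points by null forms, and the group acts
    linearly, preserving the determinant and Lebesgue measure on the space R^4 of forms.
    - A point of P which is the image of a very high point is moved very little by a
      conjugate of z |-> z + 1. So P cannot contain a ball of comparable size near it, since
      the ball would meet its image; hence the point is close to one of finitely many ideal
      points n of P, its label ([thin], by compactness).
    - Moving a form H of P away from its label, by H |-> H - (3/4) (det H / <H, n>) n, keeps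
      it in P and divides volumes by 4. Applied in every tile, and followed by integral
      translations, this gives a map from the high forms of the fundamental box
      0 <= x < d to the box that is injective because tiles are disjoint.
    - Compare it with the same flow away from oo, which is globally defined, on the region
      [roof] of forms in the box with T d + e |y| <= sqrt(det) <= 1/2. Both divide volume
      by 4, so the preimage X of the roof under the first map has at most 4 times its
      volume, which is the volume of the preimage Y under the second. The first map hardly raises the
      function T d + e |y| ([drift_sum]), hence Y \ X lies in a layer of volume O(e)
      ([loss_layer], [vol_layer]), and so vol (X \ Y) = O(e) as well ([vol_gain]).
    - If the label of some high point did not correspond to oo, the first map would decrease
      d by a definite factor nearby, and X \ Y would contain an open set independent of e
      ([flux_core]); let e tend to 0. *)

Set Implicit Arguments.
Unset Strict Implicit.
Unset Printing Implicit Defensive.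

Import Order.TTheory GRing.Theory Num.Theory.
Import numFieldNormedType.Exports.

Local Open Scope classical_set_scope.
Local Open Scope ring_scope.
Local Open Scope complex_scope.

(** * Hermitian forms and the action of PSL2 on them *)

Section Forms.
Variable R : realType.

(** The form (d, y, x, a) is the Hermitian matrix with rows (a, x + i y) and (x - i y, d).
    The coordinate a comes last because the volume arguments integrate over it first. *)
Definition hform : Type := (R * R * R * R)%type.
Definition mkf (d y x a : R) : hform := (d, y, x, a).
Definition fd (K : hform) : R := K.1.1.1.
Definition fy (K : hform) : R := K.1.1.2.
Definition fx (K : hform) : R := K.1.2.
Definition fa (K : hform) : R := K.2.
Definition fb (K : hform) : R[i] := fx K +i* fy K.

Definition fdet (K : hform) : R := fa K * fd K - fx K ^+ 2 - fy K ^+ 2.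
(** Twice the polarisation of [fdet]; it is the Lorentz form of signature (1, 3). *)
Definition bip (K L : hform) : R :=
  fa K * fd L + fd K * fa L - 2 * (fx K * fx L + fy K * fy L).
Definition ftr (K : hform) : R := fa K + fd K.

Definition fpos (K : hform) : Prop := 0 < fd K /\ 0 < fdet K.

(** The entries of A K A^*. *)
Definition fmove (A : 'M[R[i]]_2) (K : hform) : hform :=
  let a := A 0 0 in let b := A 0 1 in let c := A 1 0 in let d := A 1 1 in
  let w := a * c^* * (fa K)%:C + a * d^* * fb K + b * c^* * (fb K)^*
           + b * d^* * (fd K)%:C in
  mkf (sqnorm c * fa K + 2 * complex.Re (c * d^* * fb K) + sqnorm d * fd K)
      (complex.Im w) (complex.Re w)
      (sqnorm a * fa K + 2 * complex.Re (a * b^* * fb K) + sqnorm b * fd K).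

Lemma ReM (x y : R[i]) : complex.Re (x * y) =
  complex.Re x * complex.Re y - complex.Im x * complex.Im y.
Proof. by case: x y => [a b] [c d]. Qed.
Lemma ImM (x y : R[i]) : complex.Im (x * y) =
  complex.Re x * complex.Im y + complex.Im x * complex.Re y.
Proof. by case: x y => [a b] [c d]. Qed.
Lemma ReD (x y : R[i]) : complex.Re (x + y) = complex.Re x + complex.Re y.
Proof. by case: x y => [a b] [c d]. Qed.
Lemma ImD (x y : R[i]) : complex.Im (x + y) = complex.Im x + complex.Im y.
Proof. by case: x y => [a b] [c d]. Qed.
Lemma ReN (x : R[i]) : complex.Re (- x) = - complex.Re x.
Proof. by case: x. Qed.
Lemma ImN (x : R[i]) : complex.Im (- x) = - complex.Im x.
Proof. by case: x. Qed.
Lemma ReJ (x : R[i]) : complex.Re (x^*)%C = complex.Re x.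
Proof. by case: x. Qed.
Lemma ImJ (x : R[i]) : complex.Im (x^*)%C = - complex.Im x.
Proof. by case: x. Qed.
Definition cE := (ReM, ImM, ReD, ImD, ReN, ImN, ReJ, ImJ).

Lemma eqC (x y : R[i]) : complex.Re x = complex.Re y ->
  complex.Im x = complex.Im y -> x = y.
Proof. by case: x y => [a b] [c d] /= -> ->. Qed.

Lemma mulmx2E (A B : 'M[R[i]]_2) i j :
  (A *m B) i j = A i 0 * B 0 j + A i 1 * B 1 j.
Proof.
by rewrite mxE !big_ord_recl big_ord0 addr0; congr (_ * _ + A _ _ * B _ _);
  apply: val_inj.
Qed.

Lemma fmoveM (A B : 'M[R[i]]_2) K : fmove (A *m B) K = fmove A (fmove B K).
Proof.
rewrite /fmove /mkf !mulmx2E.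
case: (A 0 0) (A 0 1) (A 1 0) (A 1 1) => [a a'] [b b'] [c c'] [d d'].
case: (B 0 0) (B 0 1) (B 1 0) (B 1 1) => [p p'] [q q'] [r r'] [s s'].
case: K => [[[k y] x] l].
rewrite /fb /fa /fx /fy /fd /sqnorm /= .
congr (_, _, _, _); rewrite ?cE /=; ring.
Qed.

Definition fcomb (s : R) (K : hform) (t : R) (L : hform) : hform :=
  mkf (s * fd K + t * fd L) (s * fy K + t * fy L)
      (s * fx K + t * fx L) (s * fa K + t * fa L).
Definition fscale (s : R) (K : hform) : hform :=
  mkf (s * fd K) (s * fy K) (s * fx K) (s * fa K).

Lemma fscaleE s K : ((fd (fscale s K) = (s * fd K)%R) * (fy (fscale s K) = (s * fy K)%R)
  * (fx (fscale s K) = (s * fx K)%R) * (fa (fscale s K) = (s * fa K)%R))%type.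
Proof. by []. Qed.
Lemma fcombE s K t L : ((fd (fcomb s K t L) = (s * fd K + t * fd L)%R)
  * (fy (fcomb s K t L) = (s * fy K + t * fy L)%R)
  * (fx (fcomb s K t L) = (s * fx K + t * fx L)%R)
  * (fa (fcomb s K t L) = (s * fa K + t * fa L)%R))%type.
Proof. by []. Qed.

Lemma fmove_comb A s K t L :
  fmove A (fcomb s K t L) = fcomb s (fmove A K) t (fmove A L).
Proof.
rewrite /fmove /fcomb /mkf.
case: (A 0 0) (A 0 1) (A 1 0) (A 1 1) => [a a'] [b b'] [c c'] [d d'].
case: K => [[[k y] x] l]; case: L => [[[k2 y2] x2] l2].
rewrite /fb /fa /fx /fy /fd /sqnorm /=.
congr (_, _, _, _); rewrite ?cE /=; ring.
Qed.

Lemma fmove_scale A s K : fmove A (fscale s K) = fscale s (fmove A K).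
Proof.
have E L : fscale s L = fcomb s L 0 L.
  by rewrite /fscale /fcomb !mul0r !addr0.
by rewrite !E fmove_comb.
Qed.

Lemma mx2_eta (A : 'M[R[i]]_2) : A = mx2 (A 0 0) (A 0 1) (A 1 0) (A 1 1).
Proof.
apply/matrixP => i j; rewrite mxE.
have E k : k = 0 \/ k = 1 :> 'I_2.
  by case: k => [[|[|k]] p]; [left|right|]; try exact: val_inj.
by case: (E i) (E j) => -> [] ->.
Qed.

Lemma det2E (A : 'M[R[i]]_2) : \det A = A 0 0 * A 1 1 - A 0 1 * A 1 0.
Proof. by rewrite {1}(mx2_eta A) det_mx2. Qed.

Lemma bip_fmove A K L :
  bip (fmove A K) (fmove A L) = sqnorm (\det A) * bip K L.
Proof.
rewrite det2E.
rewrite /fmove /bip /mkf.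
case: (A 0 0) (A 0 1) (A 1 0) (A 1 1) => [a a'] [b b'] [c c'] [d d'].
case: K => [[[k y] x] l]; case: L => [[[k2 y2] x2] l2].
rewrite /fb /fa /fx /fy /fd /sqnorm /=.
rewrite ?cE /=; ring.
Qed.

Lemma bipKK K : bip K K = 2 * fdet K.
Proof. by rewrite /bip /fdet; ring. Qed.

Lemma fdet_fmove A K : fdet (fmove A K) = sqnorm (\det A) * fdet K.
Proof.
have h2 : (2 : R) != 0 by [].
by apply: (mulfI h2); rewrite mulrCA -!bipKK bip_fmove.
Qed.

Lemma fmove1 K : fmove 1%:M K = K.
Proof.
rewrite /fmove /mkf !mxE /=.
case: K => [[[k y] x] l].
rewrite /fb /fa /fx /fy /fd /sqnorm /=.
by congr (_, _, _, _); rewrite ?cE /=; ring.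
Qed.

Lemma fmoveN A K : fmove (- A) K = fmove A K.
Proof.
rewrite /fmove /mkf !mxE.
case: (A 0 0) (A 0 1) (A 1 0) (A 1 1) => [a a'] [b b'] [c c'] [d d'].
case: K => [[[k y] x] l].
rewrite /fb /fa /fx /fy /fd /sqnorm /=.
by congr (_, _, _, _); rewrite ?cE /=; ring.
Qed.

Lemma sqnorm_ge0 (z : R[i]) : 0 <= sqnorm z.
Proof. by rewrite addr_ge0 ?sqr_ge0. Qed.

Lemma sqnorm_eq0 (z : R[i]) : (sqnorm z == 0) = (z == 0).
Proof.
by rewrite /sqnorm paddr_eq0 ?sqr_ge0 // !sqrf_eq0 eq_complex.
Qed.

Definition gm (g : PSL2 R) (K : hform) : hform := fmove (lift_mx g) K.

Lemma gm_psl (A : SL2 R) K : gm (psl A) K = fmove (\val A) K.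
Proof. by rewrite /gm /lift_mx; case: (repr_psl A) => ->; rewrite ?fmoveN. Qed.

Lemma gmM g h K : gm (g * h)%g K = gm g (gm h K).
Proof.
have [A ->] := psl_surj g; have [B ->] := psl_surj h.
by rewrite -[(_ * _)%g]/(PSL2_mul _ _) psl_mul !gm_psl -fmoveM.
Qed.

Lemma gm1 K : gm 1%g K = K.
Proof. by rewrite -[1%g]/(psl 1%g) gm_psl fmove1. Qed.

Lemma gmK g : cancel (gm g) (gm g^-1%g).
Proof. by move=> K; rewrite -gmM mulVg gm1. Qed.
Lemma gmVK g : cancel (gm g^-1%g) (gm g).
Proof. by move=> K; rewrite -gmM mulgV gm1. Qed.

Lemma lift_det (g : PSL2 R) : \det (lift_mx g) = 1.
Proof. exact: SL2_det. Qed.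

Lemma sqnorm1 : sqnorm 1 = 1 :> R.
Proof. by rewrite /sqnorm /= expr1n expr0n addr0. Qed.

Lemma gm_bip g K L : bip (gm g K) (gm g L) = bip K L.
Proof. by rewrite bip_fmove lift_det sqnorm1 mul1r. Qed.
Lemma gm_det g K : fdet (gm g K) = fdet K.
Proof. by rewrite fdet_fmove lift_det sqnorm1 mul1r. Qed.
Lemma gm_comb g s K t L : gm g (fcomb s K t L) = fcomb s (gm g K) t (gm g L).
Proof. exact: fmove_comb. Qed.
Lemma gm_scale g s K : gm g (fscale s K) = fscale s (gm g K).
Proof. exact: fmove_scale. Qed.

(** The nonzero part of the boundary of the cone [fpos]; its rays are the ideal points. *)
Definition fnull (n : hform) : Prop :=
  [/\ fdet n = 0, 0 <= fd n, 0 <= fa n & 0 < ftr n].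

Lemma fpos_fa K : fpos K -> 0 < fa K.
Proof.
case=> d0; rewrite /fdet => D0; have : 0 < fa K * fd K by nra.
by rewrite pmulr_lgt0.
Qed.

(** The reversed Cauchy-Schwarz inequality, which makes two forms of the same cone pair
    positively, is read off from a sum of squares. *)
Lemma bip_pos K L : fpos K -> fpos L -> 0 < bip K L.
Proof.
case=> dK DK [dL DL].
have h := mulr_gt0 dK dL; rewrite -(pmulr_lgt0 _ h).
have -> : bip K L * (fd K * fd L) =
  (fd L * fx K - fd K * fx L) ^+ 2 + (fd L * fy K - fd K * fy L) ^+ 2
  + fdet K * fd L ^+ 2 + fdet L * fd K ^+ 2 by rewrite /bip /fdet; ring.
have := mulr_gt0 DK (exprn_gt0 2 dL); have := mulr_gt0 DL (exprn_gt0 2 dK).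
have := sqr_ge0 (fd L * fx K - fd K * fx L).
have := sqr_ge0 (fd L * fy K - fd K * fy L). lra.
Qed.

Lemma null_d n (n0 : fnull n) :
  fd n = 0 -> [/\ fx n = 0, fy n = 0 & 0 < fa n].
Proof.
case: n0; rewrite /fdet /ftr => D _ _ t d0; move: D t.
rewrite d0 mulr0 addr0 => D t.
have e : fx n ^+ 2 + fy n ^+ 2 = 0 by lra.
move/eqP: e; rewrite paddr_eq0 ?sqr_ge0 // !sqrf_eq0.
by case/andP => /eqP -> /eqP ->; split.
Qed.

Lemma bip_null K n : fpos K -> fnull n -> 0 < bip K n.
Proof.
move=> [dK DK] [Dn dn an tn].
have aK := fpos_fa (conj dK DK).
have [dn0|dn0] := eqVneq (fd n) 0.
  have [x0 y0 a0] := null_d (And4 Dn dn an tn) dn0.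
  have -> : bip K n = fd K * fa n by rewrite /bip dn0 x0 y0; ring.
  exact: mulr_gt0.
have {}dn : 0 < fd n by rewrite lt_def dn0.
have h := mulr_gt0 dK dn; rewrite -(pmulr_lgt0 _ h).
have -> : bip K n * (fd K * fd n) =
  (fd n * fx K - fd K * fx n) ^+ 2 + (fd n * fy K - fd K * fy n) ^+ 2
  + fdet K * fd n ^+ 2 + fdet n * fd K ^+ 2 by rewrite /bip /fdet; ring.
rewrite Dn.
have := mulr_gt0 DK (exprn_gt0 2 dn).
have := sqr_ge0 (fd n * fx K - fd K * fx n).
have := sqr_ge0 (fd n * fy K - fd K * fy n). lra.
Qed.

(** The new d-coordinate is the denominator of the Poincare extension, which explains why
    [gm] preserves the cone and why it extends the action on H^3. *)
Lemma fdE (A : 'M[R[i]]_2) K :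
  fd K * fd (fmove A K) =
    sqnorm (A 1 0 * fb K + A 1 1 * (fd K)%:C) + sqnorm (A 1 0) * fdet K.
Proof.
rewrite /fmove /fdet.
case: (A 0 0) (A 0 1) (A 1 0) (A 1 1) => [a a'] [b b'] [c c'] [d d'].
case: K => [[[k y] x] l].
by rewrite /fb /fa /fx /fy /fd /sqnorm /= ?cE /=; ring.
Qed.

Lemma gm_pos g K : fpos K -> fpos (gm g K).
Proof.
move=> [dK DK]; split; last by rewrite gm_det.
rewrite -(pmulr_rgt0 _ dK) fdE.
have [c0|c0] := eqVneq (lift_mx g 1 0) 0.
  have := lift_det g; rewrite det2E c0 mulr0 subr0 => h.
  rewrite mul0r add0r [sqnorm 0]/sqnorm /= expr0n addr0 mul0r addr0.
  rewrite lt_def sqnorm_ge0 andbT sqnorm_eq0 mulf_neq0 //.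
    by apply: contra_eq_neq h => ->; rewrite mulr0 eq_sym oner_eq0.
  by rewrite eq_complex /= negb_and gt_eqF.
by rewrite ltr_wpDl ?sqnorm_ge0 // mulr_gt0 // lt_def sqnorm_ge0 sqnorm_eq0 c0.
Qed.

Lemma hformP K L : fd K = fd L -> fy K = fy L -> fx K = fx L -> fa K = fa L ->
  K = L.
Proof.
by case: K L => [[[? ?] ?] ?] [[[? ?] ?] ?] /= ; rewrite /fd /fy /fx /fa /= => -> -> -> ->.
Qed.

(** The form of determinant t^2 representing the point (z, t) of H^3. Since d is
    normalised to 1, the height of the point of a general form K is sqrt(fdet K) / fd K. *)
Definition kpt (p : R[i] * R) : hform :=
  mkf 1 (complex.Im p.1) (complex.Re p.1) (sqnorm p.1 + p.2 ^+ 2).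
Definition npt (xi : boundary R) : hform :=
  if xi is Some z then mkf 1 (complex.Im z) (complex.Re z) (sqnorm z)
  else mkf 0 0 0 1.

Lemma kptE p : ((fd (kpt p) = 1%R) * (fy (kpt p) = complex.Im p.1)
  * (fx (kpt p) = complex.Re p.1) * (fa (kpt p) = (sqnorm p.1 + p.2 ^+ 2)%R))%type.
Proof. by []. Qed.

Lemma kpt_det p : fdet (kpt p) = p.2 ^+ 2.
Proof. by rewrite /fdet /kpt /fa /fd /fx /fy /sqnorm /=; ring. Qed.

Lemma kpt_pos p : H3 R p -> fpos (kpt p).
Proof. by move=> h; split; [exact: ltr01|rewrite kpt_det exprn_gt0]. Qed.

Lemma kpt_inj p q c : H3 R p -> H3 R q -> kpt p = fscale c (kpt q) -> p = q.
Proof.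
case: p q => [[x y] t] [[x' y'] t'] /= p0 q0.
rewrite /H3 /= in p0 q0.
rewrite /kpt /fscale /fd /fy /fx /fa /sqnorm /= => -[] e1 e2 e3 e4.
have c1 : c = 1 by move: e1; rewrite mulr1.
move: e2 e3 e4; rewrite c1 !mul1r => -> -> /addrI /eqP.
by rewrite eqrXn2 ?ltW // => /eqP ->.
Qed.

Lemma kpt_ex K : fpos K -> exists2 p, H3 R p & K = fscale (fd K) (kpt p).
Proof.
move=> [d0 D0]; have dn : fd K != 0 by rewrite gt_eqF.
exists ((fx K / fd K) +i* (fy K / fd K), Num.sqrt (fdet K) / fd K).
  by rewrite /H3 /= divr_gt0 ?sqrtr_gt0.
apply: hformP; rewrite !fscaleE !kptE ?mulr1 //= ?[fd K * _]mulrC ?divfK //.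
rewrite /sqnorm /= !exprMn sqr_sqrtr ?ltW // /fdet.
by field.
Qed.

Lemma fscaleK_pos c K : 0 < c -> fpos (fscale c K) <-> fpos K.
Proof.
move=> c0; rewrite /fpos /fdet /fscale /fd /fa /fx /fy /=.
rewrite -/(fd K) -/(fa K) -/(fx K) -/(fy K) pmulr_rgt0 //.
have -> : c * fa K * (c * fd K) - (c * fx K) ^+ 2 - (c * fy K) ^+ 2 =
  c ^+ 2 * (fa K * fd K - fx K ^+ 2 - fy K ^+ 2) by ring.
by rewrite pmulr_rgt0 // exprn_gt0.
Qed.

Lemma fd_gm_kpt g p : fd (gm g (kpt p)) =
  sqnorm (lift_mx g 1 0 * p.1 + lift_mx g 1 1)
    + sqnorm (lift_mx g 1 0) * p.2 ^+ 2.
Proof.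
have := fdE (lift_mx g) (kpt p); rewrite -/(gm g _) kpt_det.
have -> : fd (kpt p) = 1 by [].
have -> : fb (kpt p) = p.1 by case: p => [[x y] t].
by rewrite mulr1 mul1r.
Qed.

(** This and [gm_npt] say that the linear action on forms is, up to positive factors, the
    isometric action on H^3 and the Moebius action on its boundary. *)
Lemma gm_kpt g p : H3 R p -> gm g (kpt p) = fscale (fd (gm g (kpt p))) (kpt (act g p)).
Proof.
move=> p0; have := gm_pos g (kpt_pos p0).
have D2 := gm_det g (kpt p); rewrite kpt_det in D2.
case=> d0 _; have dn : fd (gm g (kpt p)) != 0 by rewrite gt_eqF.
have DE := fd_gm_kpt g p.
set K := gm g (kpt p) in D2 d0 dn DE *.
have bE : fb K = (fd K)%:C * (act g p).1.
  rewrite /K DE; move: dn; rewrite /K DE {K D2 d0 DE}.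
  case: p p0 => z t _; rewrite /act /act_mx /= => dn.
  rewrite mulrC divfK; last by apply: contra dn => /eqP [] ->.
  rewrite /gm /fmove /fb /kpt.
  case: (lift_mx g 0 0) (lift_mx g 0 1) (lift_mx g 1 0) (lift_mx g 1 1) z
    => [a a'] [b b'] [c c'] [d d'] [x y] in dn *.
  rewrite /fx /fy /fa /fd /sqnorm /=.
  by apply: eqC; rewrite ?cE /=; ring.
have tE : fd K * (act g p).2 = p.2.
  rewrite /K DE; move: dn; rewrite /K DE {K D2 d0 DE bE}.
  by case: p p0 => z t _; rewrite /act /act_mx /= => dn; rewrite mulrC divfK.
have xE : fx K = fd K * complex.Re (act g p).1.
  by have /(congr1 (@complex.Re _)) := bE; rewrite ReM /= mul0r subr0.
have yE : fy K = fd K * complex.Im (act g p).1.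
  by have /(congr1 (@complex.Im _)) := bE; rewrite ImM /= mul0r addr0.
apply: hformP; rewrite !fscaleE !kptE ?mulr1 //.
apply: (mulIf dn).
have -> : fa K * fd K = fx K ^+ 2 + fy K ^+ 2 + p.2 ^+ 2.
  by rewrite -D2 /fdet; ring.
by rewrite -tE xE yE /sqnorm; ring.
Qed.

Lemma act_H3 g p : H3 R p -> H3 R (act g p).
Proof.
move=> p0; have := gm_pos g (kpt_pos p0); rewrite (gm_kpt g p0).
have [d0 _] := gm_pos g (kpt_pos p0).
move/fscaleK_pos => /(_ d0) [_]; rewrite kpt_det /H3 /= => t2.
have : (act g p).2 * fd (gm g (kpt p)) = p.2.
  have dn : fd (gm g (kpt p)) != 0 by rewrite gt_eqF.
  have DE := fd_gm_kpt g p.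
  rewrite DE in dn *; rewrite /act /act_mx; case: p {p0 d0 t2 DE} dn => z t /= dn.
  by rewrite divfK.
move=> e; rewrite /H3 /= in p0.
by move: p0; rewrite -e pmulr_lgt0.
Qed.

Lemma null_fscale c n : 0 < c -> fnull n -> fnull (fscale c n).
Proof.
move=> c0 [D d a t]; split; rewrite /fdet /ftr /fscale /fd /fa /fx /fy /=;
  rewrite -/(fd n) -/(fa n) -/(fx n) -/(fy n).
- have -> : c * fa n * (c * fd n) - (c * fx n) ^+ 2 - (c * fy n) ^+ 2 =
    c ^+ 2 * fdet n by rewrite /fdet; ring.
  by rewrite D mulr0.
- by rewrite mulr_ge0 // ltW.
- by rewrite mulr_ge0 // ltW.
- by rewrite -mulrDr mulr_gt0.
Qed.

Lemma npt_null xi : fnull (npt xi).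
Proof.
case: xi => [z|]; split; rewrite /fdet /ftr /npt /fd /fa /fx /fy /=.
- by rewrite /sqnorm; ring.
- by [].
- exact: sqnorm_ge0.
- by rewrite ltr_pwDr ?sqnorm_ge0.
- by ring.
- by [].
- by [].
- by rewrite addr0.
Qed.

Lemma gm_npt g xi : exists2 c, 0 < c & gm g (npt xi) = fscale c (npt (mobius g xi)).
Proof.
rewrite /gm /mobius /mobius_mx.
set A := lift_mx g.
have dA : A 0 0 * A 1 1 - A 0 1 * A 1 0 = 1 by rewrite -det2E lift_det.
case: xi => [z|].
  case: eqP => [e0|/eqP e0].
    exists (sqnorm (A 0 0 * z + A 0 1)).
      rewrite lt_def sqnorm_ge0 sqnorm_eq0 andbT; apply: contra_eq_neq dA => e1.
      have e2 : A 0 1 = - (A 0 0 * z) by move: e1; rewrite addrC => /eqP; rewrite addr_eq0 => /eqP.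
      have e3 : A 1 1 = - (A 1 0 * z) by move: e0; rewrite addrC => /eqP; rewrite addr_eq0 => /eqP.
      rewrite e2 e3 eq_sym; apply/eqP => h; have := oner_neq0 R[i]; rewrite h.
      by move/eqP; apply; ring.
    have w0 : A 1 1 = - (A 1 0 * z) by move/eqP: e0; rewrite addrC addr_eq0 => /eqP.
    move: w0 {e0 dA}; rewrite /fmove /npt /fscale /mkf.
    case: (A 0 0) (A 0 1) (A 1 0) (A 1 1) z => [a a'] [b b'] [c c'] [d d'] [x y].
    case=> -> ->.
    by rewrite /fb /fa /fx /fy /fd /sqnorm /=; congr (_, _, _, _);
      rewrite ?cE /=; ring.
  set D := A 1 0 * z + A 1 1 in e0 *.
  have D0 : 0 < sqnorm D by rewrite lt_def sqnorm_ge0 sqnorm_eq0 e0.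
  exists (sqnorm D) => //.
  set w := _ / D.
  have wE : A 0 0 * z + A 0 1 = w * D by rewrite /w divfK.
  have {wE} : A 0 1 = w * D - A 0 0 * z by rewrite -wE addrC addKr.
  have : A 1 1 = D - A 1 0 * z by rewrite /D addrC addKr.
  clear dA e0 D0; clearbody w D; move: w D => w D.
  rewrite /fmove /npt /fscale /mkf.
  case: (A 0 0) (A 0 1) (A 1 0) (A 1 1) z w D
    => [a a'] [b b'] [c c'] [d d'] [x y] [u v] [p q].
  move=> [] -> -> [] -> ->.
  by rewrite /fb /fa /fx /fy /fd /sqnorm /=; congr (_, _, _, _);
    rewrite ?cE /=; ring.
case: eqP => [c0|/eqP c0].
  exists (sqnorm (A 0 0)).
    rewrite lt_def sqnorm_ge0 sqnorm_eq0 andbT.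
    by apply: contra_eq_neq dA => ->; rewrite c0 mul0r mulr0 subr0 eq_sym oner_eq0.
  move: c0; rewrite /fmove /npt /fscale /mkf.
  case: (A 0 0) (A 0 1) (A 1 0) (A 1 1) => [a a'] [b b'] [c c'] [d d'] [] -> ->.
  by rewrite /fb /fa /fx /fy /fd /sqnorm /=; congr (_, _, _, _);
    rewrite ?cE /=; ring.
exists (sqnorm (A 1 0)); first by rewrite lt_def sqnorm_ge0 sqnorm_eq0 c0.
set w := _ / _.
have : A 0 0 = w * A 1 0 by rewrite /w divfK.
clearbody w; clear dA c0; move: w => w; rewrite /fmove /npt /fscale /mkf.
case: (A 0 0) (A 0 1) (A 1 0) (A 1 1) w
  => [a a'] [b b'] [c c'] [d d'] [u v] [] -> ->.
by rewrite /fb /fa /fx /fy /fd /sqnorm /=; congr (_, _, _, _);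
  rewrite ?cE /=; ring.
Qed.

End Forms.

(** * Invariant volume on the space of forms *)

Section ProductMeasure.
Context d1 d2 (T1 : measurableType d1) (T2 : measurableType d2) (R : realType).
Variables (m1 : {sigma_finite_measure set T1 -> \bar R})
          (m2 : {sigma_finite_measure set T2 -> \bar R}).
(** A copy of the product measure, carrying its own sigma-finite structure so that products
    can be iterated. *)
Definition prodm : set (T1 * T2) -> \bar R := (m1 \x m2)%E.
HB.instance Definition _ := Measure.copy prodm (m1 \x m2)%E.
Let prodm_sigma_finite : sigma_finite setT prodm.
Proof.
exact: (@isSigmaFinite.sigma_finiteT _ _ _ _
  (lebesgue_integral_fubini.measure_function_Measure_isSigmaFinite__to__measure_function_isSigmaFinite m1 m2)).
Qed.
HB.instance Definition _ :=
  Measure_isSigmaFinite.Build _ _ _ prodm prodm_sigma_finite.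
End ProductMeasure.

Section Fibers.
Context d1 d2 (T1 : measurableType d1) (T2 : measurableType d2) (R : realType).
Variables (m1 : {sigma_finite_measure set T1 -> \bar R})
          (m2 : {sigma_finite_measure set T2 -> \bar R}).

(** Fubini: a map that acts on the fibres of a product and scales the measure of each of
    them by c scales the product measure by c. *)
Lemma measure_fiber_right (F : T1 * T2 -> T2) (c : R) : 0 <= c ->
  measurable_fun setT F ->
  (forall x B, measurable B ->
     m2 ((fun y => F (x, y)) @^-1` B) = (c%:E * m2 B)%E) ->
  forall A, measurable A ->
    prodm m1 m2 ((fun p => (p.1, F p)) @^-1` A) = (c%:E * prodm m1 m2 A)%E.
Proof.
move=> c0 mF FE A mA.
rewrite /prodm /product_measure1 -ge0_integralZl_EFin //; last first.
  exact: measurable_fun_xsection.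
apply: eq_integral => x _ /=.
rewrite -(FE x); last exact: measurable_xsection.
congr (m2 _); apply/seteqP; split=> y; rewrite /xsection /= !in_setE //=.
Qed.

Lemma measure_fiber_left (F : T1 * T2 -> T1) (c : R) : 0 <= c ->
  measurable_fun setT F ->
  (forall y B, measurable B ->
     m1 ((fun x => F (x, y)) @^-1` B) = (c%:E * m1 B)%E) ->
  forall A, measurable A ->
    prodm m1 m2 ((fun p => (F p, p.2)) @^-1` A) = (c%:E * prodm m1 m2 A)%E.
Proof.
move=> c0 mF FE A mA.
have E B : measurable B -> (m1 \x m2)%E B = (m1 \x^ m2)%E B.
  apply: product_measure_unique => X Y mX mY; exact: product_measure2E.
have mP : measurable ((fun p : T1 * T2 => (F p, p.2)) @^-1` A).
  rewrite -[X in measurable X]setTI; apply: measurable_fun_pair => //.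
rewrite /prodm !E //.
rewrite /product_measure2 -ge0_integralZl_EFin //; last first.
  exact: measurable_fun_ysection.
apply: eq_integral => y _ /=.
rewrite -(FE y); last exact: measurable_ysection.
congr (m1 _); apply/seteqP; split=> x; rewrite /ysection /= !in_setE //=.
Qed.
End Fibers.

Section Leb.
Variable R : realType.
Notation leb := (@lebesgue_measure R).

Lemma measurable_affine (c b : R) :
  measurable_fun setT (fun x : measurableTypeR R => (c * x + b : measurableTypeR R)).
Proof. by apply: measurable_funD => //; apply: measurable_funM. Qed.

Lemma leb_affine (c b : R) (A : set (measurableTypeR R)) : 0 < c -> measurable A ->
  leb ((fun x => c * x + b) @^-1` A) = ((c^-1)%:E * leb A)%E.
Proof.
move=> c0 mA.
have c0' : 0 <= c by exact: ltW.
pose f : measurableTypeR R -> measurableTypeR R := fun x => c * x + b.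
suff -> : leb A = (c%:E * leb (f @^-1` A))%E.
  by rewrite muleA -EFinM mulVf ?gt_eqF // mul1e.
apply: (@lebesgue_measure_unique R (mscale (NngNum c0') (pushforward leb f))) => //.
  exact: measurable_affine.
move=> mf X [[u v] /= uv] <-.
rewrite /mscale /= /pushforward /f.
have -> : (fun x : R => c * x + b) @^-1` `]u, v]%classic =
  `](u - b) / c, (v - b) / c]%classic.
  apply/seteqP; split=> x /=; rewrite !in_itv /=;
  by rewrite ltr_pdivrMr // ler_pdivlMr // ltrBlDr lerBrDr [x * c]mulrC.
rewrite !lebesgue_measure_itv /= !lte_fin ltr_pM2r ?invr_gt0 // ltrD2r.
case: ifP => _; last by rewrite mule0.
rewrite -!EFinD -EFinM; congr (_%:E); field; by rewrite gt_eqF.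
Qed.

Notation gR := (measurableTypeR R).
Definition leb1 : {sigma_finite_measure set gR -> \bar R} := leb.
Definition vol2 : {sigma_finite_measure set (gR * gR)%type -> \bar R} :=
  prodm leb1 leb1.
Definition vol3 : {sigma_finite_measure set (gR * gR * gR)%type -> \bar R} :=
  prodm vol2 leb1.
Definition vol : {sigma_finite_measure set (gR * gR * gR * gR)%type -> \bar R} :=
  prodm vol3 leb1.

Lemma measurable_fd : measurable_fun [set: (gR * gR * gR * gR)%type] (@fd R).
Proof.
exact: (measurableT_comp measurable_fst (measurableT_comp measurable_fst measurable_fst)).
Qed.
Lemma measurable_fy : measurable_fun [set: (gR * gR * gR * gR)%type] (@fy R).
Proof.
exact: (measurableT_comp measurable_snd (measurableT_comp measurable_fst measurable_fst)).
Qed.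
Lemma measurable_fx : measurable_fun [set: (gR * gR * gR * gR)%type] (@fx R).
Proof. exact: (measurableT_comp measurable_snd measurable_fst). Qed.
Lemma measurable_fa : measurable_fun [set: (gR * gR * gR * gR)%type] (@fa R).
Proof. exact: measurable_snd. Qed.

End Leb.

Ltac mfun := lazymatch goal with
  | |- measurable_fun _ (fun x => @?f x + @?g x) =>
      apply: (@measurable_funD _ _ _ _ f g); mfun
  | |- measurable_fun _ (fun x => @?f x * @?g x) =>
      apply: (@measurable_funM _ _ _ _ f g); mfun
  | |- measurable_fun _ (fun x => - @?f x) =>
      apply: (@measurable_funN _ _ _ _ f); mfun
  | |- measurable_fun _ (fun x => @?f x ^+ _) =>
      apply: (@measurable_funX _ _ _ _ f); mfun
  | |- measurable_fun _ (fun x => fd x) => exact: measurable_fd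
  | |- measurable_fun _ (fun x => fy x) => exact: measurable_fy
  | |- measurable_fun _ (fun x => fx x) => exact: measurable_fx
  | |- measurable_fun _ (fun x => fa x) => exact: measurable_fa
  | |- measurable_fun _ (@fd _) => exact: measurable_fd
  | |- measurable_fun _ (@fy _) => exact: measurable_fy
  | |- measurable_fun _ (@fx _) => exact: measurable_fx
  | |- measurable_fun _ (@fa _) => exact: measurable_fa
  | |- measurable_fun _ (fun x => ?c) => first [assumption | exact: measurable_cst]
  | |- _ => try assumption
  end.

Section Shears.
Variable R : realType.
Notation leb := (@lebesgue_measure R).
Notation gR := (measurableTypeR R).
Notation mform := (gR * gR * gR * gR)%type.
Notation leb1 := (leb1 R).
Notation vol2 := (vol2 R).
Notation vol3 := (vol3 R).
Notation vol := (vol R).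

(** Preimages under f have c times the volume, so f itself divides volumes by c. *)
Definition volscale (c : R) (f : hform R -> hform R) : Prop :=
  measurable_fun [set: mform] (f : mform -> mform) /\
  forall A : set mform, measurable A -> vol (f @^-1` A) = (c%:E * vol A)%E.

Lemma volscale_comp c c' f g : volscale c f -> volscale c' g ->
  volscale (c' * c) (f \o g).
Proof.
move=> [mf fE] [mg gE]; split; first exact: measurableT_comp mf mg.
move=> A mA; rewrite comp_preimage gE; last first.
  by rewrite -[X in measurable X]setTI; exact: mf.
by rewrite fE // muleA EFinM.
Qed.

Lemma volscale_ext c f g : f =1 g -> volscale c f -> volscale c g.
Proof. by move=> /funext ->. Qed.

Lemma measurable_form (d y x a : mform -> R) :
  measurable_fun setT d -> measurable_fun setT y -> measurable_fun setT x ->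
  measurable_fun setT a ->
  measurable_fun [set: mform] ((fun K => mkf (d K) (y K) (x K) (a K)) : mform -> mform).
Proof.
by move=> md my mx ma; do 3!apply: measurable_fun_pair => //.
Qed.

Lemma leb_shift (b : R) (A : set gR) : measurable A ->
  leb ((fun x => x + b) @^-1` A) = leb A.
Proof.
move=> mA; have := leb_affine b ltr01 mA.
by rewrite invr1 mul1e; under [X in X @^-1` A]funext => x do rewrite mul1r.
Qed.

(** A map that changes one coordinate by a function of the other three is a translation, or
    here an affine map, in each fibre; [shear_x], [shear_y] and [shear_d] are the same for
    the other coordinates. *)
Lemma shear_a (c : R) (g : hform R -> R) : 0 < c ->
  measurable_fun [set: mform] (g : mform -> gR) ->
  (forall K a, g (mkf (fd K) (fy K) (fx K) a) = g K) ->
  volscale c^-1 (fun K => mkf (fd K) (fy K) (fx K) (c * fa K + g K)).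
Proof.
move=> c0 mg gE; split; first by apply: measurable_form; mfun.
move=> A mA.
pose F : mform -> gR := fun p => c * fa p + g p.
have mF : measurable_fun setT F by rewrite /F; mfun.
have c1 : 0 <= c^-1 by rewrite invr_ge0 ltW.
rewrite (_ : (fun K => mkf _ _ _ _) = (fun p : mform => (p.1, F p))); last first.
  by apply/funext => -[[[d y] x] a].
apply: (@measure_fiber_right _ _ _ _ _ vol3 leb1 F c^-1 c1 mF _ A mA).
move=> [[d y] x] B mB.
rewrite -[RHS](leb_affine (g (d, y, x, 0)) c0 mB) /=.
congr (leb _); apply/funext => a /=.
by rewrite /F -(gE (d, y, x, 0) a).
Qed.

Lemma shear_x (g : hform R -> R) :
  measurable_fun [set: mform] (g : mform -> gR) ->
  (forall K x, g (mkf (fd K) (fy K) x (fa K)) = g K) ->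
  volscale 1 (fun K => mkf (fd K) (fy K) (fx K + g K) (fa K)).
Proof.
move=> mg gE; split; first by apply: measurable_form; mfun.
move=> A mA.
pose F : mform -> (gR * gR * gR)%type := fun p => (p.1.1, fx p + g p).
have mF1 : measurable_fun setT ((fun p => fx p + g p) : mform -> gR) by mfun.
have mF : measurable_fun setT F.
  by apply: measurable_fun_pair => //; exact: (measurableT_comp measurable_fst measurable_fst).
rewrite (_ : (fun K => mkf _ _ _ _) = (fun p : mform => (F p, p.2))); last first.
  by apply/funext => -[[[d y] x] a].
apply: (@measure_fiber_left _ _ _ _ _ vol3 leb1 F 1 ler01 mF _ A mA).
move=> a B mB.
pose G : (gR * gR * gR)%type -> gR := fun p => fx (p, a) + g (p, a).
have mG : measurable_fun setT G.
  apply: (measurableT_comp mF1); exact: measurable_fun_pair.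
rewrite (_ : (fun p => _) = (fun p : (gR * gR * gR)%type => (p.1, G p))); last first.
  by apply/funext => -[[d y] x].
apply: (@measure_fiber_right _ _ _ _ _ vol2 leb1 G 1 ler01 mG _ B mB).
move=> [d y] C mC.
rewrite mul1e -[RHS](leb_shift (g (d, y, 0, a)) mC) /=.
congr (leb _); apply/funext => x /=.
by rewrite /G -(gE (d, y, 0, a) x).
Qed.

Lemma shear_y (g : hform R -> R) :
  measurable_fun [set: mform] (g : mform -> gR) ->
  (forall K y, g (mkf (fd K) y (fx K) (fa K)) = g K) ->
  volscale 1 (fun K => mkf (fd K) (fy K + g K) (fx K) (fa K)).
Proof.
move=> mg gE; split; first by apply: measurable_form; mfun.
move=> A mA.
pose F : mform -> (gR * gR * gR)%type := fun p => (fd p, fy p + g p, fx p).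
have mF1 : measurable_fun setT ((fun p => fy p + g p) : mform -> gR) by mfun.
have mF : measurable_fun setT F.
  by do 2?[apply: measurable_fun_pair => //]; mfun.
rewrite (_ : (fun K => mkf _ _ _ _) = (fun p : mform => (F p, p.2))); last first.
  by apply/funext => -[[[d y] x] a].
apply: (@measure_fiber_left _ _ _ _ _ vol3 leb1 F 1 ler01 mF _ A mA).
move=> a B mB.
pose G : (gR * gR * gR)%type -> (gR * gR)%type :=
  fun p => (p.1.1, fy (p, a) + g (p, a)).
have mG1 : measurable_fun setT (fun p : (gR * gR * gR)%type => fy (p, a) + g (p, a) : gR).
  apply: (measurableT_comp mF1); exact: measurable_fun_pair.
have mG : measurable_fun setT G.
  by apply: measurable_fun_pair => //; exact: (measurableT_comp measurable_fst measurable_fst).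
rewrite (_ : (fun p => _) = (fun p : (gR * gR * gR)%type => (G p, p.2))); last first.
  by apply/funext => -[[d y] x].
apply: (@measure_fiber_left _ _ _ _ _ vol2 leb1 G 1 ler01 mG _ B mB).
move=> x C mC.
pose H : (gR * gR)%type -> gR := fun p => fy (p, x, a) + g (p, x, a).
have mH : measurable_fun setT H.
  by apply: (measurableT_comp mG1); exact: measurable_fun_pair.
rewrite (_ : (fun p => _) = (fun p : (gR * gR)%type => (p.1, H p))); last first.
  by apply/funext => -[d y].
apply: (@measure_fiber_right _ _ _ _ _ leb1 leb1 H 1 ler01 mH _ C mC).
move=> d D mD.
rewrite mul1e -[RHS](leb_shift (g (d, 0, x, a)) mD) /=.
congr (leb _); apply/funext => y /=.
by rewrite /H -(gE (d, 0, x, a) y).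
Qed.

Lemma shear_d (g : hform R -> R) :
  measurable_fun [set: mform] (g : mform -> gR) ->
  (forall K d, g (mkf d (fy K) (fx K) (fa K)) = g K) ->
  volscale 1 (fun K => mkf (fd K + g K) (fy K) (fx K) (fa K)).
Proof.
move=> mg gE; split; first by apply: measurable_form; mfun.
move=> A mA.
pose F : mform -> (gR * gR * gR)%type := fun p => (fd p + g p, fy p, fx p).
have mF1 : measurable_fun setT ((fun p => fd p + g p) : mform -> gR) by mfun.
have mF : measurable_fun setT F.
  by do 2?[apply: measurable_fun_pair => //]; mfun.
rewrite (_ : (fun K => mkf _ _ _ _) = (fun p : mform => (F p, p.2))); last first.
  by apply/funext => -[[[d y] x] a].
apply: (@measure_fiber_left _ _ _ _ _ vol3 leb1 F 1 ler01 mF _ A mA).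
move=> a B mB.
pose G : (gR * gR * gR)%type -> (gR * gR)%type :=
  fun p => (fd (p, a) + g (p, a), p.1.2).
have mG1 : measurable_fun setT (fun p : (gR * gR * gR)%type => fd (p, a) + g (p, a) : gR).
  apply: (measurableT_comp mF1); exact: measurable_fun_pair.
have mG : measurable_fun setT G.
  by apply: measurable_fun_pair => //; exact: (measurableT_comp measurable_snd measurable_fst).
rewrite (_ : (fun p => _) = (fun p : (gR * gR * gR)%type => (G p, p.2))); last first.
  by apply/funext => -[[d y] x].
apply: (@measure_fiber_left _ _ _ _ _ vol2 leb1 G 1 ler01 mG _ B mB).
move=> x C mC.
pose H : (gR * gR)%type -> gR := fun p => fd (p, x, a) + g (p, x, a).
have mH : measurable_fun setT H.
  by apply: (measurableT_comp mG1); exact: measurable_fun_pair.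
rewrite (_ : (fun p => _) = (fun p : (gR * gR)%type => (H p, p.2))); last first.
  by apply/funext => -[d y].
apply: (@measure_fiber_left _ _ _ _ _ leb1 leb1 H 1 ler01 mH _ C mC).
move=> y D mD.
rewrite mul1e -[RHS](leb_shift (g (0, y, x, a)) mD) /=.
congr (leb _); apply/funext => d /=.
by rewrite /H -(gE (0, y, x, a) d).
Qed.

Lemma volpres_comp f g : volscale 1 f -> volscale 1 g -> volscale 1 (f \o g).
Proof. by move=> /volscale_comp H /H; rewrite mul1r. Qed.

Lemma volpres_a (g : hform R -> R) :
  measurable_fun [set: mform] (g : mform -> gR) ->
  (forall K a, g (mkf (fd K) (fy K) (fx K) a) = g K) ->
  volscale 1 (fun K => mkf (fd K) (fy K) (fx K) (fa K + g K)).
Proof.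
move=> mg gE; have := shear_a ltr01 mg gE; rewrite invr1.
by apply: volscale_ext => K; rewrite mul1r.
Qed.

Lemma mx2E (a b c d : R[i]) : ((mx2 a b c d 0 0 = a) * (mx2 a b c d 0 1 = b) *
  (mx2 a b c d 1 0 = c) * (mx2 a b c d 1 1 = d))%type.
Proof. by rewrite !mxE. Qed.

(** A parabolic element acts on forms as a product of three shears. *)
Lemma volpres_upper (z : R[i]) : volscale 1 (fmove (mx2 1 z 0 1)).
Proof.
pose ga K := 2 * (complex.Re z * fx K + complex.Im z * fy K) + sqnorm z * fd K.
have Ha : volscale 1 (fun K => mkf (fd K) (fy K) (fx K) (fa K + ga K)).
  by apply: volpres_a => //; rewrite /ga; mfun.
have Hy : volscale 1 (fun K => mkf (fd K) (fy K + complex.Im z * fd K) (fx K) (fa K)).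
  by apply: shear_y => //; mfun.
have Hx : volscale 1 (fun K => mkf (fd K) (fy K) (fx K + complex.Re z * fd K) (fa K)).
  by apply: shear_x => //; mfun.
apply: volscale_ext (volpres_comp Hx (volpres_comp Hy Ha)) => -[[[d y] x] a].
rewrite /= /fmove !mx2E /ga {ga Ha Hy Hx}; case: z => u v.
rewrite /mkf /fb /fd /fy /fx /fa /sqnorm /=.
by congr (_, _, _, _); rewrite ?cE /=; ring.
Qed.

Lemma volpres_lower (z : R[i]) : volscale 1 (fmove (mx2 1 0 z 1)).
Proof.
pose gd K := 2 * (complex.Re z * fx K - complex.Im z * fy K) + sqnorm z * fa K.
have Ha : volscale 1 (fun K => mkf (fd K + gd K) (fy K) (fx K) (fa K)).
  by apply: shear_d => //; rewrite /gd; mfun.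
have Hy : volscale 1 (fun K => mkf (fd K) (fy K + - complex.Im z * fa K) (fx K) (fa K)).
  by apply: shear_y => //; mfun.
have Hx : volscale 1 (fun K => mkf (fd K) (fy K) (fx K + complex.Re z * fa K) (fa K)).
  by apply: shear_x => //; mfun.
apply: volscale_ext (volpres_comp Hx (volpres_comp Hy Ha)) => -[[[d y] x] a].
rewrite /= /fmove !mx2E /gd {gd Ha Hy Hx}; case: z => u v.
rewrite /mkf /fb /fd /fy /fx /fa /sqnorm /=.
by congr (_, _, _, _); rewrite ?cE /=; ring.
Qed.

Lemma mulmx2 (a b c d a' b' c' d' : R[i]) : mx2 a b c d *m mx2 a' b' c' d' =
  mx2 (a * a' + b * c') (a * b' + b * d') (c * a' + d * c') (c * b' + d * d').
Proof. by rewrite [LHS]mx2_eta !mulmx2E !mx2E. Qed.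

(** SL2 is generated by upper and lower unipotent matrices: a matrix with nonzero lower left
    entry is a product upper, lower, upper, and the others are a product of such a matrix
    with a lower one. *)
Lemma volpres_fmove (A : 'M[R[i]]_2) : \det A = 1 -> volscale 1 (fmove A).
Proof.
have main (B : 'M[R[i]]_2) : \det B = 1 -> B 1 0 != 0 -> volscale 1 (fmove B).
  move=> dB c0.
  have -> : B = mx2 1 ((B 0 0 - 1) / B 1 0) 0 1 *m (mx2 1 0 (B 1 0) 1 *m
                mx2 1 ((B 1 1 - 1) / B 1 0) 0 1).
    rewrite [LHS]mx2_eta !mulmx2.
    have bE : B 0 1 = (B 0 0 * B 1 1 - 1) / B 1 0.
      by rewrite -dB det2E opprB addrC subrK mulfK.
    by rewrite bE; congr mx2; field.
  apply: (volscale_ext (f := fmove (mx2 1 ((B 0 0 - 1) / B 1 0) 0 1) \o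
    (fmove (mx2 1 0 (B 1 0) 1) \o fmove (mx2 1 ((B 1 1 - 1) / B 1 0) 0 1)))).
    by move=> K; rewrite !fmoveM.
  apply: volpres_comp; first exact: volpres_upper.
  apply: volpres_comp; [exact: volpres_lower|exact: volpres_upper].
move=> dA; have [c0|] := eqVneq (A 1 0) 0; last exact: main.
have AE : A = (A *m mx2 1 0 1 1) *m mx2 1 0 (-1) 1.
  rewrite -mulmxA mulmx2.
  rewrite [X in _ *m X](_ : _ = 1%:M) ?mulmx1 //.
  rewrite [RHS]mx2_eta !mxE /=; congr mx2; ring.
rewrite AE.
apply: (volscale_ext (f := fmove (A *m mx2 1 0 1 1) \o fmove (mx2 1 0 (-1) 1))).
  by move=> K; rewrite [RHS]fmoveM.
apply: volpres_comp; last exact: volpres_lower.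
apply: main; first by rewrite det_mulmx dA det_mx2 mulr1 mul0r subr0 mulr1.
rewrite mulmx2E !mx2E c0 mul0r add0r mulr1.
by apply: contra_eq_neq dA => d0; rewrite det2E c0 d0 !mulr0 subr0 eq_sym oner_eq0.
Qed.

Lemma volpres_gm (g : PSL2 R) : volscale 1 (gm g).
Proof. exact: volpres_fmove (lift_det g). Qed.

(** This is vertical: d, x and y are kept, and det K = a d - x^2 - y^2 is divided by 4, so
    that the height is halved. It is the flow away from the ideal point oo. *)
Definition flow0 (K : hform R) : hform R :=
  mkf (fd K) (fy K) (fx K)
    (4^-1 * fa K + (3 / 4) * ((fx K ^+ 2 + fy K ^+ 2) / fd K)).
Definition flow0V (K : hform R) : hform R :=
  mkf (fd K) (fy K) (fx K)
    (4 * fa K + - 3 * ((fx K ^+ 2 + fy K ^+ 2) / fd K)).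

Lemma flow0K : cancel flow0 flow0V.
Proof.
move=> [[[d y] x] a]; rewrite /flow0 /flow0V /fd /fy /fx /fa /=.
congr (_, _, _, _); set q := _ / d; by field.
Qed.
Lemma flow0VK : cancel flow0V flow0.
Proof.
move=> [[[d y] x] a]; rewrite /flow0 /flow0V /fd /fy /fx /fa /=.
congr (_, _, _, _); set q := _ / d; by field.
Qed.

Lemma measurable_inv : measurable_fun [set: gR] (fun x : gR => x^-1 : gR).
Proof.
rewrite (_ : setT = [set x : R | x != 0] `|` [set 0]); last first.
  by apply/seteqP; split=> x //= _; have [->|] := eqVneq x 0; [right|left].
have op : open [set x : R | x != 0] by exact: open_neq.
apply/measurable_funU; [exact: open_measurable|exact: measurable_set1|].
split; last exact: measurable_fun_set1.
by apply: open_continuous_measurable_fun => // x; rewrite inE; exact: inv_continuous.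
Qed.
Lemma measurable_q : measurable_fun [set: mform]
  ((fun K => (fx K ^+ 2 + fy K ^+ 2) / fd K) : mform -> gR).
Proof.
apply: measurable_funM; first by mfun.
exact: measurableT_comp measurable_inv (@measurable_fd R).
Qed.

(** In the coordinate a the flow is affine of slope 1/4. *)
Lemma volscale_flow0 : volscale 4 flow0.
Proof.
rewrite -[4]invrK; apply: shear_a.
- by rewrite invr_gt0.
- by apply: measurable_funM => //; exact: measurable_q.
- by [].
Qed.

Lemma volscale_flow0V : volscale 4^-1 flow0V.
Proof.
apply: shear_a => //.
by apply: measurable_funM => //; exact: measurable_q.
Qed.
End Shears.

(** * Three volume estimates *)

Section Vol.
Variable R : realType.
Notation leb := (@lebesgue_measure R).
Notation gR := (measurableTypeR R).
Notation mform := (gR * gR * gR * gR)%type.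
Notation leb1 := (leb1 R).
Notation vol2 := (vol2 R).
Notation vol3 := (vol3 R).
Notation vol := (vol R).

Lemma vol_hyperplane0 : vol [set K : mform | fx K = 0] = 0%E.
Proof.
pose Z : set gR := [set 0].
have -> : [set K : mform | fx K = 0] = ((setT `*` Z) `*` setT : set mform).
  by apply/seteqP; split=> -[[[d y] x] a] /= => [e|[[_ e] _]].
have mZ : measurable Z by exact: measurable_set1.
have -> : vol ((setT `*` Z) `*` setT) = (vol3 (setT `*` Z) * leb1 setT)%E.
  by apply: product_measure1E => //; apply: measurableX.
have -> : vol3 (setT `*` Z) = (vol2 setT * leb1 Z)%E.
  exact: product_measure1E.
have -> : leb1 Z = 0%E by exact: lebesgue_measure_set1.
by rewrite mule0 mul0e.
Qed.

Lemma measurable_hyperplane0 : measurable [set K : mform | fx K = 0].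
Proof.
rewrite -[X in measurable X]setTI.
have := measurable_fx (R := R) measurableT (measurable_set1 (0 : gR)).
by [].
Qed.

Lemma vol_hyperplane (g : PSL2 R) : vol [set K : mform | fx (gm g K) = 0] = 0%E.
Proof.
have [_ /(_ _ measurable_hyperplane0) E] := volpres_gm g.
by have := E; rewrite vol_hyperplane0 mule0.
Qed.

Lemma vol_nbhs_gt0 (K : hform R) (U : set mform) : measurable U ->
  nbhs K (U : set (hform R)) -> (0 < vol U)%E.
Proof.
case: K => [[[d y] x] a] mU /nbhs_ballP [e /= e0 eU].
pose I (c : R) : set gR := [set` Interval (BRight (c - e)) (BLeft (c + e))].
have mI c : measurable (I c) by exact: measurable_itv.
have vI c : leb1 (I c) = (e *+ 2)%:E.
  rewrite [LHS](lebesgue_measure_itv (Interval (BRight (c - e)) (BLeft (c + e)))) /=.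
  rewrite lte_fin ltrBlDr -addrA ltrDl -mulr2n pmulrn_lgt0 // e0.
  by rewrite -EFinD; congr (_%:E); rewrite mulr2n; ring.
pose B : set mform := I d `*` I y `*` I x `*` I a.
have mB : measurable B by do 3?apply: measurableX.
apply: (@lt_le_trans _ _ (vol B)); last first.
  apply: le_measure; rewrite ?inE // => -[[[d' y'] x'] a'].
  rewrite /B /I /= !in_itv /= => -[[[/andP[? ?] /andP[? ?]] /andP[? ?]] /andP[? ?]].
  apply: eU; do 3?split => /=; rewrite /ball /= ltr_norml; apply/andP; split; lra.
have -> : vol B = (vol3 (I d `*` I y `*` I x) * leb1 (I a))%E.
  by apply: product_measure1E => //; do 2?apply: measurableX.
have -> : vol3 (I d `*` I y `*` I x) = (vol2 (I d `*` I y) * leb1 (I x))%E.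
  by apply: product_measure1E => //; apply: measurableX.
have -> : vol2 (I d `*` I y) = (leb1 (I d) * leb1 (I y))%E.
  exact: product_measure1E.
by rewrite !vI -!EFinM lte_fin !mulr_gt0 // pmulrn_lgt0.
Qed.

(** The factor 1 / d of the thickness in the direction a cancels the length d of the
    interval 0 <= x < d, which leaves an integral over a rectangle of the (d, y)-plane. *)
Lemma vol_thin (L : set mform) (A B c : R) (f : (gR * gR * gR)%type -> R) :
  measurable L -> 0 < A -> 0 < B -> 0 <= c ->
  (forall K, L K -> [/\ 0 < fd K <= A, `|fy K| <= B, 0 <= fx K < fd K &
     f K.1 <= fa K <= f K.1 + c / fd K]) ->
  (vol L <= (c * (A * (2 * B)))%:E)%E.
Proof.
move=> mL A0 B0 c0 LP.
pose D2 : set (gR * gR)%type := `]0, A]%classic `*` `[- B, B]%classic.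
pose D3 : set (gR * gR * gR)%type :=
  [set t | D2 t.1 /\ 0 <= t.2 < t.1.1].
have mD2 : measurable D2 by apply: measurableX; exact: measurable_itv.
have mD3 : measurable D3.
  have m1 : measurable_fun [set: (gR * gR * gR)%type] (fun t : (gR * gR * gR)%type => t.2 : R).
    exact: measurable_snd.
  have m2 : measurable_fun [set: (gR * gR * gR)%type] (fun t : (gR * gR * gR)%type => t.1.1 : R).
    exact: (measurableT_comp measurable_fst measurable_fst).
  have -> : D3 = (fst @^-1` D2) `&` ((fun t : (gR * gR * gR)%type => 0 <= (t.2 : R)) @^-1` [set true]
       `&` (fun t : (gR * gR * gR)%type => (t.2 : R) < t.1.1) @^-1` [set true]).
    apply/seteqP; split=> t /=; first by move=> [? /andP[-> ->]].
    by move=> [? [h1 h2]]; split=> //; rewrite h1 h2.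
  apply: measurableI; first by rewrite -[X in measurable X]setTI; exact: measurable_fst.
  apply: measurableI; rewrite -[X in measurable X]setTI.
    by apply: measurable_fun_ler => //; exact: measurable_cst.
  by apply: measurable_fun_ltr.
pose h (t : (gR * gR * gR)%type) : \bar R := (c * (t.1.1)^-1 * \1_D3 t)%:E.
have h0 t : (0 <= h t)%E.
  rewrite /h lee_fin indicE; case: (boolP (t \in D3)) => [|_]; last by rewrite mulr0.
  rewrite inE => -[[/=]]; rewrite !in_itv /= => /andP[d0 _] _ _.
  by rewrite mulr1 mulr_ge0 // invr_ge0 ltW.
have mh : measurable_fun [set: (gR * gR * gR)%type] h.
  apply/measurable_EFinP; apply: measurable_funM; last exact: measurable_indic.
  apply: measurable_funM => //.
  apply: (measurableT_comp (@measurable_inv R)).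
  exact: (measurableT_comp measurable_fst measurable_fst).
have vE : vol L = (\int[vol3]_t leb1 (xsection L t))%E by [].
have step1 : (vol L <= \int[vol3]_t h t)%E.
  rewrite vE; apply: ge0_le_integral => //; first exact: measurable_fun_xsection.
  move=> [[d y] x] _; rewrite /h indicE.
  have [tD|tD] := boolP (((d, y, x) : (gR * gR * gR)%type) \in D3).
    rewrite mulr1.
    have d0 : 0 < d by move: tD; rewrite inE => -[[/=]]; rewrite !in_itv /= => /andP[].
    have sub : xsection L (d, y, x) `<=` `[f (d, y, x), f (d, y, x) + c / d]%classic.
      by move=> a; rewrite /xsection /= inE => /LP[_ _ _]; rewrite in_itv.
    apply: (le_trans (le_measure leb1 _ _ sub)); rewrite ?inE.
    - exact: measurable_xsection.
    - exact: measurable_itv.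
    rewrite [leLHS](lebesgue_measure_itv `[f (d, y, x), f (d, y, x) + c / d]) /=.
    case: ifP => _; last by rewrite lee_fin mulr_ge0 // invr_ge0 ltW.
    by rewrite -EFinD lee_fin addrAC subrr add0r.
  rewrite mulr0 (_ : xsection L (d, y, x) = set0) ?measure0 //.
  apply/seteqP; split=> // a; rewrite /xsection /= inE => La.
  move/negP: tD; apply; rewrite inE /D3 /D2 /=.
  have [/andP[? ?] + /andP[? ?] _] := LP _ La.
  by rewrite !in_itv /= ler_norml => ->; split=> //; [split=> //; apply/andP|apply/andP].
apply: (le_trans step1).
have -> : (\int[vol3]_t h t = \int[vol2]_s \int[leb1]_x h (s, x))%E.
  exact: (@fubini_tonelli1 _ _ _ _ _ vol2 leb1 h mh h0).
have inner s : (\int[leb1]_x h (s, x) = (c * \1_D2 s)%:E)%E.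
  rewrite /h indicE; have [sD|sD] := boolP (s \in D2).
    have d0 : 0 < s.1 by move: sD; rewrite inE => -[/=]; rewrite !in_itv /= => /andP[].
    pose J : set gR := `[0, s.1[%classic.
    rewrite mulr1.
    have E1 x : ((c * s.1^-1 * \1_D3 (s, x))%:E = (c * s.1^-1)%:E * (\1_J x)%:E)%E.
      rewrite EFinM; congr (_ * _%:E)%E; rewrite !indicE; congr ((nat_of_bool _)%:R).
      rewrite /J; apply/idP/idP; rewrite !inE /D3 /= in_itv /=; first by case.
      by move=> ?; split=> //; move: sD; rewrite inE.
    under eq_integral => x _ do rewrite E1.
    have mJ : measurable J by exact: measurable_itv.
    have mJ1 : measurable_fun [set: gR] (fun x => (\1_J x)%:E : \bar R).
      by apply/measurable_EFinP; exact: measurable_indic.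
    have k0 : 0 <= c / s.1 by rewrite mulr_ge0 // invr_ge0 ltW.
    rewrite ge0_integralZl_EFin //.
    have -> : (\int[leb1]_x (\1_J x)%:E = (s.1)%:E)%E.
      rewrite integral_indic // setIT.
      by rewrite [LHS](lebesgue_measure_itv `[0, s.1[) /= lte_fin d0 -EFinD subr0.
    rewrite -EFinM.
    by congr (_%:E); rewrite divfK // gt_eqF.
  rewrite mulr0 integral0_eq // => x _.
  rewrite indicE (_ : ((s, x) \in D3) = false) ?mulr0 //.
  by apply/negP; rewrite inE => -[sD' _]; move/negP: sD; apply; rewrite inE.
under eq_integral => s _ do rewrite inner EFinM.
have mJ1 : measurable_fun [set: (gR * gR)%type] (fun x => (\1_D2 x)%:E : \bar R).
  by apply/measurable_EFinP; exact: measurable_indic.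
rewrite ge0_integralZl_EFin //.
rewrite integral_indic // setIT.
have E2 : vol2 D2 = (leb1 `]0%R, A]%classic * leb1 `[(- B)%R, B]%classic)%E.
  by apply: product_measure1E; exact: measurable_itv.
have E3 : (leb1 `]0%R, A]%classic = A%:E)%E.
  by rewrite [LHS](lebesgue_measure_itv `]0, A]) /= lte_fin A0 -EFinD subr0.
have E4 : (leb1 `[(- B)%R, B]%classic = (2 * B)%:E)%E.
  rewrite [LHS](lebesgue_measure_itv `[- B, B]) /= lte_fin gtrN // -EFinD opprK.
  by congr (_%:E); ring.
rewrite [X in (_ * X)%E](_ : _ = (A * (2 * B))%:E) -?EFinM //.
by rewrite [LHS]E2 E3 E4.
Qed.

Section Pieces.
Variables (I : countType) (E : I -> set mform) (f g : I -> hform R -> hform R).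
Hypothesis mE : forall i, measurable (E i).
Hypothesis fS : forall i, volscale 4 (f i).
Hypothesis gS : forall i, measurable_fun [set: mform] (g i : mform -> mform).
Hypothesis fK : forall i, cancel (f i) (g i).
Hypothesis gK : forall i, cancel (g i) (f i).
Hypothesis fE : forall i j K L, E i K -> E j L -> f i K = f j L -> i = j.

(** The images of the pieces are disjoint parts of A, and passing to preimages multiplies
    their volumes by 4. *)
Lemma vol_pieces (A : set mform) : measurable A ->
  (vol (\bigcup_i (E i `&` f i @^-1` A)) <= 4%:E * vol A)%E.
Proof.
move=> mA.
pose X (o : option I) : set mform := if o is Some i then E i `&` f i @^-1` A else set0.
pose B (o : option I) : set mform := if o is Some i then g i @^-1` (E i) `&` A else set0.
have mB o : measurable (B o).
  case: o => [i|]; last exact: measurable0.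
  rewrite /B; apply: measurableI; last exact: mA.
  by rewrite -[X in measurable X]setTI; apply: gS.
have XB o : X o = if o is Some i then f i @^-1` (B o) else set0.
  case: o => [i|] //=; apply/seteqP; split=> K /=; first by move=> [? ?]; rewrite fK.
  by rewrite fK.
have mX o : measurable (X o).
  rewrite XB; case: o => [i|] //; rewrite -[X in measurable X]setTI.
  by apply: (fS i).1.
have vX o : vol (X o) = (4%:E * vol (B o))%E.
  rewrite XB; case: o => [i|]; first by rewrite (fS i).2 //; exact: mB.
  by rewrite /B !measure0 mule0.
pose pv (n : nat) : option I := pickle_inv n.
have tB : trivIset setT (fun n => B (pv n)).
  apply/trivIsetP => m n _ _ mn; apply/seteqP; split=> // K [].
  case Em : (pv m) => [i|] //=; case En : (pv n) => [j|] //=.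
  move=> [Ei _] [Ej _]; case/eqP: mn.
  have ij : i = j by apply: (fE Ei Ej); rewrite !gK.
  have := @pickle_invK I m; have := @pickle_invK I n.
  by rewrite -/(pv m) -/(pv n) Em En /= ij => <- <-.
have -> : \bigcup_i (E i `&` f i @^-1` A) = \bigcup_n X (pv n).
  apply/seteqP; split=> K [] => [i _ KX|n _].
    by exists (pickle i) => //; rewrite /pv pickleK_inv.
  by case: (pv n) => [i|] //= KX; exists i.
apply: (@le_trans _ _ (\sum_(0 <= n <oo) vol (X (pv n)))%E).
  apply: (measure_sigma_subadditive vol) => //.
  by apply: bigcupT_measurable => n; exact: mX.
under eq_eseriesr do rewrite vX.
rewrite nneseriesZl //; apply: lee_wpmul2l => //.
rewrite (_ : (\sum_(0 <= i <oo) _)%E = vol (\bigcup_n B (pv n))); last first.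
  rewrite measure_bigcup //.
  by apply: eq_eseriesl => n; rewrite in_setT.
apply: le_measure; rewrite ?inE //; first by apply: bigcupT_measurable => n.
by move=> K [n _]; case: (pv n) => [i|] //= [].
Qed.
End Pieces.
End Vol.

(** * Tiles, and the lack of room high above a cusp *)

Section Geo.
Variable R : realType.
Implicit Types (K L H : hform R) (g : PSL2 R).

Lemma gm_upper (z : R[i]) K : gm (upper z) K = mkf (fd K)
  (fy K + complex.Im z * fd K) (fx K + complex.Re z * fd K)
  (fa K + 2 * (complex.Re z * fx K + complex.Im z * fy K) + sqnorm z * fd K).
Proof.
rewrite gm_psl /= /fmove !mx2E /mkf; case: z => u v; case: K => [[[d y] x] a].
rewrite /fb /fd /fy /fx /fa /sqnorm /=.
by congr (_, _, _, _); rewrite ?cE /=; ring.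
Qed.

Lemma gm_u (r : R) K : gm (u_ r) K = mkf (fd K) (fy K) (fx K + r * fd K)
  (fa K + 2 * (r * fx K) + r ^+ 2 * fd K).
Proof.
rewrite gm_upper /=; apply: hformP => //; rewrite /fa /fy /mkf /sqnorm /=; ring.
Qed.

Lemma fpos_comb (s t : R) K L : 0 <= s -> 0 <= t -> 0 < s + t ->
  fpos K -> fpos L -> fpos (fcomb s K t L).
Proof.
move=> s0 t0 st pK pL; have q := bip_pos pK pL.
have [dK DK] := pK; have [dL DL] := pL.
have DE : fdet (fcomb s K t L) = s ^+ 2 * fdet K + t ^+ 2 * fdet L + s * t * bip K L.
  by rewrite /fdet /bip !fcombE; ring.
have h1 := mulr_ge0 (sqr_ge0 s) (ltW DK); have h2 := mulr_ge0 (sqr_ge0 t) (ltW DL).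
have h3 := mulr_ge0 (mulr_ge0 s0 t0) (ltW q).
have [s1|s1] := ltP 0 s.
  have h4 := mulr_gt0 (mulr_gt0 s1 s1) DK; have h5 := mulr_gt0 s1 dK.
  have h6 := mulr_ge0 t0 (ltW dL).
  by split; [rewrite !fcombE|rewrite DE]; lra.
have t1 : 0 < t by lra.
have h4 := mulr_gt0 (mulr_gt0 t1 t1) DL; have h5 := mulr_gt0 t1 dL.
have h6 := mulr_ge0 s0 (ltW dK).
by split; [rewrite !fcombE|rewrite DE]; lra.
Qed.

(** The cone det > 0 has two components, and they are told apart by the sign of the pairing
    with a fixed positive form. *)
Lemma fpos_timelike K L : fpos K -> 0 < fdet L -> 0 < bip K L -> fpos L.
Proof.
move=> pK DL q; split=> //; rewrite ltNge; apply/negP => dL.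
have dL0 : fd L != 0.
  apply/eqP => e; move: DL; rewrite /fdet e mulr0.
  have := sqr_ge0 (fx L); have := sqr_ge0 (fy L); lra.
have pL : fpos (fscale (-1) L).
  split; first by rewrite fscaleE; move: dL; rewrite le_eqVlt (negbTE dL0) /=; lra.
  have -> : fdet (fscale (-1) L) = fdet L by rewrite /fdet !fscaleE; ring.
  exact: DL.
have := bip_pos pK pL.
have -> : bip K (fscale (-1) L) = - bip K L by rewrite /bip !fscaleE; ring.
lra.
Qed.

(** If L + Y is the image of L under a parabolic of displacement about e / sqrt(det L), at
    most 1 / T, then the signed distance of L to the plane fx = 0 drops by a proportion of
    order 1 / T only. All Y with the given invariants form an ellipsoid in the hyperplane
    bip L Y = e^2, and the bound estimates the minimum of a linear function on it. *)
Lemma displacement_bound L (Y : hform R) (e T : R) : 1 <= T -> 0 <= e ->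
  T ^+ 2 * e ^+ 2 <= fdet L -> 0 < fdet L ->
  fdet Y = - e ^+ 2 -> bip L Y = e ^+ 2 -> 0 <= fx L ->
  - (2 / T) * (fx L + Num.sqrt (fdet L)) <= fx Y.
Proof.
move=> T1 e0; set D := Num.sqrt (fdet L).
move=> TD DL DY q xL.
have D0 : 0 < D by rewrite sqrtr_gt0.
have D2 : fdet L = D ^+ 2 by rewrite sqr_sqrtr // ltW.
rewrite D2 in TD; clear DL; clearbody D.
have T0 : 0 < T by lra.
have TD1 : T * e <= D.
  have h : 0 <= T * e by rewrite mulr_ge0 // ltW.
  rewrite -(ler_pXn2r (n := 2)) ?nnegrE //; last exact: ltW.
  by rewrite exprMn.
move: D2 DY q xL; rewrite /fdet /bip.
move: (fa L) (fd L) (fx L) (fy L) (fa Y) (fd Y) (fx Y) (fy Y).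
move=> a d b1 b2 p k r1 r2 DL DY q b10.
(* This is 0 <= (a k - d p)^2, where a k + d p and a d, p k are known. *)
have key : 4 * (D ^+ 2 + b1 ^+ 2 + b2 ^+ 2) * (r1 ^+ 2 + r2 ^+ 2 - e ^+ 2)
   <= (e ^+ 2 + 2 * (b1 * r1 + b2 * r2)) ^+ 2.
  have h := sqr_ge0 (a * k - d * p).
  have e1 : a * d = D ^+ 2 + b1 ^+ 2 + b2 ^+ 2 by lra.
  have e2 : p * k = r1 ^+ 2 + r2 ^+ 2 - e ^+ 2 by lra.
  have e3 : a * k + d * p = e ^+ 2 + 2 * (b1 * r1 + b2 * r2) by lra.
  rewrite -e3 -e1 -e2 -subr_ge0.
  by have -> : (a * k + d * p) ^+ 2 - 4 * (a * d) * (p * k) = (a * k - d * p) ^+ 2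
    by ring.
pose W := D ^+ 2 + b1 ^+ 2 + b2 ^+ 2.
have W0 : 0 < W by have := sqr_ge0 b1; have := sqr_ge0 b2; have := exprn_gt0 2 D0; rewrite /W; lra.
pose x1 := r1 - e ^+ 2 * b1 / (2 * D ^+ 2).
pose x2 := r2 - e ^+ 2 * b2 / (2 * D ^+ 2).
have Dn : D != 0 by rewrite gt_eqF.
have ell : D ^+ 2 * (x1 ^+ 2 + x2 ^+ 2) + (b1 * x2 - b2 * x1) ^+ 2
   <= W * (e ^+ 2 + e ^+ 4 / (4 * D ^+ 2)).
  have E : W * (e ^+ 2 + e ^+ 4 / (4 * D ^+ 2)) -
     (D ^+ 2 * (x1 ^+ 2 + x2 ^+ 2) + (b1 * x2 - b2 * x1) ^+ 2) =
    ((e ^+ 2 + 2 * (b1 * r1 + b2 * r2)) ^+ 2 - 4 * W * (r1 ^+ 2 + r2 ^+ 2 - e ^+ 2)) / 4.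
    by rewrite /x1 /x2 /W; field.
  by rewrite -subr_ge0 E; apply: mulr_ge0 => //; rewrite subr_ge0.
have x1b : D ^+ 2 * x1 ^+ 2 <= (D ^+ 2 + b1 ^+ 2) * (e ^+ 2 + e ^+ 4 / (4 * D ^+ 2)).
  have E : (D ^+ 2 + b1 ^+ 2) * (D ^+ 2 * (x1 ^+ 2 + x2 ^+ 2) + (b1 * x2 - b2 * x1) ^+ 2)
     = D ^+ 2 * W * x1 ^+ 2 + ((D ^+ 2 + b1 ^+ 2) * x2 - b1 * b2 * x1) ^+ 2.
    by rewrite /W; ring.
  have c0 : 0 <= D ^+ 2 + b1 ^+ 2 by rewrite addr_ge0 ?sqr_ge0.
  have h2 := ler_wpM2l c0 ell; rewrite E in h2.
  have h1 := sqr_ge0 ((D ^+ 2 + b1 ^+ 2) * x2 - b1 * b2 * x1).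
  rewrite -(ler_pM2l W0).
  have -> : W * (D ^+ 2 * x1 ^+ 2) = D ^+ 2 * W * x1 ^+ 2 by ring.
  by rewrite [leRHS]mulrCA; apply: le_trans h2; rewrite lerDl.
have eD : e <= D by apply: le_trans TD1; rewrite ler_peMl.
have e4 : e ^+ 2 + e ^+ 4 / (4 * D ^+ 2) <= (5 / 4) * e ^+ 2.
  have : e ^+ 4 / (4 * D ^+ 2) <= e ^+ 2 / 4.
    rewrite ler_pdivrMr; last by rewrite mulr_gt0 // exprn_gt0.
    have -> : e ^+ 2 / 4 * (4 * D ^+ 2) = e ^+ 2 * D ^+ 2 by field.
    rewrite (_ : e ^+ 4 = e ^+ 2 * e ^+ 2); last by ring.
    by apply: ler_wpM2l; [exact: sqr_ge0|rewrite lerXn2r ?nnegrE // ltW].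
  lra.
have x1b2 : (D * x1) ^+ 2 <= ((5 / 4) * e * (D + b1)) ^+ 2.
  have h : D ^+ 2 + b1 ^+ 2 <= (D + b1) ^+ 2.
    by have := mulr_ge0 (ltW D0) b10; lra.
  have h0 : 0 <= D ^+ 2 + b1 ^+ 2 by rewrite addr_ge0 ?sqr_ge0.
  have := ler_wpM2l h0 e4.
  have h3 : (D ^+ 2 + b1 ^+ 2) * e ^+ 2 <= (D + b1) ^+ 2 * e ^+ 2.
    by apply: ler_wpM2r => //; exact: sqr_ge0.
  have h4 : 0 <= (D + b1) ^+ 2 * e ^+ 2 by rewrite mulr_ge0 ?sqr_ge0.
  have := x1b; rewrite !exprMn; lra.
have x1b3 : - ((5 / 4) * e * (D + b1)) <= D * x1.
  have h : 0 <= (5 / 4) * e * (D + b1) by rewrite !mulr_ge0 // addr_ge0 // ltW.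
  move: x1b2 h; set M := 5 / 4 * e * (D + b1); set z := D * x1 => x1b2 h.
  by rewrite leNgt; apply/negP => lt; nra.
have x1r : x1 <= r1.
  by rewrite /x1 gerBl !mulr_ge0 ?sqr_ge0 // invr_ge0 mulr_ge0 // sqr_ge0.
have : - ((5 / 4) * e * (D + b1)) <= D * r1.
  by apply: le_trans x1b3 _; rewrite ler_pM2l.
move=> fin; rewrite -(ler_pM2l D0).
apply: le_trans fin.
rewrite [X in X <= _](_ : _ = - (2 * (D / T) * (D + b1))); last by field; rewrite gt_eqF.
rewrite lerN2; apply: ler_wpM2r; first by rewrite addr_ge0 // ltW.
have : e <= D / T by rewrite ler_pdivlMr // mulrC.
have : 0 <= D / T by rewrite divr_ge0 // ltW.
lra.
Qed.

(** The cone over the polyhedron with sides s, and [tile0] the cone over its interior. *)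
Definition tile (s : seq (PSL2 R)) : set (hform R) :=
  [set K | fpos K /\ forall h, h \in s -> 0 <= fx (gm h K)].
Definition tile0 (s : seq (PSL2 R)) : set (hform R) :=
  [set K | fpos K /\ forall h, h \in s -> 0 < fx (gm h K)].

(** The tiles are the g^-1 P for g in S. The quotient ftr^2 / fdet is proper on H^3, being
    4 cosh^2 of the distance to the base point, so [tes_lf] is local finiteness: finitely
    many tiles meet each ball. *)
Record tessellation (S : set (PSL2 R)) (s : seq (PSL2 R)) : Prop := Tessellation {
  tes1 : S 1%g;
  tesM : forall g h, S g -> S h -> S (g * h)%g;
  tesV : forall g, S g -> S g^-1%g;
  tes_cover : forall K, fpos K -> exists2 g, S g & tile s (gm g K);
  tes_disj : forall g K, S g -> tile0 s K -> tile0 s (gm g K) -> g = 1%g;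
  tes_lf : forall M : R, finite_set
    [set g | S g /\ exists2 K, tile s K & ftr (gm g K) ^+ 2 <= M * fdet K]
}.

Definition inf_pt : hform R := npt None.

Lemma u1_neq1 : u_ 1 != 1%g :> PSL2 R.
Proof.
apply/eqP => e; have := gm_u 1 (mkf 1 0 0 1); rewrite e gm1.
move=> /(congr1 (@fx R)); rewrite /fx /fd /= => h.
by move/eqP: h; rewrite add0r mulr1 eq_sym oner_eq0.
Qed.

Section Tiling.
Variables (S : set (PSL2 R)) (s : seq (PSL2 R)).
Hypothesis TS : tessellation S s.
Hypothesis cusp : S (u_ 1).

(** If the tile contained a ball, centred at H' and of definite size, close to a point H of
    P that corresponds to a very high point K, then the conjugate h of z |-> z + 1 would move
    H' by less than the radius of the ball, and both H' and h H' would be interior to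
    P. The form C H - H' being positive is what keeps H' about as high as H. *)
Lemma no_room (c C : R) : 0 < c -> 0 < C -> exists2 T : R, 0 < T &
  forall g H H', S g -> fpos H -> fpos H' -> fpos (fcomb C H (-1) H') ->
   c * fdet H <= fdet H' ->
   (forall h, h \in s -> c * Num.sqrt (fdet H') <= fx (gm h H')) ->
   T ^+ 2 * fd (gm g^-1%g H) ^+ 2 <= fdet H -> False.
Proof.
move=> c0 C0.
pose T' := 3 + 2 / c.
have T'0 : 0 < T' by rewrite /T' addr_gt0 // divr_gt0.
have T'1 : 1 <= T'.
  have : 0 < 2 / c by rewrite divr_gt0.
  rewrite /T'; lra.
have sc : 0 < Num.sqrt c by rewrite sqrtr_gt0.
have sc2 : Num.sqrt c ^+ 2 = c by rewrite sqr_sqrtr // ltW.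
(* With K and K' below, d(K') <= C d(K), while c compares the determinants. *)
exists (T' * C / Num.sqrt c); first by rewrite divr_gt0 // mulr_gt0.
move=> g H H' Sg pH pH' pHH cD room high.
pose K := gm g^-1%g H; pose K' := gm g^-1%g H'.
have pK' : fpos K' by exact: gm_pos.
have pK : fpos K by exact: gm_pos.
have dK : fd K' <= C * fd K.
  by have [+ _] := gm_pos g^-1%g pHH; rewrite gm_comb fcombE -/K -/K'; lra.
have [dH0 DH0] := pH; have [dH'0 DH'0] := pH'.
have [dK0 _] := pK; have [dK'0 _] := pK'.
have small : T' ^+ 2 * fd K' ^+ 2 <= fdet H'.
  have h1 : fd K' ^+ 2 <= C ^+ 2 * fd K ^+ 2.
    by rewrite -exprMn lerXn2r // nnegrE ?mulr_ge0 // ltW.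
  have h2 : T' ^+ 2 * C ^+ 2 * fd K ^+ 2 <= c * fdet H.
    move: high; rewrite -/K !exprMn exprVn sc2 => high.
    have := ler_wpM2l (ltW c0) high.
    rewrite (_ : c * (T' ^+ 2 * C ^+ 2 / c * fd K ^+ 2) = T' ^+ 2 * C ^+ 2 * fd K ^+ 2) //.
    by field; rewrite gt_eqF.
  have := ler_wpM2l (sqr_ge0 T') h1; lra.
pose u : PSL2 R := u_ 1.
pose h := (g * u * g^-1)%g.
have Sh : S h.
  by apply: (tesM TS); [apply: (tesM TS)|apply: (tesV TS)].
pose N := fcomb 1 (gm u K') (-1) K'.
have NE : N = mkf 0 0 (fd K') (2 * fx K' + fd K').
  by rewrite /N /u gm_u /fcomb /fd /fy /fx /fa /mkf /=; congr (_, _, _, _); ring.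
have hH' : gm h H' = gm g (gm u K') by rewrite /h !gmM.
have t0 : tile0 s H'.
  split=> // k ks; apply: lt_le_trans (room k ks).
  by rewrite mulr_gt0 // sqrtr_gt0.
have th0 : tile0 s (gm h H').
  split; first exact: gm_pos.
  move=> k ks.
  have E1 : gm k (gm h H') = fcomb 1 (gm k H') 1 (gm k (gm g N)).
    rewrite hH' /N !gm_comb /K' gmVK.
    apply: hformP; rewrite !fcombE; ring.
  have rk := room k ks.
  have xk : 0 <= fx (gm k H').
    by apply: le_trans rk; rewrite mulr_ge0 ?sqrtr_ge0 // ltW.
  have := @displacement_bound (gm k H') (gm k (gm g N)) (fd K') T' T'1 (ltW dK'0).
  rewrite !gm_det => /(_ small DH'0).
  have -> : fdet N = - fd K' ^+ 2 by rewrite NE /fdet /fa /fd /fx /fy /=; ring.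
  have -> : bip (gm k H') (gm k (gm g N)) = fd K' ^+ 2.
    rewrite gm_bip -{1}(gmVK g H') gm_bip -/K' NE /bip /mkf.
    by rewrite [fd (0, _, _, _)]/fd [fy (0, _, _, _)]/fy [fx (0, _, _, _)]/fx
      [fa (0, _, _, _)]/fa /=; ring.
  move=> /(_ erefl erefl xk) b.
  rewrite E1 fcombE !mul1r.
  set X := fx (gm k H') in rk xk b *; set D := Num.sqrt _ in rk b.
  have D0 : 0 < D by rewrite sqrtr_gt0.
  have X0 : 0 < X by apply: lt_le_trans rk; rewrite mulr_gt0.
  suff : (2 / T') * (X + D) < X by move: b; lra.
  rewrite mulrAC ltr_pdivrMr //.
  have DX : D <= X / c by rewrite ler_pdivlMr // mulrC.
  have -> : X * T' = 3 * X + 2 * (X / c) by rewrite /T'; field; rewrite gt_eqF.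
  lra.
have h1 : h = 1%g by apply: (tes_disj TS Sh t0 th0).
have u1 : u = 1%g.
  have : (g^-1 * h * g)%g = u by rewrite /h !mulgA mulVg mul1g -mulgA mulVg mulg1.
  by rewrite h1 mulg1 mulVg.
by have := u1_neq1; rewrite -/u u1 eqxx.
Qed.
End Tiling.
End Geo.

(** * Continuity on the space of forms, and the ideal vertices of a polyhedron *)

Section Cont.
Variable (R : realType) (T : topologicalType).
Implicit Types (f g : T -> R).
Lemma contD f g : continuous f -> continuous g -> continuous (fun K => f K + g K).
Proof. by move=> cf cg x; exact: cvgD (cf x) (cg x). Qed.
Lemma contM f g : continuous f -> continuous g -> continuous (fun K => f K * g K).
Proof. by move=> cf cg x; exact: cvgM (cf x) (cg x). Qed.
Lemma contN f : continuous f -> continuous (fun K => - f K).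
Proof. by move=> cf x; exact: cvgN (cf x). Qed.
Lemma contX f n : continuous f -> continuous (fun K => f K ^+ n).
Proof.
move=> cf; elim: n => [|n IH]; first by under eq_fun do rewrite expr0; exact: cst_continuous.
by under eq_fun do rewrite exprS; exact: contM.
Qed.
Lemma contC (c : R) : continuous (fun K : T => c).
Proof. exact: cst_continuous. Qed.
End Cont.

Section ContForm.
Variable R : realType.
Implicit Types (K L H : hform R) (g : PSL2 R).
Notation form4 := (R * R * R * R)%type.

Lemma cont_fd : continuous (@fd R : form4 -> R).
Proof.
by move=> K; apply: (@continuous_comp _ _ _ fst (fun p => p.1.1)); [exact: cvg_fst|];
  apply: (@continuous_comp _ _ _ fst fst); exact: cvg_fst.
Qed.
Lemma cont_fy : continuous (@fy R : form4 -> R).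
Proof.
by move=> K; apply: (@continuous_comp _ _ _ fst (fun p => p.1.2)); [exact: cvg_fst|];
  apply: (@continuous_comp _ _ _ fst snd); [exact: cvg_fst|exact: cvg_snd].
Qed.
Lemma cont_fx : continuous (@fx R : form4 -> R).
Proof.
by move=> K; apply: (@continuous_comp _ _ _ fst snd); [exact: cvg_fst|exact: cvg_snd].
Qed.
Lemma cont_fa : continuous (@fa R : form4 -> R).
Proof. by move=> K; exact: cvg_snd. Qed.

Definition bas_d : hform R := mkf 1 0 0 0.
Definition bas_y : hform R := mkf 0 1 0 0.
Definition bas_x : hform R := mkf 0 0 1 0.
Definition bas_a : hform R := mkf 0 0 0 1.

Lemma gm_basis g K : gm g K =
  fcomb 1 (fcomb (fd K) (gm g bas_d) (fy K) (gm g bas_y)) 1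
          (fcomb (fx K) (gm g bas_x) (fa K) (gm g bas_a)).
Proof.
rewrite -!gm_comb; congr (gm g _).
by apply: hformP; rewrite !fcombE /fd /fy /fx /fa /=; ring.
Qed.
Lemma fx_gm g K : fx (gm g K) = fd K * fx (gm g bas_d) + fy K * fx (gm g bas_y)
  + fx K * fx (gm g bas_x) + fa K * fx (gm g bas_a).
Proof. by rewrite [in LHS]gm_basis !fcombE; ring. Qed.
Lemma fd_gm g K : fd (gm g K) = fd K * fd (gm g bas_d) + fy K * fd (gm g bas_y)
  + fx K * fd (gm g bas_x) + fa K * fd (gm g bas_a).
Proof. by rewrite [in LHS]gm_basis !fcombE; ring. Qed.
Lemma fy_gm g K : fy (gm g K) = fd K * fy (gm g bas_d) + fy K * fy (gm g bas_y)
  + fx K * fy (gm g bas_x) + fa K * fy (gm g bas_a).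
Proof. by rewrite [in LHS]gm_basis !fcombE; ring. Qed.
Lemma fa_gm g K : fa (gm g K) = fd K * fa (gm g bas_d) + fy K * fa (gm g bas_y)
  + fx K * fa (gm g bas_x) + fa K * fa (gm g bas_a).
Proof. by rewrite [in LHS]gm_basis !fcombE; ring. Qed.
End ContForm.

Ltac mcont := lazymatch goal with
  | |- continuous (fun x => @?f x + @?g x) => apply: (@contD _ _ f g); mcont
  | |- continuous (fun x => @?f x * @?g x) => apply: (@contM _ _ f g); mcont
  | |- continuous (fun x => - @?f x) => apply: (@contN _ _ f); mcont
  | |- continuous (fun x => @?f x ^+ ?n) => apply: (@contX _ _ f n); mcont
  | |- continuous (fun x => fd x) => exact: cont_fd
  | |- continuous (fun x => fy x) => exact: cont_fy
  | |- continuous (fun x => fx x) => exact: cont_fx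
  | |- continuous (fun x => fa x) => exact: cont_fa
  | |- continuous (@fd _) => exact: cont_fd
  | |- continuous (@fy _) => exact: cont_fy
  | |- continuous (@fx _) => exact: cont_fx
  | |- continuous (@fa _) => exact: cont_fa
  | |- continuous (fun x => ?c) => first [assumption | exact: contC]
  | |- _ => try assumption
  end.

Section Sigma.
Variable R : realType.
Implicit Types (K L H n m : hform R) (g h : PSL2 R).
Notation form4 := (R * R * R * R)%type.

Lemma cont_fxgm g : continuous ((fun K => fx (gm g K)) : form4 -> R).
Proof.
rewrite (_ : (fun K => _) = (fun K : form4 => fd K * fx (gm g (bas_d R)) + fy K * fx (gm g (bas_y R))
  + fx K * fx (gm g (bas_x R)) + fa K * fx (gm g (bas_a R)))); first by mcont.
by apply/funext => K; rewrite fx_gm.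
Qed.
Lemma cont_fdet : continuous (@fdet R : form4 -> R).
Proof. rewrite /fdet; mcont. Qed.
Lemma cont_ftr : continuous (@ftr R : form4 -> R).
Proof. rewrite /ftr; mcont. Qed.

(** The side h lies in the same hyperplane of forms as the side g. *)
Definition coplanar g h : Prop := exists c, forall K, fx (gm h K) = c * fx (gm g K).

(** With traces 1, the pairing of null forms is a squared Euclidean distance. *)
Lemma bip_null_gt0 n m : fdet n = 0 -> fdet m = 0 -> ftr n = 1 -> ftr m = 1 ->
  n <> m -> 0 < bip n m.
Proof.
rewrite /fdet /ftr => Dn Dm tn tm nm.
pose X := (fa n - fd n - (fa m - fd m)) ^+ 2 + 4 * (fx n - fx m) ^+ 2
  + 4 * (fy n - fy m) ^+ 2.
have E : 4 * bip n m = X.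
  rewrite /X /bip; have e1 : (fa n - fd n) ^+ 2 + 4 * fx n ^+ 2 + 4 * fy n ^+ 2 = 1.
    have : (fa n + fd n) ^+ 2 = 1 by rewrite tn expr1n.
    lra.
  have e2 : (fa m - fd m) ^+ 2 + 4 * fx m ^+ 2 + 4 * fy m ^+ 2 = 1.
    have : (fa m + fd m) ^+ 2 = 1 by rewrite tm expr1n.
    lra.
  have : (fa n + fd n) * (fa m + fd m) = 1 by rewrite tn tm mulr1.
  lra.
have q1 := sqr_ge0 (fa n - fd n - (fa m - fd m)).
have q2 := sqr_ge0 (fx n - fx m); have q3 := sqr_ge0 (fy n - fy m).
have : 0 <= X by rewrite /X; lra.
rewrite -E le_eqVlt => /orP[/eqP e|]; last by rewrite pmulr_rgt0.
exfalso; apply: nm; move: e; rewrite E /X => e.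
have /eqP : (fa n - fd n - (fa m - fd m)) ^+ 2 = 0 by lra.
have /eqP : (fx n - fx m) ^+ 2 = 0 by lra.
have /eqP : (fy n - fy m) ^+ 2 = 0 by lra.
rewrite !sqrf_eq0 => /eqP e1 /eqP e2 /eqP e3.
by apply: hformP; lra.
Qed.

(** Two distinct planes of H^3 have at most two common ideal points. Algebraically, a linear
    form vanishing on the kernel of another at three null vectors is a multiple of it, since
    the square of the determinant of the three vectors is the product of their pairings. *)
Lemma three_null g h (n1 n2 n3 : hform R) :
  (forall n, n \in [:: n1; n2; n3] -> [/\ fdet n = 0, ftr n = 1,
     fx (gm g n) = 0 & fx (gm h n) = 0]) ->
  n1 <> n2 -> n2 <> n3 -> n1 <> n3 -> coplanar g h.
Proof.
move=> H n12 n23 n13.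
have [D1 t1 g1 h1] := H n1 ltac:(by rewrite !inE eqxx).
have [D2 t2 g2 h2] := H n2 ltac:(by rewrite !inE eqxx orbT).
have [D3 t3 g3 h3] := H n3 ltac:(by rewrite !inE eqxx !orbT).
pose k := (h * g^-1)%g.
have hk K : fx (gm h K) = fx (gm k (gm g K)) by rewrite /k gmM gmK.
have p12 := bip_null_gt0 D1 D2 t1 t2 n12.
have p23 := bip_null_gt0 D2 D3 t2 t3 n23.
have p13 := bip_null_gt0 D1 D3 t1 t3 n13.
rewrite -(gm_bip g) in p12; rewrite -(gm_bip g) in p23; rewrite -(gm_bip g) in p13.
rewrite -(gm_det g) in D1; rewrite -(gm_det g) in D2; rewrite -(gm_det g) in D3.
rewrite hk in h1; rewrite hk in h2; rewrite hk in h3.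
rewrite fx_gm in h1; rewrite fx_gm in h2; rewrite fx_gm in h3.
move: (gm g n1) (gm g n2) (gm g n3) => m1 m2 m3 in g1 g2 g3 D1 D2 D3 h1 h2 h3 p12 p23 p13.
pose Dt := fd m1 * (fy m2 * fa m3 - fa m2 * fy m3)
  - fy m1 * (fd m2 * fa m3 - fa m2 * fd m3)
  + fa m1 * (fd m2 * fy m3 - fy m2 * fd m3).
have DtE : Dt ^+ 2 = bip m1 m2 * bip m1 m3 * bip m2 m3.
  have e x1 x2 x3 : x1 = 0 -> x2 = 0 -> x3 = 0 ->
     4 * x1 * x2 * x3 - x1 * bip m2 m3 ^+ 2 - x2 * bip m1 m3 ^+ 2
     - x3 * bip m1 m2 ^+ 2 = 0 by move=> -> -> ->; ring.
  have E := e _ _ _ D1 D2 D3.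
  rewrite -[RHS]addr0 -E /Dt /bip /fdet g1 g2 g3; ring.
have Dt0 : Dt != 0.
  by apply/eqP => e; have := mulr_gt0 (mulr_gt0 p12 p13) p23; rewrite -DtE e expr0n ltxx.
rewrite g1 mul0r addr0 in h1; rewrite g2 mul0r addr0 in h2; rewrite g3 mul0r addr0 in h3.
set p := fx (gm k (bas_d R)) in h1 h2 h3; set q := fx (gm k (bas_y R)) in h1 h2 h3.
set r := fx (gm k (bas_a R)) in h1 h2 h3.
have comb (c1 c2 c3 : R) : c1 * (fd m1 * p + fy m1 * q + fa m1 * r)
  + c2 * (fd m2 * p + fy m2 * q + fa m2 * r) + c3 * (fd m3 * p + fy m3 * q + fa m3 * r) = 0.
  by rewrite h1 h2 h3 !mulr0 !addr0.
have pz : p = 0.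
  apply: (mulfI Dt0); rewrite mulr0 -[RHS](comb (fy m2 * fa m3 - fa m2 * fy m3)
    (- (fy m1 * fa m3 - fa m1 * fy m3)) (fy m1 * fa m2 - fa m1 * fy m2)).
  rewrite /Dt; ring.
have qz : q = 0.
  apply: (mulfI Dt0); rewrite mulr0 -[RHS](comb (- (fd m2 * fa m3 - fa m2 * fd m3))
    (fd m1 * fa m3 - fa m1 * fd m3) (- (fd m1 * fa m2 - fa m1 * fd m2))).
  rewrite /Dt; ring.
have rz : r = 0.
  apply: (mulfI Dt0); rewrite mulr0 -[RHS](comb (fd m2 * fy m3 - fy m2 * fd m3)
    (- (fd m1 * fy m3 - fy m1 * fd m3)) (fd m1 * fy m2 - fy m1 * fd m2)).
  rewrite /Dt; ring.
exists (fx (gm k (bas_x R))) => K.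
by rewrite hk fx_gm -/p -/q -/r pz qz rz; ring.
Qed.

Lemma finite_two (T : choiceType) (X : set T) :
  (forall a b c, X a -> X b -> X c -> a <> b -> b <> c -> a <> c -> False) ->
  finite_set X.
Proof.
move=> H; have [->|/set0P [a Xa]] := eqVneq X set0; first exact: finite_set0.
have [[b [Xb ab]]|nb] := pselect (exists b, X b /\ a <> b).
  apply: (@sub_finite_set _ _ [set a; b]) => [c Xc|]; last first.
    by rewrite finite_setU; split; exact: finite_set1.
  have [->|ca] := eqVneq c a; [by left|right].
  apply: contrapT => cb; apply: (H a b c) => //; first by move=> e; apply: cb.
  by move=> e; rewrite e eqxx in ca.
apply: (@sub_finite_set _ _ [set a]); last exact: finite_set1.
by move=> c Xc; apply: contrapT => ca; apply: nb; exists c; split=> // e; apply: ca.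
Qed.

(** The ideal points of the polyhedron that lie on two of its sides, normalised to trace 1. *)
Definition cusp_point (s : seq (PSL2 R)) : set (hform R) :=
  [set n | [/\ fnull n, ftr n = 1, (forall g, g \in s -> 0 <= fx (gm g n)) &
    exists g h, [/\ g \in s, h \in s, fx (gm g n) = 0, fx (gm h n) = 0 &
       ~ coplanar g h]]].

Lemma finite_cusp_point s : finite_set (cusp_point s).
Proof.
pose X (p : PSL2 R * PSL2 R) : set (hform R) := [set n | [/\ fdet n = 0, ftr n = 1,
   fx (gm p.1 n) = 0, fx (gm p.2 n) = 0 & ~ coplanar p.1 p.2]].
pose D : set (PSL2 R * PSL2 R) := [set` s] `*` [set` s].
apply: (@sub_finite_set _ _ (\bigcup_(p in D) X p)).
  move=> n [[Dn _ _ _] tn _ [g [h [gs hs g0 h0 cp]]]].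
  by exists (g, h).
apply: bigcup_finite; first by apply: finite_setX; exact: finite_seq.
move=> [g h] _; apply: (@finite_two (R * R * R * R)%type) => a b c.
move=> [Da ta ga ha cp] [Db tb gb hb _] [Dc tc gc hc _] ab bc ac.
apply: cp; apply: (three_null (n1 := a) (n2 := b) (n3 := c)) => // n.
by rewrite !inE => /or3P[] /eqP ->.
Qed.
End Sigma.

(** * Tiles up to null sets *)

Section Generic.
Variable R : realType.
Notation gR := (measurableTypeR R).
Notation mform := (gR * gR * gR * gR)%type.
Implicit Types (K L H : hform R) (g h : PSL2 R).

Lemma vol_bigcup0 (F : nat -> set mform) : (forall n, measurable (F n)) ->
  (forall n, vol R (F n) = 0%E) -> vol R (\bigcup_n F n) = 0%E.
Proof.
move=> mF F0; apply/eqP; rewrite -measure_le0.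
apply: (@le_trans _ _ (\sum_(0 <= n <oo) vol R (F n))%E).
  apply: (measure_sigma_subadditive (vol R)) => //.
  exact: bigcupT_measurable.
by rewrite eseries0.
Qed.

Lemma measurable_fxgm g h : measurable [set K : mform | fx (gm h (gm g K)) = 0].
Proof.
have -> : [set K : mform | fx (gm h (gm g K)) = 0] = gm (h * g)%g @^-1` [set K : mform | fx K = 0].
  by apply/seteqP; split=> K /=; rewrite gmM.
rewrite -[X in measurable X]setTI.
by apply: (volpres_gm (h * g)%g).1 => //; exact: measurable_hyperplane0.
Qed.

Lemma vol_fxgm g h : vol R [set K : mform | fx (gm h (gm g K)) = 0] = 0%E.
Proof.
rewrite -(vol_hyperplane (h * g)%g); congr (vol R _).
by apply/seteqP; split=> K /=; rewrite gmM.
Qed.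

Section Tiling.
Variables (S : set (PSL2 R)) (s : seq (PSL2 R)).
Hypothesis TS : tessellation S s.

Lemma fpos_base : fpos (mkf 1 0 0 1 : hform R).
Proof. by split; rewrite /fdet /fd /fa /fx /fy /=; lra. Qed.

Lemma tile_nonempty : exists K, tile s K.
Proof. by have [g _ tK] := tes_cover TS fpos_base; exists (gm g (mkf 1 0 0 1)). Qed.

(** S is countable, by local finiteness. *)
Lemma tes_enum : exists (en : nat -> PSL2 R) (f : PSL2 R -> nat),
  (forall n, S (en n)) /\ (forall g, S g -> en (f g) = g).
Proof.
have [K0 tK0] := tile_nonempty.
have cS : countable S.
  have -> : S = \bigcup_(M in setT) [set g | S g /\
     exists2 K, tile s K & ftr (gm g K) ^+ 2 <= M%:R * fdet K].
    apply/seteqP; split=> g; last by case=> M _ [].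
    move=> Sg; have [_ D0] := tK0.1.
    exists (Num.bound (ftr (gm g K0) ^+ 2 / fdet K0)) => //; split=> //.
    exists K0 => //; rewrite -ler_pdivrMr //; apply: ltW.
    by apply: archi_boundP; rewrite divr_ge0 ?sqr_ge0 // ltW.
  apply: bigcup_countable => // M _.
  apply: finite_set_countable; exact: (tes_lf TS).
have /countable_injP [f inj] := cS.
pose P n g := S g /\ f g = n.
have ex n : exists g, S g /\ ((exists g', P n g') -> P n g).
  have [[g Pg]|no] := pselect (exists g', P n g'); first by exists g; split=> //; case: Pg.
  by exists 1%g; split; first exact: (tes1 TS).
exists (fun n => projT1 (cid (ex n))), f; split=> [n|g Sg].
  by case: (cid (ex n)) => g /= [].
case: (cid (ex (f g))) => g' /= [Sg' h].
have [|_ e] := h; first by exists g.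
by apply: inj; rewrite ?inE.
Qed.

(** The countably many hyperplanes carrying sides of tiles form a null set. *)
Lemma generic_tile0 : exists Z : set mform, [/\ measurable Z, vol R Z = 0%E &
  forall K, fpos K -> ~ Z K -> exists2 g, S g & tile0 s (gm g K)].
Proof.
have [en [f [Sen enf]]] := tes_enum.
pose Y n k : set mform := [set K : mform | fx (gm (nth 1%g s k) (gm (en n) K)) = 0].
exists (\bigcup_n \bigcup_k Y n k); split.
- by apply: bigcupT_measurable => n; apply: bigcupT_measurable => k; exact: measurable_fxgm.
- apply: vol_bigcup0 => n.
    by apply: bigcupT_measurable => k; exact: measurable_fxgm.
  by apply: vol_bigcup0 => k; [exact: measurable_fxgm|exact: vol_fxgm].
move=> K pK nZ; have [g Sg [pg tg]] := tes_cover TS pK.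
exists g => //; split=> // h hs; rewrite lt_def tg // andbT.
apply/eqP => e; apply: nZ; exists (f g) => //; exists (index h s) => //.
by rewrite /Y /= enf // nth_index.
Qed.

Lemma near_fpos K : fpos K -> \forall L \near (K : R * R * R * R), fpos (L : hform R).
Proof.
move=> [d0 D0].
have c1 := @cont_fd R K; have c2 := @cont_fdet R K.
near=> L; split; near: L; [exact: (cvgr_gt _ c1)|exact: (cvgr_gt _ c2)].
Unshelve. all: by end_near. Qed.

Lemma measurable_fpos : measurable [set K : mform | fpos K].
Proof.
have -> : [set K : mform | fpos K] =
   (fun K : mform => 0 < fd K) @^-1` [set true] `&` (fun K : mform => 0 < fdet K) @^-1` [set true].
  by apply/seteqP; split=> K /= [].
apply: measurableI; rewrite -[X in measurable X]setTI.
  by apply: measurable_fun_ltr => //; mfun.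
by apply: measurable_fun_ltr => //; rewrite /fdet; mfun.
Qed.

(** Otherwise the null set of [generic_tile0] would contain all positive forms. *)
Lemma tile0_nonempty : exists K, tile0 s K.
Proof.
have [Z [mZ vZ cov]] := generic_tile0.
apply: contrapT => no; have := vol_nbhs_gt0 measurable_fpos (near_fpos fpos_base).
apply/negP; rewrite -leNgt -vZ; apply: le_measure; rewrite ?inE //.
  exact: measurable_fpos.
move=> K pK; apply: contrapT => nZ; apply: no.
by have [g _ tg] := cov K pK nZ; exists (gm g K).
Qed.
End Tiling.
End Generic.

(** * The thin part of a tile *)

Section Thin.
Variable R : realType.
Implicit Types (K L H n m : hform R) (g h : PSL2 R).
Notation form4 := (R * R * R * R)%type.

(** A common constant, and a common neighbourhood, for finitely many indices. *)
Lemma seq_near (T : eqType) (X : Type) (F : set_system X) (FF : Filter F)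
    (s : seq T) (Q : R -> T -> X -> Prop) :
  (forall c c' k x, 0 < c' -> c' <= c -> Q c k x -> Q c' k x) ->
  (forall k, k \in s -> exists2 c, 0 < c & \forall x \near F, Q c k x) ->
  exists2 c, 0 < c & \forall x \near F, forall k, k \in s -> Q c k x.
Proof.
move=> mono; elim: s => [|k0 s IH] H.
  by exists 1 => //; apply: filterE => x k; rewrite in_nil.
have [c c0 Hc] := H k0 (mem_head k0 s).
have [|c' c'0 Hc'] := IH.
  by move=> k ks; apply: H; rewrite inE ks orbT.
exists (Num.min c c'); first by rewrite lt_min c0 c'0.
apply: filterS2 Hc Hc' => x Qc Qc' k; rewrite inE => /predU1P[->|ks].
  by apply: mono Qc; [rewrite lt_min c0 c'0|rewrite ge_min lexx].
by apply: mono (Qc' k ks); [rewrite lt_min c0 c'0|rewrite ge_min lexx orbT].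
Qed.

(** H, once scaled to trace 1, is within e of n. *)
Definition near_dir (e : R) n H : Prop :=
  [/\ `|fd H - ftr H * fd n| < e * ftr H, `|fy H - ftr H * fy n| < e * ftr H,
      `|fx H - ftr H * fx n| < e * ftr H & `|fa H - ftr H * fa n| < e * ftr H].

Lemma cont_comb (a b : R) L : continuous ((fun K => fcomb a K b L) : form4 -> form4).
Proof.
move=> K.
have cd : {for K, continuous (fun H : form4 => a * fd H + b * fd L)}.
  by apply: (_ : continuous _); mcont.
have cy : {for K, continuous (fun H : form4 => a * fy H + b * fy L)}.
  by apply: (_ : continuous _); mcont.
have cx : {for K, continuous (fun H : form4 => a * fx H + b * fx L)}.
  by apply: (_ : continuous _); mcont.
have ca : {for K, continuous (fun H : form4 => a * fa H + b * fa L)}.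
  by apply: (_ : continuous _); mcont.
exact: (cvg_pair (cvg_pair (cvg_pair cd cy) cx) ca).
Qed.

Variables (S : set (PSL2 R)) (s : seq (PSL2 R)).
Hypothesis TS : tessellation S s.
Hypothesis cusp : S (u_ 1).

(** The hypotheses of [no_room]: a ball inside the tile, at bounded distance from H. *)
Definition has_room (c C : R) H : Prop := exists H',
  [/\ fpos H', fpos (fcomb C H (-1) H'), c * fdet H <= fdet H' &
    forall h, h \in s -> c * Num.sqrt (fdet H') <= fx (gm h H')].

(** No point g^-1 H of the orbit reaches the height T. *)
Definition low (T : R) H : Prop := forall g, S g ->
  T ^+ 2 * fd (gm g^-1%g H) ^+ 2 <= fdet H -> False.

Lemma room_low c C : 0 < c -> 0 < C ->
  exists2 T, 0 < T & forall H, fpos H -> has_room c C H -> low T H.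
Proof.
move=> c0 C0; have [T T0 HT] := no_room TS cusp c0 C0.
by exists T => // H pH [H' [p1 p2 p3 p4]] g Sg; exact: HT p4.
Qed.

Lemma low_mono T T' H : 0 < T -> T <= T' -> low T H -> low T' H.
Proof.
move=> T0 TT l g Sg le; apply: (l g Sg); apply: le_trans le.
by apply: ler_wpM2r; [exact: sqr_ge0|rewrite lerXn2r // nnegrE ltW // (lt_le_trans T0)].
Qed.

(** Near a point of H^3 the room is found by moving towards an interior point of the tile. *)
Lemma room_interior H0 : fpos H0 ->
  exists c C, [/\ 0 < c, 0 < C & \forall H \near (H0 : form4), fpos (H : hform R) ->
    tile s H -> has_room c C H].
Proof.
move=> pH0; have [q0 [pq tq]] := tile0_nonempty TS.
pose A (H : hform R) : hform R := fcomb 1 H 1 q0.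
have [d0 D0] := pH0; have [dq Dq] := pq; have bq := bip_pos pH0 pq.
(* t is large enough for t H0 - q0 to be positive. *)
pose t := fd q0 / fd H0 + bip H0 q0 / fdet H0 + 1.
have t1 : 1 <= t by rewrite /t lerDr addr_ge0 // divr_ge0 // ltW.
pose B (H : hform R) : hform R := fcomb t H (-1) q0.
have pB : fpos (B H0).
  split.
    rewrite /B fcombE.
    have e : t * fd H0 = fd q0 + bip H0 q0 / fdet H0 * fd H0 + fd H0.
      by rewrite /t; field; rewrite !gt_eqF.
    have : 0 < bip H0 q0 / fdet H0 * fd H0 by rewrite mulr_gt0 // divr_gt0.
    lra.
  have -> : fdet (B H0) = t * (t * fdet H0 - bip H0 q0) + fdet q0.
    by rewrite /B /fdet /bip !fcombE; ring.
  have e : t * fdet H0 - bip H0 q0 = fd q0 / fd H0 * fdet H0 + fdet H0.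
    by rewrite /t; field; rewrite !gt_eqF.
  rewrite e; apply: addr_gt0 => //; apply: mulr_gt0; first by lra.
  by apply: addr_gt0 => //; rewrite mulr_gt0 // divr_gt0.
have nB : \forall H \near (H0 : form4), fpos (B H).
  exact: (@cont_comb t (-1) q0 H0 _ (near_fpos pB)).
pose M := fdet (A H0) + 1.
have nA : \forall H \near (H0 : form4), fdet (A H) < M.
  have cA : ((fun H => fdet (A H)) : form4 -> R) @ (H0 : form4) --> fdet (A H0).
    exact: (@continuous_comp _ _ _ ((fun H => A H) : form4 -> form4) (@fdet R) H0 (@cont_comb 1 1 q0 H0) (@cont_fdet R _)).
  by apply: (cvgr_lt _ cA); rewrite /M ltrDl.
have M0 : 0 < M.
  by have [_ ?] := fpos_comb ler01 ler01 (ltr0Sn R 1) pH0 pq; rewrite /M addr_gt0.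
have sM : 0 < Num.sqrt M by rewrite sqrtr_gt0.
have [||c c0 Hc] := @seq_near _ _ (nbhs (H0 : form4)) _ s
    (fun c h _ => c * Num.sqrt M <= fx (gm h q0)).
- by move=> c c' h x c'0 cc' le; apply: le_trans le; rewrite ler_pM2r.
- move=> h hs; exists (fx (gm h q0) / Num.sqrt M); first by rewrite divr_gt0 ?tq.
  by apply: nearW => x; rewrite divfK // gt_eqF.
exists (Num.min c 1), (t + 1); split; first by rewrite lt_min c0 /=.
  by lra.
have c1 : 0 < Num.min c 1 by rewrite lt_min c0 /=.
near=> H => pH tH; exists (A H).
have pA : fpos (A H) by apply: fpos_comb => //; lra.
split=> //.
- suff -> : fcomb (t + 1) H (-1) (A H) = B H by near: H.
  by apply: hformP; rewrite !fcombE; ring.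
- have -> : fdet (A H) = fdet H + bip H q0 + fdet q0 by rewrite /A /fdet /bip !fcombE; ring.
  have := bip_pos pH pq; have [_ DH] := pH.
  have : Num.min c 1 * fdet H <= 1 * fdet H by rewrite ler_pM2r // ge_min lexx orbT.
  lra.
- move=> h hs; rewrite /A gm_comb fcombE !mul1r.
  have h1 : c * Num.sqrt M <= fx (gm h q0) by move: h hs; near: H; exact: Hc.
  have h2 : Num.sqrt (fdet (A H)) <= Num.sqrt M.
    by apply: ler_wsqrtr; apply: ltW; near: H; exact: nA.
  have h3 : Num.min c 1 * Num.sqrt (fdet (A H)) <= c * Num.sqrt M.
    by apply: ler_pM; [exact: ltW|exact: sqrtr_ge0|rewrite ge_min lexx|exact: h2].
  by have := tH.2 h hs; lra.
Unshelve. all: by end_near. Qed.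

(** Near an ideal point that lies on no side, the tile fills a neighbourhood. *)
Lemma room_ordinary n : fdet n = 0 -> (forall h, h \in s -> 0 < fx (gm h n)) ->
  exists c C, [/\ 0 < c, 0 < C & \forall H \near (n : form4), fpos (H : hform R) ->
    tile s H -> has_room c C H].
Proof.
move=> Dn pn.
have [||c c0 Hc] := @seq_near _ _ (nbhs (n : form4)) _ s (fun c h H => c <= fx (gm h H)).
- by move=> c c' h x _ cc' le; apply: le_trans le.
- move=> h hs; exists (fx (gm h n) / 2); first by rewrite divr_gt0 ?pn.
  have cv := @cont_fxgm R h n.
  near=> x; apply: ltW; near: x; apply: (cvgr_gt _ cv).
  by have := pn h hs; lra.
have nD : \forall H \near (n : form4), fdet (H : hform R) < 1.
  have cv := @cont_fdet R n; apply: (cvgr_lt _ cv); by rewrite Dn.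
have c1 : 0 < Num.min c 1 by rewrite lt_min c0 /=.
exists (Num.min c 1), 2; split=> //.
near=> H => pH tH; exists H; split=> //.
- suff -> : fcomb 2 H (-1) H = H by [].
  by apply: hformP; rewrite !fcombE; ring.
- by rewrite ler_piMl ?ge_min ?lexx ?orbT // ltW //; case: pH.
- move=> h hs.
  have h1 : c <= fx (gm h H) by move: h hs; near: H; exact: Hc.
  apply: le_trans h1; rewrite -[leRHS]mulr1.
  apply: ler_pM; [exact: ltW|exact: sqrtr_ge0|by rewrite ge_min lexx|].
  by rewrite -sqrtr1; apply: ler_wsqrtr; apply: ltW; near: H.
Unshelve. all: by end_near. Qed.

(** Near an ideal point on one side only, the tile is a half-space and the room is found by
    moving off the side by a bounded hyperbolic distance. *)
Lemma room_side n g0 : fdet n = 0 -> (forall h, h \in s -> 0 <= fx (gm h n)) ->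
  g0 \in s -> fx (gm g0 n) = 0 ->
  (forall h, h \in s -> fx (gm h n) = 0 -> coplanar g0 h) ->
  exists c C, [/\ 0 < c, 0 < C & \forall H \near (n : form4), fpos (H : hform R) ->
    tile s H -> has_room c C H].
Proof.
move=> Dn pn g0s n0 cop; have [q0 [pq tq]] := tile0_nonempty TS.
pose e : hform R := gm g0^-1%g (bas_x R).
have fe : fx (gm g0 e) = 1 by rewrite /e gmVK.
have bE H : bip H e = - 2 * fx (gm g0 H).
  rewrite -(gm_bip g0) /e gmVK /bip /bas_x.
  by rewrite [fd (mkf _ _ _ _)]/fd [fy (mkf _ _ _ _)]/fy [fx (mkf _ _ _ _)]/fx
    [fa (mkf _ _ _ _)]/fa /=; ring.
have De : fdet e = -1.
  rewrite /e gm_det /fdet /bas_x.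
  by rewrite [fd (mkf _ _ _ _)]/fd [fy (mkf _ _ _ _)]/fy [fx (mkf _ _ _ _)]/fx
    [fa (mkf _ _ _ _)]/fa /=; ring.
have detE (H : hform R) (m : R) : fdet (fcomb 1 H m e) = fdet H - 2 * m * fx (gm g0 H) - m ^+ 2.
  have -> : fdet (fcomb 1 H m e) = fdet H + m * bip H e + m ^+ 2 * fdet e.
    by rewrite /fdet /bip !fcombE; ring.
  by rewrite bE De; ring.
(* H is pushed off its side by a bounded hyperbolic distance, unless it is already far. *)
pose H' (H : hform R) : hform R := if Num.sqrt (fdet H) / 4 <= fx (gm g0 H) then H
  else fcomb 1 H (Num.sqrt (fdet H) / 4) e.
have [||c c0 Hc] := @seq_near _ _ (nbhs (n : form4)) _ s
    (fun c h H => fpos H -> tile s H -> c * Num.sqrt (fdet H) <= fx (gm h (H' H))).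
- by move=> c c' h x _ cc' le pH tH; apply: le_trans (le pH tH); rewrite ler_wpM2r ?sqrtr_ge0.
- move=> h hs; have [hn|hn] := eqVneq (fx (gm h n)) 0.
    have [k hk] := cop h hs hn.
    have k0 : 0 < k.
      by have := tq h hs; rewrite hk; have := tq g0 g0s => t0; rewrite pmulr_lgt0.
    exists (k / 4); first by rewrite divr_gt0.
    apply: nearW => H pH tH; rewrite hk mulrAC -mulrA ler_pM2l //.
    rewrite /H'; case: (leP (Num.sqrt (fdet H) / 4) (fx (gm g0 H))) => // lt.
    by rewrite gm_comb fcombE fe; have := tH.2 g0 g0s; lra.
  have m0 : 0 < fx (gm h n) by rewrite lt_def hn pn.
  set m := fx (gm h n) in m0 hn.
  pose w := `|fx (gm h e)| + 1.
  have w0 : 0 < w by rewrite /w ltr_wpDl.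
  exists (m / 8); first by rewrite divr_gt0.
  have cv := @cont_fxgm R h n; have cd := @cont_fdet R n.
  near=> H => pH tH.
  have h1 : m / 2 < fx (gm h H) by near: H; apply: (cvgr_gt _ cv); rewrite -/m; lra.
  have dw : Num.sqrt (fdet H) < m / w.
    have mw : 0 < m / w by rewrite divr_gt0.
    have -> : m / w = Num.sqrt ((m / w) ^+ 2) by rewrite sqrtr_sqr gtr0_norm.
    rewrite ltr_sqrt ?exprn_gt0 //.
    near: H; apply: (cvgr_lt _ cd); by rewrite Dn exprn_gt0 // divr_gt0.
  have d1 : Num.sqrt (fdet H) <= 1.
    rewrite -sqrtr1; apply: ler_wsqrtr; apply: ltW; near: H.
    by apply: (cvgr_lt _ cd); rewrite Dn.
  have d0 := sqrtr_ge0 (fdet H).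
  have lhs : m / 8 * Num.sqrt (fdet H) <= m / 8 by rewrite ler_piMr // divr_ge0 // ltW.
  rewrite /H'; case: (leP (Num.sqrt (fdet H) / 4) (fx (gm g0 H))) => _; first by lra.
  rewrite gm_comb fcombE mul1r.
  have h4 : Num.sqrt (fdet H) * w < m by rewrite -ltr_pdivlMr.
  have h5 : - `|fx (gm h e)| <= fx (gm h e) by rewrite lerNl -normrN ler_norm.
  have h6 := ler_wpM2l d0 h5; rewrite /w mulrDr mulr1 in h4.
  have h7 : Num.sqrt (fdet H) / 4 * fx (gm h e) = Num.sqrt (fdet H) * fx (gm h e) / 4 by ring.
  by rewrite mulrN in h6; rewrite h7; lra.
have c1 : 0 < Num.min c (1 / 2) by rewrite lt_min c0 /=; lra.
exists (Num.min c (1 / 2)), 2; split=> //.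
near=> H => pH tH; exists (H' H).
have D0 : 0 < Num.sqrt (fdet H) by rewrite sqrtr_gt0; case: pH.
have D2 : Num.sqrt (fdet H) ^+ 2 = fdet H by rewrite sqr_sqrtr //; case: pH => _ /ltW.
have l0 := tH.2 g0 g0s.
set D := Num.sqrt (fdet H) in D0 D2.
have hl0 := mulr_ge0 (ltW D0) l0; have hq := sqr_ge0 D.
have detH' : fdet H / 2 <= fdet (H' H) <= fdet H.
  rewrite /H'; case: (leP (Num.sqrt (fdet H) / 4) (fx (gm g0 H))) => lt; first by rewrite -D2; have := sqr_ge0 D; lra.
  rewrite -/D in lt *; have hl := ler_wpM2l (ltW D0) (ltW lt).
  by rewrite detE -D2; apply/andP; split; lra.
split.
- rewrite /H'; case: (leP (Num.sqrt (fdet H) / 4) (fx (gm g0 H))) => lt //.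
  rewrite -/D in lt *; have hl := ler_wpM2l (ltW D0) (ltW lt).
  have hp := exprn_gt0 2 D0.
  apply: (fpos_timelike pH); first by rewrite detE -D2; lra.
  have -> : bip H (fcomb 1 H (D / 4) e) = 2 * fdet H + (D / 4) * bip H e.
    by rewrite /fdet /bip !fcombE; ring.
  by rewrite bE -D2; lra.
- rewrite /H'; case: (leP (Num.sqrt (fdet H) / 4) (fx (gm g0 H))) => lt.
    suff -> : fcomb 2 H (-1) H = H by [].
    by apply: hformP; rewrite !fcombE; ring.
  have -> : fcomb 2 H (-1) (fcomb 1 H (D / 4) e) = fcomb 1 H (- (D / 4)) e.
    by apply: hformP; rewrite !fcombE; ring.
  rewrite -/D in lt *; have hl := ler_wpM2l (ltW D0) (ltW lt).
  have hp := exprn_gt0 2 D0.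
  apply: (fpos_timelike pH); first by rewrite detE -D2; lra.
  have -> : bip H (fcomb 1 H (- (D / 4)) e) = 2 * fdet H - (D / 4) * bip H e.
    by rewrite /fdet /bip !fcombE; ring.
  by rewrite bE -D2; lra.
- have : Num.min c (1 / 2) <= 1 / 2 by rewrite ge_min lexx orbT.
  move=> h3; have := ler_wpM2r hq h3; rewrite D2; case/andP: detH'; lra.
- move=> h hs.
  have h1 : c * D <= fx (gm h (H' H)).
    by have := near Hc H; apply.
  apply: le_trans h1; apply: ler_pM; [exact: ltW|exact: sqrtr_ge0|by rewrite ge_min lexx|].
  by apply: ler_wsqrtr; case/andP: detH'.
Unshelve. all: by end_near. Qed.

Variable e : R.
Hypothesis e0 : 0 < e.

Definition thin_at (T : R) H : Prop := fpos H -> ftr H = 1 -> tile s H ->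
  (forall n, cusp_point s n -> ~ near_dir e n H) -> low T H.

Lemma thin_at_room H0 :
  (exists c C, [/\ 0 < c, 0 < C & \forall H \near (H0 : form4), fpos (H : hform R) ->
    tile s H -> has_room c C H]) ->
  exists2 T, 0 < T & \forall H \near (H0 : form4), thin_at T H.
Proof.
move=> [c [C [c0 C0 nr]]]; have [T T0 HT] := room_low c0 C0.
exists T => //; apply: filterS nr => H nr pH _ tH _.
exact: HT (nr pH tH).
Qed.

(** Away from cusp points every form in the closure of the tile has room nearby; forms that
    are not in this closure satisfy [thin_at] vacuously. *)
Lemma thin_local H0 : 0 <= fd H0 -> 0 <= fa H0 ->
  exists2 T, 0 < T & \forall H \near (H0 : form4), thin_at T H.
Proof.
move=> d0 a0.
have cD := @cont_fdet R H0; have cT := @cont_ftr R H0.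
have [t1|t1|t1] := ltgtP (ftr H0) 1.
- exists 1 => //; near=> H => _ t; exfalso.
  have : ftr H < 1 by near: H; exact: (cvgr_lt _ cT).
  by rewrite t ltxx.
- exists 1 => //; near=> H => _ t; exfalso.
  have : 1 < ftr H by near: H; exact: (cvgr_gt _ cT).
  by rewrite t ltxx.
have [D0|D0] := ltP (fdet H0) 0.
  exists 1 => //; near=> H => -[_ D] _; exfalso.
  have : fdet H < 0 by near: H; exact: (cvgr_lt _ cD).
  by rewrite ltNge ltW.
have [[h [hs h0]]|nh] := pselect (exists h, h \in s /\ fx (gm h H0) < 0).
  exists 1 => //; near=> H => _ _ [_ /(_ h hs) D]; exfalso.
  have : fx (gm h H) < 0 by near: H; apply: (cvgr_lt _ (@cont_fxgm R h H0)).
  by rewrite ltNge D.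
have hpos h : h \in s -> 0 <= fx (gm h H0).
  by move=> hs; rewrite leNgt; apply/negP => l; apply: nh; exists h.
move: D0; rewrite le_eqVlt => /orP[/eqP/esym D0|D0]; last first.
  apply: thin_at_room; apply: room_interior; split=> //.
  rewrite lt_def d0 andbT; apply/eqP => z; move: D0; rewrite /fdet z mulr0.
  by have := sqr_ge0 (fx H0); have := sqr_ge0 (fy H0); lra.
have n0 : fnull H0 by split=> //; rewrite t1.
have [cp|ncp] := pselect (cusp_point s H0).
  exists 1 => //.
  have nb (f : form4 -> R) : continuous f -> \forall H \near (H0 : form4), `|f H - f H0| < e.
    by move=> cf; have /cvgr_distC_lt := cf (H0 : form4); apply.
  near=> H => _ tH _ /(_ H0 cp) []; rewrite /near_dir tH !mul1r !mulr1.
  split; near: H; apply: nb.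
  - exact: cont_fd.
  - exact: cont_fy.
  - exact: cont_fx.
  - exact: cont_fa.
apply: thin_at_room.
have [[g0 [g0s z0]]|no] := pselect (exists g0, g0 \in s /\ fx (gm g0 H0) = 0).
  apply: (room_side D0 hpos g0s z0) => h hs hz; apply: contrapT => nc.
  by apply: ncp; split=> //; exists g0, h; split.
apply: room_ordinary => // h hs; rewrite lt_def hpos // andbT.
by apply/eqP => z; apply: no; exists h.
Unshelve. all: by end_near. Qed.

(** Forms of trace 1 in the closed cone are a compact set, so the local constants of
    [thin_local] can be made uniform. *)
Lemma thin : exists2 T, 0 < T & forall g K, S g -> fpos K -> tile s (gm g K) ->
  T ^+ 2 * fd K ^+ 2 <= fdet K -> exists2 n, cusp_point s n & near_dir e n (gm g K).
Proof.
pose I01 : set R := `[0, 1]%classic; pose I11 : set R := `[-1, 1]%classic.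
pose X : set form4 := I01 `*` I11 `*` I11 `*` I01.
have cX : compact X.
  by do 3?apply: compact_setX; exact: segment_compact.
have ncX := (compact_near_coveringP X).1 cX.
have : \forall T \near +oo, X `<=` thin_at T.
  apply: (ncX R (pinfty_nbhs R) thin_at) => H0 XH0.
  have dH0 : 0 <= fd H0.
    by case: XH0 => [[[]]]; rewrite /I01 /= in_itv /= => /andP[].
  have aH0 : 0 <= fa H0.
    by case: XH0 => _; rewrite /I01 /= in_itv /= => /andP[].
  have [T T0 nT] := thin_local dH0 aH0.
  exists ([set H | thin_at T H], [set T' | T <= T']); last first.
    move=> [H T'] /= [tH TT] p1 p2 p3 p4; apply: (low_mono T0 TT); exact: tH.
  by split; [exact: nT|apply: nbhs_pinfty_ge; exact: num_real].
move=> nT; have : \forall T \near +oo, (X `<=` thin_at T) /\ 0 < T.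
  apply: filterS2 nT (nbhs_pinfty_gt (num_real 0)) => T XT T0; split=> //.
move=> nT'; have [T [XT T0]] := filter_ex nT'.
exists T => // g K Sg pK tK high; apply: contrapT => nn.
have pH : fpos (gm g K) by exact: gm_pos.
have aH := fpos_fa pH; have [dH DH] := pH.
have t0 : 0 < ftr (gm g K) by rewrite /ftr addr_gt0.
set H := gm g K in tK nn pH aH dH DH t0.
pose c := (ftr H)^-1.
have c0 : 0 < c by rewrite invr_gt0.
pose H1 := fscale c H.
have pH1 : fpos H1 by apply/fscaleK_pos.
have [d1 D1] := pH1; have a1 := fpos_fa pH1.
have t1 : ftr H1 = 1 by rewrite /ftr !fscaleE -mulrDr mulVf // gt_eqF.
have XH1 : X (H1 : form4).
  have bd (x : R) : x ^+ 2 <= 1 -> I11 x.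
    by move=> x1; rewrite /I11 /= in_itv /=; apply/andP; split; nra.
  have q : fx H1 ^+ 2 + fy H1 ^+ 2 <= 1.
    have : fa H1 * fd H1 <= 1.
      move: t1 d1 a1; rewrite /ftr; move: (fa H1) (fd H1) => a d t1 d1 a1; nra.
    by move: D1; rewrite /fdet; lra.
  have i01 : I01 (fd H1) /\ I01 (fa H1).
    move: t1 d1 a1; rewrite /ftr /I01 /= !in_itv /=; move: (fa H1) (fd H1) => a d t1 d1 a1.
    by split; apply/andP; split; lra.
  have sx := sqr_ge0 (fx H1); have sy := sqr_ge0 (fy H1).
  split; [split; [split|]|].
  - by case: i01.
  - by apply: (bd (fy H1)); lra.
  - by apply: (bd (fx H1)); lra.
  - by case: i01.
have tH1 : tile s H1.
  split=> // h hs; rewrite gm_scale fscaleE; apply: mulr_ge0; [exact: ltW|exact: tK.2].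
apply: (XT _ XH1 pH1 t1 tH1) Sg _.
  move=> n cn [e1 e2 e3 e4]; apply: nn; exists n => //.
  have E (u v : R) : `|c * u - 1 * v| < e * 1 -> `|u - ftr H * v| < e * ftr H.
    rewrite mul1r mulr1 => l.
    have -> : u - ftr H * v = ftr H * (c * u - v) by rewrite /c; field; rewrite gt_eqF.
    by rewrite normrM (gtr0_norm t0) mulrC ltr_pM2r.
  by rewrite t1 in e1 e2 e3 e4; split; apply: E.
rewrite /H1 gm_scale fscaleE /H gmK -/H.
have -> : fdet (fscale c H) = c ^+ 2 * fdet K.
  by rewrite -[fdet K](gm_det g) -/H /fdet !fscaleE; ring.
by rewrite exprMn mulrCA ler_pM2l // exprn_gt0.
Qed.
End Thin.

(** * The flow away from an ideal point *)

Section Flow.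
Variable R : realType.
Implicit Types (K L H n m : hform R) (g h : PSL2 R).
Notation form4 := (R * R * R * R)%type.

(** The geodesic flow away from the ideal point n, on forms; the coefficient is such that
    the determinant is divided by 4, and [flow0] is the case of oo. *)
Definition flow n H : hform R := fcomb 1 H (- (3 / 4 * (fdet H / bip H n))) n.

Lemma null_npt n : fnull n -> exists2 c, 0 < c & exists xi, n = fscale c (npt xi).
Proof.
move=> n0; have [d0|d0] := eqVneq (fd n) 0.
  have [x0 y0 a0] := null_d n0 d0.
  exists (fa n) => //; exists None; apply: hformP; rewrite fscaleE /npt.
  - by rewrite d0 mulr0.
  - by rewrite y0 mulr0.
  - by rewrite x0 mulr0.
  - by rewrite mulr1.
have [D d1 _ _] := n0; have dp : 0 < fd n by rewrite lt_def d0.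
exists (fd n) => //; exists (Some ((fx n / fd n) +i* (fy n / fd n))).
apply: hformP; rewrite fscaleE /npt.
- by rewrite mulr1.
- by rewrite [fy (mkf _ _ _ _)]/= mulrC divfK.
- by rewrite [fx (mkf _ _ _ _)]/= mulrC divfK.
- rewrite [fa (mkf _ _ _ _)]/fa /sqnorm /=; apply: (mulIf d0).
  have -> : fa n * fd n = fx n ^+ 2 + fy n ^+ 2 by move: D; rewrite /fdet; lra.
  by field.
Qed.

(** The group is transitive on ideal points, so that [flow] is conjugate to [flow0]. *)
Lemma null_orbit n : fnull n -> exists k c, 0 < c /\ n = fscale c (gm k (inf_pt R)).
Proof.
move=> /null_npt [c c0 [xi ->]].
have [k kxi] : exists k, mobius k None = xi.
  case: xi => [z|]; last first.
    by exists 1%g; rewrite -[1%g]/(psl 1%g) mobius_psl /mobius_mx /= !mxE /= eqxx.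
  have dz : \det (mx2 z (-1) 1 0) = 1 by rewrite det_mx2 mulr0 mulr1 sub0r opprK.
  exists (psl (toSL2 dz)); rewrite mobius_psl /mobius_mx /= !mx2E oner_eq0.
  by rewrite divr1.
have [c' c'0 E] := gm_npt k None; rewrite kxi in E.
exists k, (c / c'); split; first by rewrite divr_gt0.
by rewrite /inf_pt E; apply: hformP; rewrite !fscaleE mulrA divfK // gt_eqF.
Qed.

Lemma flow_scale c n H : c != 0 -> bip H n != 0 -> flow (fscale c n) H = flow n H.
Proof.
move=> c0 b0; have bE : bip H (fscale c n) = c * bip H n by rewrite /bip !fscaleE; ring.
by apply: hformP; rewrite !fcombE !fscaleE bE; field; rewrite c0 b0.
Qed.

Lemma gm_flow g n H : gm g (flow n H) = flow (gm g n) (gm g H).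
Proof. by rewrite /flow gm_comb gm_det gm_bip. Qed.

Lemma flow_inf H : fpos H -> flow (inf_pt R) H = flow0 H.
Proof.
move=> [d0 _]; have dn : fd H != 0 by rewrite gt_eqF.
have b : bip H (inf_pt R) = fd H.
  by rewrite /bip /inf_pt /npt /fd /fa /fx /fy /=; ring.
apply: hformP; rewrite /flow !fcombE b /flow0.
- by rewrite [fd (mkf _ _ _ _)]/fd [fd (inf_pt _)]/fd /=; ring.
- by rewrite [fy (mkf _ _ _ _)]/fy [fy (inf_pt _)]/fy /=; ring.
- by rewrite [fx (mkf _ _ _ _)]/fx [fx (inf_pt _)]/fx /=; ring.
- by rewrite [fa (mkf _ _ _ _)]/fa [fa (inf_pt _)]/fa /= /fdet; field.
Qed.

(** The flow is defined on positive forms only; its conjugacy with [flow0] provides a total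
    bijection extending it. *)
Lemma flow_bij n : fnull n -> exists f f' : hform R -> hform R,
  [/\ volscale 4 f, volscale 4^-1 f', cancel f f', cancel f' f &
    forall H, fpos H -> f H = flow n H].
Proof.
move=> n0; have [k [c [c0 nE]]] := null_orbit n0.
exists (gm k \o (@flow0 R \o gm k^-1%g)), (gm k \o (@flow0V R \o gm k^-1%g)); split.
- have := volscale_comp (volpres_gm k) (volscale_comp (volscale_flow0 R) (volpres_gm k^-1%g)).
  by rewrite mul1r mulr1.
- have := volscale_comp (volpres_gm k) (volscale_comp (volscale_flow0V R) (volpres_gm k^-1%g)).
  by rewrite mul1r mulr1.
- by move=> H /=; rewrite gmK flow0K gmVK.
- by move=> H /=; rewrite gmK flow0VK gmVK.
move=> H pH /=; have pk := gm_pos k^-1%g pH.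
rewrite -flow_inf // gm_flow gmVK nE flow_scale ?gt_eqF //.
apply: bip_null => //; rewrite -[gm k _](_ : fscale c^-1 n = _).
  by apply: null_fscale; rewrite ?invr_gt0.
by rewrite nE; apply: hformP; rewrite !fscaleE mulKf // gt_eqF.
Qed.

(** Moving by any proportion t < 1 of det H / <H, n> stays in the cone, since the determinant
    is multiplied by 1 - t. *)
Lemma fpos_flow_gen (t : R) n H : t < 1 -> fpos H -> fnull n ->
  fpos (fcomb 1 H (- (t * (fdet H / bip H n))) n) /\
  fdet (fcomb 1 H (- (t * (fdet H / bip H n))) n) = (1 - t) * fdet H.
Proof.
move=> t1 pH n0; have b0 := bip_null pH n0; have [_ DH] := pH.
have bn : bip H n != 0 by rewrite gt_eqF.
set c := t * _.
have E : fdet (fcomb 1 H (- c) n) = fdet H - c * bip H n + c ^+ 2 * fdet n.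
  by rewrite /fdet /bip !fcombE; ring.
have cb : c * bip H n = t * fdet H by rewrite /c -mulrA divfK.
case: (n0) => Dn _ _ _; rewrite Dn mulr0 addr0 cb in E.
have E2 : fdet (fcomb 1 H (- c) n) = (1 - t) * fdet H by rewrite E; ring.
have D' : 0 < fdet (fcomb 1 H (- c) n) by rewrite E2 mulr_gt0 // subr_gt0.
split=> //; apply: (fpos_timelike pH D').
have -> : bip H (fcomb 1 H (- c) n) = 2 * fdet H - c * bip H n.
  by rewrite /fdet /bip !fcombE; ring.
rewrite cb; have := mulr_gt0 (_ : 0 < 1 - t) DH; rewrite subr_gt0 => /(_ t1).
lra.
Qed.

Lemma fpos_flow n H : fpos H -> fnull n -> fpos (flow n H).
Proof. by move=> pH n0; apply: (fpos_flow_gen _ pH n0).1; lra. Qed.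

Lemma det_flow n H : fpos H -> fnull n -> fdet (flow n H) = fdet H / 4.
Proof.
by move=> pH n0; rewrite /flow (fpos_flow_gen _ pH n0).2; [field|lra].
Qed.

(** At t = 15/16 the form is still positive, hence so is its trace. *)
Lemma flow_coef n H : fpos H -> fnull n -> ftr n = 1 ->
  0 <= 3 / 4 * (fdet H / bip H n) <= 4 / 5 * ftr H.
Proof.
move=> pH n0 t1; have b0 := bip_null pH n0; have [_ DH] := pH.
have q0 : 0 < fdet H / bip H n by rewrite divr_gt0.
have [p _] : fpos (fcomb 1 H (- (15 / 16 * (fdet H / bip H n))) n) /\ True.
  by split=> //; apply: (fpos_flow_gen _ pH n0).1; lra.
have := fpos_fa p; have [] := p; rewrite !fcombE.
move: t1; rewrite /ftr; move: q0; set q := fdet H / bip H n => q0 t1 h1 _ h2.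
have e : q * fa n + q * fd n = q by rewrite -mulrDr t1 mulr1.
by apply/andP; split; lra.
Qed.

Lemma ftr_flow n H : fpos H -> fnull n -> ftr n = 1 -> ftr H / 5 <= ftr (flow n H).
Proof.
move=> pH n0 t1; have := flow_coef pH n0 t1.
rewrite /ftr /flow !fcombE; set c := 3 / 4 * _ => h.
have e : c * fa n + c * fd n = c by rewrite -mulrDr; move: t1; rewrite /ftr => ->; rewrite mulr1.
move: h; rewrite /ftr; lra.
Qed.

Lemma near_flow e n H : fpos H -> fnull n -> ftr n = 1 -> 0 < e -> near_dir e n H ->
  near_dir (5 * e) n (flow n H).
Proof.
move=> pH n0 t1 e0 [h1 h2 h3 h4]; have tf := ftr_flow pH n0 t1.
have tE : ftr (flow n H) = ftr H - 3 / 4 * (fdet H / bip H n).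
  rewrite {1}/ftr /flow !fcombE; set c := 3 / 4 * _.
  have e' : c * fa n + c * fd n = c by rewrite -mulrDr; move: t1; rewrite /ftr => ->; rewrite mulr1.
  by rewrite /ftr; lra.
have le : e * ftr H <= 5 * e * ftr (flow n H) by have := ler_wpM2l (ltW e0) tf; lra.
have E (u v : R) : `|u - ftr H * v| < e * ftr H ->
    `|1 * u + - (3 / 4 * (fdet H / bip H n)) * v - ftr (flow n H) * v| < 5 * e * ftr (flow n H).
  move=> lt; apply: lt_le_trans le; apply: le_lt_trans lt.
  by rewrite tE le_eqVlt; apply/orP; left; apply/eqP; congr (`|_|); ring.
by split; rewrite /flow fcombE; apply: E.
Qed.

(** Here q = det K d(m) / (<K, m> d(K)) measures how far m is from oo as seen from K: it
    vanishes exactly when m is oo, and then the flow is vertical. In general the horizontal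
    displacement is only of order sqrt(q), while d decreases by the proportion 3 q / 4. *)
Lemma flow_drift m K : fpos K -> fnull m ->
  exists q p : R, [/\ 0 <= p, p ^+ 2 = q, q <= 1 /\ q = fdet K * fd m / (bip K m * fd K),
    fd (flow m K) = (1 - 3 / 4 * q) * fd K &
    `|fy (flow m K)| <= (1 - 3 / 4 * q) * `|fy K| + 3 / 4 * Num.sqrt (fdet K) * p].
Proof.
move=> pK m0; have b0 := bip_null pK m0; have [dK DK] := pK.
have [Dm dm _ _] := m0.
pose q := fdet K * fd m / (bip K m * fd K).
have bd0 : 0 < bip K m * fd K by rewrite mulr_gt0.
have q0 : 0 <= q by rewrite /q divr_ge0 ?mulr_ge0 // ltW.
have id1 : bip K m * (fd K * fd m) =
  (fd m * fx K - fd K * fx m) ^+ 2 + (fd m * fy K - fd K * fy m) ^+ 2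
  + fdet K * fd m ^+ 2.
  have : bip K m * (fd K * fd m) =
   (fd m * fx K - fd K * fx m) ^+ 2 + (fd m * fy K - fd K * fy m) ^+ 2
   + fdet K * fd m ^+ 2 + fdet m * fd K ^+ 2 by rewrite /bip /fdet; ring.
  by rewrite Dm mul0r addr0.
have s1 := sqr_ge0 (fd m * fx K - fd K * fx m).
have s2 := sqr_ge0 (fd m * fy K - fd K * fy m).
have q1 : q <= 1.
  rewrite /q ler_pdivrMr // mul1r.
  move: dm; rewrite le_eqVlt => /orP[/eqP <-|dm]; first by rewrite mulr0 ltW.
  rewrite -(ler_pM2r dm).
  have -> : fdet K * fd m * fd m = fdet K * fd m ^+ 2 by ring.
  by rewrite -mulrA id1; lra.
exists q, (Num.sqrt q); split=> //.
- by rewrite sqr_sqrtr.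
- by rewrite /flow fcombE /q; field; rewrite !gt_eqF.
set D := Num.sqrt (fdet K); have D0 : 0 <= D by exact: sqrtr_ge0.
have D2 : D ^+ 2 = fdet K by rewrite sqr_sqrtr // ltW.
pose w := 3 / 4 * (fdet K / bip K m) / fd K * (fd m * fy K - fd K * fy m).
have -> : fy (flow m K) = (1 - 3 / 4 * q) * fy K + w.
  by rewrite /flow fcombE /q /w; field; rewrite !gt_eqF.
have k0 : 0 <= 1 - 3 / 4 * q by lra.
apply: (le_trans (ler_normD _ _)); rewrite normrM (ger0_norm k0) lerD2l.
have r0 : 0 <= 3 / 4 * D * Num.sqrt q by rewrite !mulr_ge0 // sqrtr_ge0.
rewrite -(ler_pXn2r (n := 2)) ?nnegrE // ?normr_ge0 //.
rewrite real_normK ?num_real //.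
have -> : (3 / 4 * D * Num.sqrt q) ^+ 2 = (3 / 4) ^+ 2 * fdet K * q.
  by rewrite [LHS]exprMn [X in X * _]exprMn D2 sqr_sqrtr.
have bn : bip K m != 0 by rewrite gt_eqF.
have dn : fd K != 0 by rewrite gt_eqF.
have -> : w ^+ 2 = (3 / 4) ^+ 2 * (fdet K / bip K m / fd K) ^+ 2 * (fd m * fy K - fd K * fy m) ^+ 2.
  by rewrite /w; field; rewrite bn dn.
have -> : (3 / 4) ^+ 2 * fdet K * q = (3 / 4) ^+ 2 * (fdet K / bip K m / fd K) ^+ 2 *
   (bip K m * (fd K * fd m)).
  by rewrite /q; field; rewrite bn dn.
apply: ler_wpM2l; first by rewrite mulr_ge0 ?sqr_ge0.
rewrite id1; have := mulr_ge0 (ltW DK) (sqr_ge0 (fd m)); lra.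
Qed.
End Flow.

(** * Separating the ideal vertices *)

Section Labels.
Variable R : realType.
Implicit Types (K L H n m : hform R) (g h : PSL2 R).
Notation form4 := (R * R * R * R)%type.
Variables (s : seq (PSL2 R)).

Lemma cusp_seq : exists ns : seq form4, uniq ns /\
  forall n, n \in ns <-> cusp_point s n.
Proof.
have /finite_seqP [ns nsE] := @finite_cusp_point R s.
exists (undup ns); split; first exact: undup_uniq.
move=> n; rewrite mem_undup; split=> [nn|cn]; first by rewrite nsE.
by move: cn; rewrite nsE.
Qed.

(** The norm of the linear function fx o gm g. *)
Definition fbound g : R := `|fx (gm g (bas_d R))| + `|fx (gm g (bas_y R))|
  + `|fx (gm g (bas_x R))| + `|fx (gm g (bas_a R))|.

Definition apart (e : R) n m : Prop :=
  ~ [/\ `|fd n - fd m| < e, `|fy n - fy m| < e, `|fx n - fx m| < e & `|fa n - fa m| < e].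

(** At scale e the cusp points are separated from each other, and from the sides that do not
    contain them. The factors 5 and 10 allow for the growth of [near_dir] in [near_flow]. *)
Definition good_eps (ns : seq form4) (e : R) : Prop :=
  (forall n h, n \in ns -> h \in s -> fx (gm h n) = 0 \/ 5 * e * fbound h < fx (gm h n)) /\
  (forall n m, n \in ns -> m \in ns -> n <> m -> apart (10 * e) n m).

Lemma fbound_ge0 g : 0 <= fbound g.
Proof. by rewrite /fbound !addr_ge0. Qed.

Lemma good_eps_ex ns : (forall n, n \in ns -> cusp_point s n) ->
  exists2 e, 0 < e & good_eps ns e.
Proof.
move=> nsP.
pose Q1 (e : R) (n : form4) (_ : R) := forall h, h \in s -> fx (gm h n) = 0 \/ 5 * e * fbound h < fx (gm h n).
pose Q2 (e : R) (n : form4) (_ : R) := forall m, m \in ns -> n <> m -> apart (10 * e) n m.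
have mono1 (e e' : R) n x : e' <= e -> Q1 e n x -> Q1 e' n x.
  move=> le q h hs; case: (q h hs) => [->|lt]; [by left|right].
  apply: le_lt_trans lt; apply: ler_wpM2r; first exact: fbound_ge0.
  by rewrite ler_pM2l.
have mono2 (e e' : R) n x : e' <= e -> Q2 e n x -> Q2 e' n x.
  move=> le q m mn nm [h1 h2 h3 h4]; apply: (q m mn nm).
  have le10 : 10 * e' <= 10 * e by rewrite ler_pM2l.
  by split; apply: lt_le_trans le10.
have [||e1 e10 /nbhs_singleton He1] := @seq_near _ _ _ (nbhs (0 : R)) _ ns Q1.
- by move=> c c' k x _; exact: mono1.
- move=> n nn; have [_ _ npos _] := nsP n nn.
  have [||e e0 /nbhs_singleton He] := @seq_near _ _ _ (nbhs (0 : R)) _ s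
      (fun e h (_ : R) => fx (gm h n) = 0 \/ 5 * e * fbound h < fx (gm h n)).
  + move=> c c' h x _ le [->|lt]; [by left|right].
    apply: le_lt_trans lt; apply: ler_wpM2r; first exact: fbound_ge0.
    by rewrite ler_pM2l.
  + move=> h hs; have [z|z] := eqVneq (fx (gm h n)) 0.
      by exists 1 => //; apply: nearW => x; left.
    have z0 : 0 < fx (gm h n) by rewrite lt_def z npos.
    have b0 : 0 < fbound h + 1 by rewrite ltr_wpDl // fbound_ge0.
    exists (fx (gm h n) / (10 * (fbound h + 1))); first by rewrite divr_gt0 // mulr_gt0.
    apply: nearW => x; right.
    have -> : 5 * (fx (gm h n) / (10 * (fbound h + 1))) * fbound h =
      fx (gm h n) * (fbound h / (2 * (fbound h + 1))) by field; rewrite gt_eqF.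
    rewrite gtr_pMr // ltr_pdivrMr ?mulr_gt0 // mul1r.
    by have := fbound_ge0 h; lra.
  by exists e => //; apply: nearW => x h hs; exact: He.
have [||e2 e20 /nbhs_singleton He2] := @seq_near _ _ _ (nbhs (0 : R)) _ ns Q2.
- by move=> c c' k x _; exact: mono2.
- move=> n nn.
  have [||e e0 /nbhs_singleton He] := @seq_near _ _ _ (nbhs (0 : R)) _ ns
      (fun e m (_ : R) => n <> m -> apart (10 * e) n m).
  + move=> c c' m x _ le q nm [h1 h2 h3 h4]; apply: (q nm).
    have le10 : 10 * c' <= 10 * c by rewrite ler_pM2l.
    by split; apply: lt_le_trans le10.
  + move=> m mn; have [->|nm] := eqVneq n m; first by exists 1 => //; apply: nearW.
    have one (f : form4 -> R) : f n != f m -> 0 < `|f n - f m| / 10.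
      by move=> fnm; rewrite divr_gt0 // normr_gt0 subr_eq0.
    have far (f : form4 -> R) : `|f n - f m| < 10 * (`|f n - f m| / 10) -> False.
      by rewrite mulrCA divff // mulr1 ltxx.
    have [d1|d1] := eqVneq (fd n) (fd m); last first.
      by exists (`|fd n - fd m| / 10); [exact: one|apply: nearW => _ _ [/far]].
    have [d2|d2] := eqVneq (fy n) (fy m); last first.
      by exists (`|fy n - fy m| / 10); [exact: one|apply: nearW => _ _ [_ /far]].
    have [d3|d3] := eqVneq (fx n) (fx m); last first.
      by exists (`|fx n - fx m| / 10); [exact: one|apply: nearW => _ _ [_ _ /far]].
    have [d4|d4] := eqVneq (fa n) (fa m); last first.
      by exists (`|fa n - fa m| / 10); [exact: one|apply: nearW => _ _ [_ _ _ /far]].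
    by exfalso; move/eqP: nm; apply; exact: hformP.
  by exists e => //; apply: nearW => x m mn; exact: He.
exists (Num.min e1 e2); first by rewrite lt_min e10.
split=> [n h nn hs|n m nn mn nm].
  by apply: (mono1 e1 _ n 0) (He1 n nn) h hs; rewrite ge_min lexx.
by apply: (mono2 e2 _ n 0) (He2 n nn) m mn nm; rewrite ge_min lexx orbT.
Qed.

Lemma fbound_near g (v1 v2 v3 v4 b : R) : `|v1| <= b -> `|v2| <= b -> `|v3| <= b ->
  `|v4| <= b -> - (b * fbound g) <= fx (gm g (mkf v1 v2 v3 v4)).
Proof.
have one (v z : R) : `|v| <= b -> - (b * `|z|) <= v * z.
  move=> vb; rewrite lerNl -mulNr; apply: le_trans (ler_norm _) _.
  by rewrite normrM normrN ler_wpM2r.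
move=> b1 b2 b3 b4; rewrite fx_gm /fbound.
have := one _ (fx (gm g (bas_d R))) b1; have := one _ (fx (gm g (bas_y R))) b2.
have := one _ (fx (gm g (bas_x R))) b3; have := one _ (fx (gm g (bas_a R))) b4.
rewrite [fd (mkf _ _ _ _)]/fd [fy (mkf _ _ _ _)]/fy [fx (mkf _ _ _ _)]/fx
  [fa (mkf _ _ _ _)]/fa /=; lra.
Qed.

(** On a side through n the flow does not change the sign of the linear function defining
    the side; and far sides are not reached. *)
Lemma flow_tile0 ns e n H : good_eps ns e -> 0 < e -> n \in ns -> cusp_point s n ->
  tile0 s H -> near_dir e n H -> tile0 s (flow n H).
Proof.
move=> [good _] e0 nn [n0 t1 npos _] [pH tH] [h1 h2 h3 h4].
split; first exact: fpos_flow.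
have pt : 0 < ftr H by have := fpos_fa pH; case: pH => d0 _; rewrite /ftr; lra.
move=> h hs; rewrite /flow gm_comb fcombE mul1r.
have [z|lt] := good n h nn hs; first by rewrite z mulr0 addr0; exact: tH.
have /andP[c0 c1] := flow_coef pH n0 t1.
set c := 3 / 4 * _ in c0 c1 *.
pose V := fcomb 1 H (- ftr H) n.
have E : fx (gm h H) = ftr H * fx (gm h n) + fx (gm h V).
  by rewrite /V gm_comb fcombE; ring.
have bV : - (e * ftr H * fbound h) <= fx (gm h V).
  by apply: fbound_near; rewrite mul1r mulNr; apply: ltW.
rewrite E.
have := ler_wpM2r (_ : 0 <= fx (gm h n)) c1; rewrite npos // => /(_ isT).
have := ltr_pM2l pt (5 * e * fbound h) (fx (gm h n)); rewrite lt.
move=> l1 l2.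
have l3 : ftr H * (5 * e * fbound h) < ftr H * fx (gm h n) by rewrite l1.
lra.
Qed.
End Labels.

(** * The region over the cusp *)

Section Measurability.
Variable R : realType.
Notation gR := (measurableTypeR R).
Notation mform := (gR * gR * gR * gR)%type.

Lemma mset_lt (f g : mform -> R) : measurable_fun setT (f : mform -> gR) ->
  measurable_fun setT (g : mform -> gR) -> measurable [set K : mform | f K < g K].
Proof.
move=> mf mg.
have -> : [set K : mform | f K < g K] = (fun K : mform => f K < g K) @^-1` [set true].
  by apply/seteqP; split.
by rewrite -[X in measurable X]setTI; apply: measurable_fun_ltr.
Qed.
Lemma mset_le (f g : mform -> R) : measurable_fun setT (f : mform -> gR) ->
  measurable_fun setT (g : mform -> gR) -> measurable [set K : mform | f K <= g K].
Proof.
move=> mf mg.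
have -> : [set K : mform | f K <= g K] = (fun K : mform => f K <= g K) @^-1` [set true].
  by apply/seteqP; split.
by rewrite -[X in measurable X]setTI; apply: measurable_fun_ler.
Qed.

Lemma mset_gm (g : PSL2 R) (A : set mform) : measurable A ->
  measurable [set K : mform | A (gm g K)].
Proof.
move=> mA; rewrite -[X in measurable X]setTI.
exact: ((volpres_gm g).1 measurableT A mA).
Qed.

Lemma measurable_tile0 (s : seq (PSL2 R)) : measurable (tile0 s : set mform).
Proof.
have -> : (tile0 s : set mform) = [set K : mform | fpos K] `&`
    \bigcap_n [set K : mform | (n < size s)%N -> 0 < fx (gm (nth 1%g s n) K)].
  apply/seteqP; split=> K /=.
    by move=> [pK tK]; split=> // n _ /= ns; apply: tK; exact: mem_nth.
  move=> [pK tK]; split=> // h hs.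
  by have := tK (index h s) I; rewrite /= index_mem nth_index //; apply.
apply: measurableI; first exact: measurable_fpos.
apply: bigcapT_measurable => n.
have [ns|ns] := boolP (n < size s)%N; last first.
  rewrite (_ : [set K | _] = setT) //; by apply/seteqP; split.
rewrite (_ : [set K | _] = [set K | (0 : R) < fx (gm (nth 1%g s n) K)]); last first.
  by apply/seteqP; split=> K /= H; [exact: H|].
have := mset_gm (nth 1%g s n) (mset_lt (measurable_cst (0 : gR)) (@measurable_fx R)).
by [].
Qed.

Lemma measurable_near_dir (e : R) (n : hform R) :
  measurable [set K : mform | near_dir e n K].
Proof.
have one (f : mform -> R) (v : R) : measurable_fun setT (f : mform -> gR) ->
    measurable [set K : mform | `|f K - ftr K * v| < e * ftr K].
  move=> mf.
  have -> : [set K : mform | `|f K - ftr K * v| < e * ftr K] =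
    [set K : mform | - (e * ftr K) < f K - ftr K * v] `&`
    [set K : mform | f K - ftr K * v < e * ftr K].
    by apply/seteqP; split=> K /=; rewrite ltr_norml => /andP.
  apply: measurableI; apply: mset_lt; rewrite /ftr; mfun.
have -> : [set K : mform | near_dir e n K] =
  [set K : mform | `|fd K - ftr K * fd n| < e * ftr K] `&`
  [set K : mform | `|fy K - ftr K * fy n| < e * ftr K] `&`
  [set K : mform | `|fx K - ftr K * fx n| < e * ftr K] `&`
  [set K : mform | `|fa K - ftr K * fa n| < e * ftr K].
  by apply/seteqP; split=> K /=; [move=> [? ? ? ?]|move=> [[[? ?] ?] ?]; split].
apply: measurableI; last by apply: one; exact: measurable_fa.
apply: measurableI; last by apply: one; exact: measurable_fx.
by apply: measurableI; apply: one; [exact: measurable_fd|exact: measurable_fy].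
Qed.

(** The fundamental domain 0 <= x / d < 1 of the integral translations. *)
Definition box : set (hform R) := [set K | 0 <= fx K < fd K].
Lemma measurable_box : measurable (box : set mform).
Proof.
have -> : (box : set mform) = [set K : mform | 0 <= fx K] `&` [set K : mform | fx K < fd K].
  by apply/seteqP; split=> K /= => /andP.
by apply: measurableI; [apply: mset_le|apply: mset_lt]; mfun.
Qed.

Lemma measurable_absy : measurable_fun [set: mform] ((fun K => `|fy K|) : mform -> gR).
Proof.
apply: (@measurableT_comp _ _ _ _ _ _ (fun x : gR => `|x| : gR)); last exact: measurable_fy.
exact: normr_measurable.
Qed.
Lemma measurable_sqdet : measurable_fun [set: mform] ((fun K => Num.sqrt (fdet K)) : mform -> gR).
Proof.
apply: (@measurableT_comp _ _ _ _ _ _ (fun x : gR => Num.sqrt x : gR)).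
  by apply: continuous_measurable_fun; exact: sqrt_continuous.
by rewrite /fdet; mfun.
Qed.

(** The part of the horoball of height T over the box. The term e |y| is a tilt which makes
    its volume finite, as the box is unbounded in the direction of y. *)
Definition roof (c T e : R) : set (hform R) :=
  [set K | [/\ fpos K, box K, fdet K <= c & T * fd K + e * `|fy K| <= Num.sqrt (fdet K)]].

Lemma measurable_roof c T e : measurable (roof c T e : set mform).
Proof.
have -> : (roof c T e : set mform) = [set K : mform | fpos K] `&` box `&`
   [set K : mform | fdet K <= c] `&`
   [set K : mform | T * fd K + e * `|fy K| <= Num.sqrt (fdet K)].
  by apply/seteqP; split=> K /=; [move=> []|move=> [[[]]]].
apply: measurableI.
  apply: measurableI.
    by apply: measurableI; [exact: measurable_fpos|exact: measurable_box].
  by apply: mset_le; rewrite /fdet; mfun.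
apply: mset_le; last exact: measurable_sqdet.
apply: measurable_funD; first by mfun.
by apply: measurable_funM => //; exact: measurable_absy.
Qed.

Lemma vol_roof c T e : 0 < c -> 0 < T -> 0 < e -> (vol R (roof c T e) < +oo)%E.
Proof.
move=> c0 T0 e0; set q := Num.sqrt c.
have q0 : 0 < q by rewrite sqrtr_gt0.
have := @vol_thin R (roof c T e) (q / T) (q / e) c
  (fun t => (t.2 ^+ 2 + t.1.2 ^+ 2) / t.1.1).
move=> /(_ (measurable_roof c T e)) H; apply: (le_lt_trans (H _ _ _ _)); rewrite ?ltry ?divr_gt0 //.
  exact: ltW.
move=> K [[d0 D0] bK Dc le].
have Dq : Num.sqrt (fdet K) <= q by apply: ler_wsqrtr.
have y0 := normr_ge0 (fy K).
split=> //.
- rewrite d0 ler_pdivlMr // mulrC; apply: le_trans Dq; apply: le_trans le.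
  by rewrite lerDl mulr_ge0 // ltW.
- rewrite ler_pdivlMr // mulrC; apply: le_trans Dq; apply: le_trans le.
  by rewrite lerDr mulr_ge0 // ltW.
have -> : (K.1.2 ^+ 2 + K.1.1.2 ^+ 2) / K.1.1.1 = (fx K ^+ 2 + fy K ^+ 2) / fd K by [].
rewrite -mulrDl ler_pdivrMr // ler_pdivlMr //.
by move: D0 Dc; rewrite /fdet => D0 Dc; apply/andP; split; lra.
Qed.

(** Where the squares of sqrt(det) and of its lower bound 2 (T d + e |y|) differ by O(e^2)
    only; see [loss_ineq]. *)
Definition layer (T e : R) : set (hform R) :=
  [set K | [/\ fpos K, box K, 0 < fdet K <= 1 &
     4 * (T * fd K + e * `|fy K|) ^+ 2 <= fdet K
      <= 4 * (T * fd K + e * `|fy K|) ^+ 2 + 6 * e ^+ 2]].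

Lemma measurable_layer T e : measurable (layer T e : set mform).
Proof.
have -> : (layer T e : set mform) = [set K : mform | fpos K] `&` box `&`
   ([set K : mform | 0 < fdet K] `&` [set K : mform | fdet K <= 1]) `&`
   ([set K : mform | 4 * (T * fd K + e * `|fy K|) ^+ 2 <= fdet K] `&`
    [set K : mform | fdet K <= 4 * (T * fd K + e * `|fy K|) ^+ 2 + 6 * e ^+ 2]).
  apply/seteqP; split=> K /=; first by move=> [? ? /andP[? ?] /andP[? ?]].
  by move=> [[[? ?] [h1 h2]] [h3 h4]]; split=> //; apply/andP.
have mM : measurable_fun [set: mform] ((fun K => 4 * (T * fd K + e * `|fy K|) ^+ 2) : mform -> gR).
  apply: measurable_funM => //; apply: measurable_funX.
  apply: measurable_funD; first by mfun.
  by apply: measurable_funM => //; exact: measurable_absy.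
have mD : measurable_fun [set: mform] (@fdet R : mform -> gR) by rewrite /fdet; mfun.
apply: measurableI.
  apply: measurableI.
    by apply: measurableI; [exact: measurable_fpos|exact: measurable_box].
  by apply: measurableI; [apply: mset_lt|apply: mset_le].
apply: measurableI; first exact: mset_le.
by apply: mset_le => //; apply: measurable_funD.
Qed.

Lemma vol_layer T e : 0 < T -> 0 < e -> (vol R (layer T e) <= (12 * e / T)%:E)%E.
Proof.
move=> T0 e0.
have Ti : 0 < T^-1 by rewrite invr_gt0.
have ei : 0 < e^-1 by rewrite invr_gt0.
have := @vol_thin R (layer T e) T^-1 e^-1 (6 * e ^+ 2)
  (fun t => (t.2 ^+ 2 + t.1.2 ^+ 2 + 4 * (T * t.1.1 + e * `|t.1.2|) ^+ 2) / t.1.1).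
move=> /(_ (measurable_layer T e)) H; apply: (le_trans (H Ti ei _ _)).
- by rewrite mulr_ge0 // sqr_ge0.
- move=> K [[d0 D0] bK /andP[_ D1] /andP[l1 l2]].
  have y0 := normr_ge0 (fy K).
  have M1 : T * fd K + e * `|fy K| <= 1.
    have p : 0 <= T * fd K + e * `|fy K| by rewrite addr_ge0 // mulr_ge0 // ltW.
    move: (T * fd K + e * _) p l1 => M p l1; nra.
  split=> //.
  + rewrite d0 -[_^-1]mul1r ler_pdivlMr // mulrC; apply: le_trans M1.
    by rewrite lerDl mulr_ge0 // ltW.
  + rewrite -[_^-1]mul1r ler_pdivlMr // mulrC; apply: le_trans M1.
    by rewrite lerDr mulr_ge0 // ltW.
  have -> : (K.1.2 ^+ 2 + K.1.1.2 ^+ 2 + 4 * (T * K.1.1.1 + e * `|K.1.1.2|) ^+ 2) / K.1.1.1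
    = (fx K ^+ 2 + fy K ^+ 2 + 4 * (T * fd K + e * `|fy K|) ^+ 2) / fd K by [].
  rewrite -mulrDl ler_pdivrMr // ler_pdivlMr //.
  by move: l1 l2; rewrite /fdet => l1 l2; apply/andP; split; lra.
rewrite lee_fin le_eqVlt; apply/orP; left; apply/eqP; field.
by rewrite !gt_eqF.
Qed.
End Measurability.
Arguments box {R}.

(** * Neighbourhoods in the space of forms *)

Section Near.
Variable R : realType.
Notation gR := (measurableTypeR R).
Notation mform := (gR * gR * gR * gR)%type.
Notation form4 := (R * R * R * R)%type.
Implicit Types (K L H n m : hform R) (g h : PSL2 R).

Lemma cont_gm g : continuous (gm g : form4 -> form4).
Proof.
move=> K.
have lin (f : form4 -> R) (b : bool) : (forall L, f (gm g L) = fd L * f (gm g (bas_d R))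
    + fy L * f (gm g (bas_y R)) + fx L * f (gm g (bas_x R)) + fa L * f (gm g (bas_a R))) ->
    {for K, continuous (fun L : form4 => f (gm g L))}.
  move=> fE; rewrite (_ : (fun L => _) = (fun L => fd L * f (gm g (bas_d R))
    + fy L * f (gm g (bas_y R)) + fx L * f (gm g (bas_x R)) + fa L * f (gm g (bas_a R)))).
    by apply: (_ : continuous _); mcont.
  by apply/funext.
have cd := lin _ true (fd_gm g); have cy := lin _ true (fy_gm g).
have cx := lin _ true (fx_gm g); have ca := lin _ true (fa_gm g).
exact: (cvg_pair (cvg_pair (cvg_pair cd cy) cx) ca).
Qed.

Lemma near_gm g K (P : set form4) :
  (\forall L \near (gm g K : form4), P L) -> \forall L \near (K : form4), P (gm g L).
Proof. exact: cont_gm. Qed.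

Lemma near_tile0 s K : tile0 s K -> \forall L \near (K : form4), tile0 s L.
Proof.
move=> [pK sK]; have : \forall L \near (K : form4), forall h, h \in s -> 0 < fx (gm h L).
  elim: s sK => [|h s IH] sK; first by near=> L.
  have h1 : \forall L \near (K : form4), forall h, h \in s -> 0 < fx (gm h L).
    by apply: IH => k ks; apply: sK; rewrite in_cons ks orbT.
  have h2 : \forall L \near (K : form4), 0 < fx (gm h L).
    by apply: (cvgr_gt _ (@cont_fxgm R h K)); apply: sK; rewrite mem_head.
  near=> L.
  have q1 : forall k, k \in s -> 0 < fx (gm k L) by near: L.
  have q2 : 0 < fx (gm h L) by near: L.
  by move=> k; rewrite in_cons => /orP[/eqP->|/q1].
move=> h; have h' := near_fpos pK; near=> L; split; near: L => //.
Unshelve. all: by end_near. Qed.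

Lemma near_near_dir (e : R) n K :
  near_dir e n K -> \forall L \near (K : form4), near_dir e n L.
Proof.
have one (f : form4 -> R) (v : R) : continuous f -> `|f K - ftr K * v| < e * ftr K ->
    \forall L \near (K : form4), `|f L - ftr L * v| < e * ftr L.
  move=> cf; rewrite ltr_norml => /andP[h1 h2].
  have c1 : continuous (fun L : form4 => e * ftr L + (f L - ftr L * v)).
    by have ct := @cont_ftr R; mcont.
  have c2 : continuous (fun L : form4 => e * ftr L - (f L - ftr L * v)).
    by have ct := @cont_ftr R; mcont.
  have p1 : 0 < e * ftr K + (f K - ftr K * v) by lra.
  have p2 : 0 < e * ftr K - (f K - ftr K * v) by lra.
  have n1 := cvgr_gt _ (c1 K) _ p1; have n2 := cvgr_gt _ (c2 K) _ p2.
  near=> L; rewrite ltr_norml.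
  have q1 : 0 < e * ftr L + (f L - ftr L * v) by near: L; exact: n1.
  have q2 : 0 < e * ftr L - (f L - ftr L * v) by near: L; exact: n2.
  by apply/andP; split; move: q1 q2; set X := e * _; set Y := f L - _ => q1 q2; lra.
move=> [a b c d].
have h1 := one _ _ (@cont_fd R) a; have h2 := one _ _ (@cont_fy R) b.
have h3 := one _ _ (@cont_fx R) c; have h4 := one _ _ (@cont_fa R) d.
by near=> L; split; near: L.
Unshelve. all: by end_near. Qed.

(** A box around K does. *)
Lemma nbhs_measurable K (U : set form4) : nbhs (K : form4) U ->
  exists G : set mform, [/\ measurable G, nbhs (K : form4) (G : set form4) & G `<=` U].
Proof.
move=> /nbhs_ballP[r /= r0 sub]; exists (ball (K : form4) r : set mform); split => //.
  have one (f : mform -> R) (c : R) : measurable_fun setT (f : mform -> gR) ->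
      measurable [set L : mform | `|c - f L| < r].
    move=> mf; rewrite (_ : mkset _ = [set L | c - r < f L] `&` [set L | f L < c + r]).
      by apply: measurableI; apply: mset_lt => //; mfun.
    apply/seteqP; split=> L /=; rewrite ltr_norml.
      by move=> /andP[a b]; split; lra.
    by move=> [a b]; apply/andP; split; lra.
  rewrite (_ : ball _ _ = [set L : mform | `|fd K - fd L| < r] `&` [set L : mform | `|fy K - fy L| < r]
     `&` [set L : mform | `|fx K - fx L| < r] `&` [set L : mform | `|fa K - fa L| < r]).
    by repeat apply: measurableI; apply: one; mfun.
  by apply/seteqP; split=> L.
exact: nbhsx_ballx.
Qed.

Lemma cont_sqdet : continuous ((fun K => Num.sqrt (fdet K)) : form4 -> R).
Proof.
move=> K; apply: (@continuous_comp _ _ _ (@fdet R : form4 -> R) (@Num.sqrt R) K).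
  exact: cont_fdet.
exact: sqrt_continuous.
Qed.
Lemma cont_absy : continuous ((fun K => `|fy K|) : form4 -> R).
Proof.
move=> K; apply: (@continuous_comp _ _ _ (@fy R : form4 -> R) (fun x : R => `|x|) K).
  exact: cont_fy.
exact: norm_continuous.
Qed.
End Near.

(** * The piecewise flow over the cusp *)

Section Flux.
Variable R : realType.
Notation gR := (measurableTypeR R).
Notation mform := (gR * gR * gR * gR)%type.
Notation form4 := (R * R * R * R)%type.
Implicit Types (K L H n m : hform R) (g h : PSL2 R).

Lemma upperM (z w : R[i]) : (upper z * upper w)%g = upper (z + w).
Proof.
rewrite -[(_ * _)%g]/(PSL2_mul _ _) psl_mul; congr (psl _); apply: val_inj => /=.
by rewrite mulmx2 !(mul1r, mulr1, mul0r, mulr0, addr0, add0r) addrC.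
Qed.

Lemma upper0 : upper 0 = 1%g :> PSL2 R.
Proof. by apply: (@mulgI _ (upper 0)); rewrite upperM addr0 mulg1. Qed.

Lemma upperV (z : R[i]) : (upper z)^-1%g = upper (- z).
Proof. by apply: (@mulgI _ (upper z)); rewrite mulgV upperM subrr upper0. Qed.

Lemma u_mul (a b : R) : (u_ a * u_ b)%g = u_ (a + b).
Proof. by rewrite /u_ upperM -rmorphD. Qed.

Lemma u_zero : u_ 0 = 1%g :> PSL2 R.
Proof. exact: upper0. Qed.

Lemma u_inv (a : R) : (u_ a)^-1%g = u_ (- a).
Proof. by rewrite /u_ upperV -rmorphN. Qed.

Variables (S : set (PSL2 R)) (s : seq (PSL2 R)).
Hypothesis TS : tessellation S s.
Hypothesis cusp : S (u_ 1).

Lemma S_uint (j : int) : S (u_ j%:~R).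
Proof.
have nat (k : nat) : S (u_ k%:R).
  elim: k => [|k IH]; first by rewrite u_zero; exact: (tes1 TS).
  by rewrite -addn1 natrD -u_mul; exact: (tesM TS).
case: j => k; first exact: nat.
by rewrite NegzE mulrNz -u_inv; apply: (tesV TS); exact: nat.
Qed.

Variables (ns : seq form4) (e : R).
Hypothesis nsu : uniq ns.
Hypothesis nsP : forall n, n \in ns <-> cusp_point s n.
Hypothesis e0 : 0 < e.
Hypothesis good : good_eps s ns e.
Variables (T0 : R).
Hypothesis T00 : 0 < T0.
Hypothesis thinP : forall g K, S g -> fpos K -> tile s (gm g K) ->
  T0 ^+ 2 * fd K ^+ 2 <= fdet K -> exists2 n, cusp_point s n & near_dir e n (gm g K).
Variables (en : nat -> PSL2 R) (cd : PSL2 R -> nat).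
Hypothesis enS : forall k, S (en k).
Hypothesis cdK : forall g, S g -> en (cd g) = g.

(** The default value matters for indices beyond the size of ns only, which never label a
    nonempty piece. *)
Definition label (k : nat) : hform R := nth (inf_pt R) ns k.

Lemma label_null k : fnull (label k).
Proof.
rewrite /label; have [ks|ks] := ltnP k (size ns).
  by have [] := (nsP (nth (inf_pt R) ns k)).1 (mem_nth _ ks).
by rewrite nth_default //; exact: npt_null.
Qed.

Definition label_flow (k : nat) : hform R -> hform R := projT1 (cid (flow_bij (label_null k))).
Definition label_flow_inv (k : nat) : hform R -> hform R :=
  projT1 (cid (projT2 (cid (flow_bij (label_null k))))).
Arguments label_flow : simpl never.
Arguments label_flow_inv : simpl never.

Lemma label_flowP k : [/\ volscale 4 (label_flow k), volscale 4^-1 (label_flow_inv k),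
  cancel (label_flow k) (label_flow_inv k), cancel (label_flow_inv k) (label_flow k) &
  forall H, fpos H -> label_flow k H = flow (label k) H].
Proof. exact: projT2 (cid (projT2 (cid (flow_bij (label_null k))))). Qed.

(** A piece is indexed by the tile, its label, and the integral translation that will bring
    its image back to the box; the condition on the code makes the index of the tile unique. *)
Definition piece (i : nat * nat * int) : set (hform R) :=
  let: (a, k, j) := i in
  [set K | [/\ fpos K, box K, cd (en a) = a /\ (k < size ns)%N,
    tile0 s (gm (en a) K) & near_dir e (label k) (gm (en a) K)]].
Definition piece_map (i : nat * nat * int) : hform R -> hform R :=
  let: (a, k, j) := i in
  gm (u_ (- j%:~R)) \o (gm (en a)^-1%g \o (label_flow k \o gm (en a))).
Definition piece_inv (i : nat * nat * int) : hform R -> hform R :=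
  let: (a, k, j) := i in
  gm (en a)^-1%g \o (label_flow_inv k \o (gm (en a) \o gm (u_ j%:~R))).

Lemma gm_uK (r : R) K : gm (u_ r) (gm (u_ (- r)) K) = K.
Proof. by rewrite -gmM u_mul subrr u_zero gm1. Qed.
Lemma gm_uVK (r : R) K : gm (u_ (- r)) (gm (u_ r) K) = K.
Proof. by rewrite -gmM u_mul addNr u_zero gm1. Qed.

Lemma piece_mapK i : cancel (piece_map i) (piece_inv i).
Proof.
case: i => [[a k] j] K; have [_ _ c1 c2 _] := label_flowP k.
by rewrite /piece_map /piece_inv /= gm_uK gmVK c1 gmK.
Qed.
Lemma piece_invK i : cancel (piece_inv i) (piece_map i).
Proof.
case: i => [[a k] j] K; have [_ _ c1 c2 _] := label_flowP k.
by rewrite /piece_map /piece_inv /= gmVK c2 gmK gm_uVK.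
Qed.

Lemma volscale_piece_map i : volscale 4 (piece_map i).
Proof.
case: i => [[a k] j]; have [v _ _ _ _] := label_flowP k.
have h := volscale_comp v (volpres_gm (en a)); rewrite mul1r in h.
have h2 := volscale_comp (volpres_gm (en a)^-1%g) h; rewrite mulr1 in h2.
have h3 := volscale_comp (volpres_gm (u_ (- j%:~R))) h2; rewrite mulr1 in h3.
exact: h3.
Qed.

Lemma measurable_piece_inv i : measurable_fun [set: mform] (piece_inv i : mform -> mform).
Proof.
case: i => [[a k] j]; have [_ [v _] _ _ _] := label_flowP k.
have h1 := measurableT_comp (volpres_gm (en a)).1 (volpres_gm (u_ j%:~R)).1.
exact: (measurableT_comp (volpres_gm (en a)^-1%g).1 (measurableT_comp v h1)).
Qed.

Lemma measurable_piece i : measurable (piece i : set mform).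
Proof.
case: i => [[a k] j] /=.
have [v|nv] := pselect (cd (en a) = a /\ (k < size ns)%N); last first.
  rewrite (_ : mkset _ = set0); first exact: measurable0.
  by apply/seteqP; split=> K // [].
rewrite (_ : mkset _ = [set K : mform | fpos K] `&` box `&`
  ([set K : mform | tile0 s (gm (en a) K)] `&`
   [set K : mform | near_dir e (label k) (gm (en a) K)])); last first.
  by apply/seteqP; split=> K /=; [move=> []|move=> [[? ?] [? ?]]].
apply: measurableI.
  by apply: measurableI; [exact: measurable_fpos|exact: measurable_box].
apply: measurableI; first exact: (mset_gm (en a) (measurable_tile0 s)).
exact: (mset_gm (en a) (measurable_near_dir e (label k))).
Qed.

Lemma pieceP (a k : nat) (j : int) K : piece (a, k, j) K ->
  let H := flow (label k) (gm (en a) K) in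
  [/\ tile0 s H, near_dir (5 * e) (label k) H & gm (en a) (gm (u_ j%:~R) (piece_map (a, k, j) K)) = H].
Proof.
move=> [pK bK [_ ks] tK nK] /=.
have lin : label k \in ns by exact: mem_nth.
have cl := (nsP _).1 lin; have [l0 t1 _ _] := cl.
have [_ _ _ _ fE] := label_flowP k.
split; first exact: (flow_tile0 good e0 lin cl tK nK).
  by apply: near_flow => //; exact: gm_pos.
by rewrite gm_uK gmVK fE //; exact: gm_pos.
Qed.

(** Two points with the same image have images under the flow in interiors of tiles which
    differ by an element of the group, so the tiles and the flowed points agree up to an
    integral translation. The labels agree because both are close to the flowed point, and
    the translation is trivial because both points lie in the box. *)
Lemma piece_inj i i' K K' : piece i K -> piece i' K' -> piece_map i K = piece_map i' K' -> i = i'.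
Proof.
case: i => [[a k] j]; case: i' => [[a' k'] j'] P P' E.
have [t1 n1 E1] := pieceP P; have [t2 n2 E2] := pieceP P'.
set L := piece_map (a, k, j) K in E E1; rewrite -E in E2.
set H1 := flow _ _ in t1 n1 E1; set H2 := flow _ _ in t2 n2 E2.
pose b := (en a' * u_ (j' - j)%:~R * (en a)^-1)%g.
have Sb : S b by apply: (tesM TS); [apply: (tesM TS) => //; exact: S_uint|exact: (tesV TS)].
have bH : gm b H1 = H2.
  have uu : gm (u_ (j' - j)%:~R) (gm (u_ j%:~R) L) = gm (u_ j'%:~R) L.
    by rewrite -gmM u_mul -intrD subrK.
  by rewrite -E1 -E2 /b !gmM gmK uu.
have b1 : b = 1%g by apply: (tes_disj TS Sb t1); rewrite bH.
have H12 : H1 = H2 by rewrite -bH b1 gm1.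
have [pK bK [ca ks] tK nK] := P; have [pK' bK' [ca' ks'] tK' nK'] := P'.
have l1 : label k \in ns by exact: mem_nth.
have l2 : label k' \in ns by exact: mem_nth.
have kk : label k = label k'.
  apply: contrapT => ne; apply: (good.2 _ _ l1 l2 ne).
  have pt : 0 < ftr H1.
    by have := fpos_fa t1.1; case: t1.1 => d0 _; rewrite /ftr; lra.
  have tri (u v w : R) : `|u - ftr H1 * v| < 5 * e * ftr H1 ->
      `|u - ftr H1 * w| < 5 * e * ftr H1 -> `|v - w| < 10 * e.
    move=> h1 h2; rewrite -(ltr_pM2l pt) -[X in X * `|_|](gtr0_norm pt) -normrM.
    have -> : ftr H1 * (v - w) = (u - ftr H1 * w) - (u - ftr H1 * v) by ring.
    apply: le_lt_trans (ler_normB _ _) _; lra.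
  rewrite -H12 in n2; have [a1 a2 a3 a4] := n1; have [b1' b2 b3 b4] := n2.
  by split; [exact: tri a1 b1'|exact: tri a2 b2|exact: tri a3 b3|exact: tri a4 b4].
have ek : k = k' by apply/eqP; rewrite -(nth_uniq (inf_pt R) ks ks' nsu) -/(label k) kk.
have gK : gm (en a) K = gm (en a') K'.
  have [_ _ c1 _ fE] := label_flowP k.
  apply: (can_inj c1); rewrite !fE; try exact: gm_pos.
  by have := H12; rewrite /H1 /H2 -kk.
have ea : en a' = (en a * u_ (j - j')%:~R)%g.
  have : (b * (en a * u_ (j - j')%:~R))%g = en a'.
    rewrite /b -!mulgA (mulgA (en a)^-1%g) mulVg mul1g u_mul.
    by rewrite (_ : _ + _ = 0) ?u_zero ?mulg1 // -intrD addrA subrK subrr.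
  by rewrite b1 mul1g => <-.
have KK : K = gm (u_ (j - j')%:~R) K'.
  by rewrite -(gmK (en a) K) gK ea gmM gmK.
have jj : j = j'.
  have := bK; rewrite /box /= KK gm_u [fx (mkf _ _ _ _)]/fx [fd (mkf _ _ _ _)]/fd /=.
  have := bK'; rewrite /box /=; have [d0 _] := pK'.
  move: (fx K') (fd K') d0 => x d d0 /andP[x0 xd] /andP[y0 yd].
  have h1 : (j - j')%:~R * d < 1 * d by lra.
  have h2 : (-1) * d < (j - j')%:~R * d by lra.
  rewrite ltr_pM2r // in h1; rewrite ltr_pM2r // in h2.
  have h3 : (j - j' < 1) by rewrite -(ltr_int R).
  have h4 : (-1 < j - j') by rewrite -(ltr_int R).
  by move: h3 h4; clear; lia.
have eaa : en a = en a' by rewrite ea jj subrr u_zero mulg1.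
by rewrite -ca -ca' eaa ek jj.
Qed.

Lemma flow_lands g K n : S g -> fpos K -> box K -> n \in ns ->
  tile0 s (gm g K) -> near_dir e n (gm g K) ->
  exists i, [/\ piece i K, fpos (piece_map i K), box (piece_map i K), fdet (piece_map i K) = fdet K / 4 &
    fd (piece_map i K) = fd (flow (gm g^-1%g n) K) /\ fy (piece_map i K) = fy (flow (gm g^-1%g n) K)].
Proof.
move=> Sg pK bK nn tK nK; pose k := index n ns.
have lk : label k = n by rewrite /label nth_index.
have ks : (k < size ns)%N by rewrite index_mem.
pose L := flow (gm g^-1%g n) K.
have eL : gm g^-1%g (flow n (gm g K)) = L by rewrite gm_flow gmK.
have n0 : fnull n by rewrite -lk; exact: label_null.
have pL : fpos L by rewrite -eL; apply: gm_pos; apply: fpos_flow => //; exact: gm_pos.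
have dL : fdet L = fdet K / 4.
  by rewrite -eL gm_det det_flow ?gm_det //; exact: gm_pos.
pose j := Num.floor (fx L / fd L).
exists (cd g, k, j).
have eg : en (cd g) = g by exact: cdK.
have [_ _ _ _ fE] := label_flowP k.
have pE : piece_map (cd g, k, j) K = gm (u_ (- j%:~R)) L.
  by rewrite /piece_map /= eg fE ?lk ?eL //; exact: gm_pos.
split.
- by split=> //; rewrite ?eg ?lk.
- by rewrite pE; exact: gm_pos.
- rewrite pE gm_u /box /= [fx (mkf _ _ _ _)]/fx [fd (mkf _ _ _ _)]/fd /=.
  have [d0 _] := pL.
  have /andP[h1 h2] := mem_rg1_floor (fx L / fd L).
  rewrite -/j in h1 h2.
  move: h1 h2; rewrite ler_pdivlMr // ltr_pdivrMr // mulrDl mul1r => h1 h2.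
  by apply/andP; split; lra.
- by rewrite pE gm_det.
- by rewrite pE gm_u.
Qed.

(** The preimage of A under the piecewise flow. *)
Definition reached (A : set (hform R)) : set (hform R) :=
  \bigcup_i (piece i `&` piece_map i @^-1` A).

Lemma measurable_reached A : measurable (A : set mform) -> measurable (reached A : set mform).
Proof.
move=> mA; apply: countable_bigcupT_measurable => [|i]; first exact: countableP.
apply: measurableI; first exact: measurable_piece.
by rewrite -[X in measurable X]setTI; apply: (volscale_piece_map i).1.
Qed.

(** The first map raises M = T d + E |y| by at most the term in E p, where p^2 = q, and it
    lowers it by the proportion 3 q / 4. If M crosses the threshold D / 2 upwards, then
    q < 2 E p, so that p < 2 E and M was within O(E^2) of the threshold. *)
Lemma loss_ineq (M D q p E x : R) : 0 < D -> D <= 1 -> 0 < E -> 3 * E ^+ 2 <= 1 ->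
  0 <= p -> p ^+ 2 = q -> q <= 1 -> 0 <= M -> M <= D / 2 ->
  D / 2 < x -> x <= (1 - 3 / 4 * q) * M + E * (3 / 4 * D * p) ->
  4 * M ^+ 2 <= D ^+ 2 <= 4 * M ^+ 2 + 6 * E ^+ 2.
Proof.
move=> D0 D1 E0 E1 p0 pq q1 M0 MD Dx xM.
have h1 : (1 - 3 / 4 * q) * M <= (1 - 3 / 4 * q) * (D / 2).
  by apply: ler_wpM2l => //; lra.
have h2 : q * D < 2 * E * p * D by nra.
have {h2} h2 : q < 2 * E * p by rewrite ltr_pM2r in h2.
have pE : p < 2 * E.
  by rewrite ltNge; apply/negP => le; have := ler_wpM2r p0 le; rewrite -expr2 pq; lra.
have h3 : D / 2 < M + (3 / 2) * E ^+ 2 * D.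
  have q0 : 0 <= q by rewrite -pq sqr_ge0.
  have h0 : 0 <= q * M by rewrite mulr_ge0.
  have hd : 0 <= E * D by rewrite mulr_ge0 // ltW.
  have h : E * D * p <= E * D * (2 * E) by apply: ler_wpM2l => //; exact: ltW.
  have e1 : (1 - 3 / 4 * q) * M = M - 3 / 4 * (q * M) by ring.
  have e2 : E * (3 / 4 * D * p) = 3 / 4 * (E * D * p) by ring.
  have e3 : E * D * (2 * E) = 2 * (E ^+ 2 * D) by ring.
  have e4 : 3 / 2 * E ^+ 2 * D = 3 / 2 * (E ^+ 2 * D) by ring.
  rewrite e1 e2 in xM; rewrite e3 in h; rewrite e4; lra.
have h4 : D * (1 - 3 * E ^+ 2) <= 2 * M by lra.
have h5 : 0 <= D * (1 - 3 * E ^+ 2) by rewrite mulr_ge0 ?subr_ge0 // ltW.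
have h6 : (D * (1 - 3 * E ^+ 2)) ^+ 2 <= (2 * M) ^+ 2.
  by rewrite lerXn2r // nnegrE // mulr_ge0.
have h7 : (2 * M) ^+ 2 <= D ^+ 2 by rewrite lerXn2r ?nnegrE //; lra.
have D2 : D ^+ 2 <= 1 by rewrite expr_le1 // ltW.
have h8 : D ^+ 2 * (1 - 6 * E ^+ 2) <= (D * (1 - 3 * E ^+ 2)) ^+ 2.
  have -> : (D * (1 - 3 * E ^+ 2)) ^+ 2 = D ^+ 2 * (1 - 6 * E ^+ 2) + 9 * (D * E ^+ 2) ^+ 2 by ring.
  by rewrite lerDl mulr_ge0 // sqr_ge0.
have h9 : D ^+ 2 * E ^+ 2 <= E ^+ 2 by rewrite ler_piMl // sqr_ge0.
by apply/andP; split; lra.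
Qed.

Lemma drift_sum (T E : R) m K : 0 < T -> 0 < E -> fpos K -> fnull m ->
  exists q p : R, [/\ 0 <= p, p ^+ 2 = q, q <= 1, q = fdet K * fd m / (bip K m * fd K) &
   T * fd (flow m K) + E * `|fy (flow m K)| <=
   (1 - 3 / 4 * q) * (T * fd K + E * `|fy K|) + E * (3 / 4 * Num.sqrt (fdet K) * p)].
Proof.
move=> T0' E0 pK m0; have [q [p [p0 pq [q1 qE] dE yE]]] := flow_drift pK m0.
exists q, p; split=> //; rewrite dE.
have := ler_wpM2l (ltW E0) yE; lra.
Qed.

Lemma fdet_flow0 K : fd K != 0 -> fdet (flow0 K) = fdet K / 4.
Proof.
move=> d0; rewrite /flow0 /fdet [fd (mkf _ _ _ _)]/fd [fy (mkf _ _ _ _)]/fy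
  [fx (mkf _ _ _ _)]/fx [fa (mkf _ _ _ _)]/fa /=.
by rewrite -/(fd K) -/(fx K) -/(fy K); field.
Qed.

Lemma sqrt4 (x : R) : 0 <= x -> Num.sqrt (x / 4) = Num.sqrt x / 2.
Proof.
move=> x0; have -> : x / 4 = (Num.sqrt x / 2) ^+ 2 by rewrite exprMn sqr_sqrtr //; field.
by rewrite sqrtr_sqr ger0_norm // divr_ge0 // sqrtr_ge0.
Qed.

Lemma roof_flow0 (T E : R) K : 0 < T -> 0 < E -> roof (1 / 4) T E (flow0 K) ->
  [/\ fpos K, box K, fdet K <= 1 & T * fd K + E * `|fy K| <= Num.sqrt (fdet K) / 2].
Proof.
move=> T0' E0 [[d0 D0] bK D1 le].
have d0' : 0 < fd K by [].
rewrite fdet_flow0 ?gt_eqF // in D0 D1 le.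
have D0' : 0 < fdet K by lra.
split=> //; first by lra.
by move: le; rewrite sqrt4 // ltW.
Qed.

(** A high point in the vertical preimage of the roof has a label, and if the piecewise flow
    does not take it to the roof then [loss_ineq] applies. *)
Lemma loss_layer (Z : set mform) (T E : R) :
  (forall K, fpos K -> ~ Z K -> exists2 g, S g & tile0 s (gm g K)) ->
  T0 <= T -> 0 < E -> 3 * E ^+ 2 <= 1 ->
  (@flow0 R @^-1` roof (1 / 4) T E) `\` reached (roof (1 / 4) T E) `<=` Z `|` layer T E.
Proof.
move=> cov TT E0 E1 K [YK nX].
have T0' : 0 < T by exact: lt_le_trans TT.
have [pK bK D1 le] := roof_flow0 T0' E0 YK.
have [d0 D0] := pK; have y0 := normr_ge0 (fy K).
have [ZK|nZ] := pselect (Z K); [by left|right].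
have [g Sg tK] := cov K pK nZ.
set D := Num.sqrt (fdet K) in le.
have D0' : 0 < D by rewrite sqrtr_gt0.
have D2 : D ^+ 2 = fdet K by rewrite sqr_sqrtr // ltW.
have Ey : 0 <= E * `|fy K| by rewrite mulr_ge0 // ltW.
have Td : 0 <= T * fd K by rewrite mulr_ge0 // ltW.
have high : T0 ^+ 2 * fd K ^+ 2 <= fdet K.
  rewrite -exprMn -D2 lerXn2r // ?nnegrE ?ltW //; last first.
    have : T0 * fd K <= T * fd K by rewrite ler_pM2r.
    lra.
  by rewrite mulr_gt0.
have tK' : tile s (gm g K) by case: tK => p q; split=> // h hs; apply: ltW; exact: q.
have [n cn nK] := thinP Sg pK tK' high.
have nn : n \in ns by exact/nsP.
have [i [Pi pi bi di [ei fi]]] := flow_lands Sg pK bK nn tK nK.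
have n0 : fnull (gm g^-1%g n).
  have [n0 _ _ _] := cn; have [c c0 [xi ->]] := null_npt n0.
  rewrite gm_scale; have [c' c'0 ->] := gm_npt g^-1%g xi.
  apply: (null_fscale c0); apply: (null_fscale c'0); exact: npt_null.
have [q [p [p0 pq q1 qE sum]]] := drift_sum T0' E0 pK n0.
split=> //; first by rewrite D0.
rewrite -D2; apply: (loss_ineq D0' _ E0 E1 p0 pq q1 _ le _ sum).
- by rewrite -sqrtr1; apply: ler_wsqrtr.
- by lra.
rewrite ltNge; apply/negP => le2; apply: nX; exists i => //; split=> //.
split=> //; first by rewrite di; lra.
by rewrite di ei fi (sqrt4 (ltW D0)).
Qed.

(** With X and Y the preimages of the roof under the two flows, vol X <= vol Y < oo, hence
    vol (X \ Y) <= vol (Y \ X). *)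
Lemma vol_gain (Z G : set mform) (T E : R) :
  measurable Z -> vol R Z = 0%E ->
  (forall K, fpos K -> ~ Z K -> exists2 g, S g & tile0 s (gm g K)) ->
  T0 <= T -> 0 < E -> 3 * E ^+ 2 <= 1 ->
  measurable G -> G `<=` reached (roof (1 / 4) T E) `\` (@flow0 R @^-1` roof (1 / 4) T E) ->
  (vol R G <= (12 * E / T)%:E)%E.
Proof.
move=> mZ vZ cov TT E0 E1 mG sub.
have T0' : 0 < T by exact: lt_le_trans TT.
pose A : set mform := roof (1 / 4) T E.
have mA : measurable A by exact: measurable_roof.
pose X : set mform := reached A; pose Y : set mform := @flow0 R @^-1` A.
have mX : measurable X by exact: measurable_reached.
have mY : measurable Y.
  by rewrite -[X in measurable X]setTI; apply: (volscale_flow0 R).1.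
have vX : (vol R X <= 4%:E * vol R A)%E.
  apply: (@vol_pieces R (nat * nat * int)%type piece piece_map piece_inv) => //.
  - exact: measurable_piece.
  - exact: volscale_piece_map.
  - exact: measurable_piece_inv.
  - exact: piece_mapK.
  - exact: piece_invK.
  - exact: piece_inj.
have vY : vol R Y = (4%:E * vol R A)%E by exact: (volscale_flow0 R).2.
have fA : (vol R A < +oo)%E by apply: vol_roof => //; lra.
have fY : (vol R Y < +oo)%E by rewrite vY lte_mul_pinfty.
have vXY : vol R Y = (vol R (X `&` Y) + vol R (Y `\` X))%E.
  by rewrite setIC addeC; apply: measureDI.
have fXY : vol R (X `&` Y) \is a fin_num.
  rewrite ge0_fin_numE //; apply: le_lt_trans fY; apply: le_measure; rewrite ?inE //.
  exact: measurableI.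
have vG : (vol R (X `&` Y) + vol R G <= vol R (X `&` Y) + vol R (Y `\` X))%E.
  rewrite -vXY vY; apply: le_trans vX.
  rewrite -measureU //; last 2 first.
  - exact: measurableI.
  - by apply/seteqP; split=> // K [[_ YK] /sub [_]].
  apply: le_measure; rewrite ?inE //; first by apply: measurableU => //; exact: measurableI.
  by move=> K [[]|/sub []].
rewrite leeD2lE // in vG; apply: (le_trans vG).
apply: (@le_trans _ _ (vol R (Z `|` layer T E))).
  apply: le_measure; rewrite ?inE; first exact: measurableD.
    by apply: measurableU => //; exact: measurable_layer.
  exact: loss_layer.
apply: (@le_trans _ _ (vol R Z + vol R (layer T E))%E).
  by apply: measureU2 => //; exact: measurable_layer.
by rewrite vZ add0e; exact: vol_layer.
Qed.

Lemma null_gm g n : fnull n -> fnull (gm g n).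
Proof.
move=> n0; have [c c0 [xi ->]] := null_npt n0.
rewrite gm_scale; have [c' c'0 ->] := gm_npt g xi.
by apply: (null_fscale c0); apply: (null_fscale c'0); exact: npt_null.
Qed.

(** Open conditions under which K lies outside of the vertical preimage of the roof, while the
    piecewise flow takes it to the roof, whatever the tilt in ]0, E]. *)
Definition gained g n (T E q : R) : set (hform R) :=
  let m := gm g^-1%g n in
  [set K | [/\ fpos K /\ 0 < fx K < fd K, fdet K < 1 /\ Num.sqrt (fdet K) / 2 < T * fd K,
    tile0 s (gm g K) /\ near_dir e n (gm g K), q * bip K m * fd K < fdet K * fd m &
    (1 - 3 / 4 * q) * (T * fd K + E * `|fy K|) + E * (3 / 4 * Num.sqrt (fdet K)) <
      Num.sqrt (fdet K) / 2]].

Lemma near_gained g n T E q K : gained g n T E q K ->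
  \forall L \near (K : form4), gained g n T E q L.
Proof.
set m := gm g^-1%g n.
move=> [[pK /andP[x0 xd]] [D1 DT] [tK nK] qK lK].
have cs := @cont_sqdet R; have cy := @cont_absy R; have cD := @cont_fdet R.
have n1 := near_fpos pK.
have n2 := cvgr_gt _ (@cont_fx R K) _ x0.
have c3 : continuous (fun L : form4 => fd L - fx L) by mcont.
have n3 : \forall L \near (K : form4), 0 < fd L - fx L.
  by apply: (cvgr_gt _ (c3 K)); rewrite subr_gt0.
have n4 := cvgr_lt _ (cD K) _ D1.
have c5 : continuous (fun L : form4 => T * fd L - Num.sqrt (fdet L) / 2).
  by apply: contD; [mcont|apply: contN; apply: contM => //; exact: contC].
have n5 : \forall L \near (K : form4), 0 < T * fd L - Num.sqrt (fdet L) / 2.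
  by apply: (cvgr_gt _ (c5 K)); rewrite subr_gt0.
have n6 := near_gm (near_tile0 tK); have n7 := near_gm (near_near_dir nK).
have c8 : continuous (fun L : form4 => fdet L * fd m - q * bip L m * fd L).
  by rewrite /bip; mcont.
have n8 : \forall L \near (K : form4), 0 < fdet L * fd m - q * bip L m * fd L.
  by apply: (cvgr_gt _ (c8 K)); rewrite subr_gt0.
have c9 : continuous (fun L : form4 => Num.sqrt (fdet L) / 2 -
   ((1 - 3 / 4 * q) * (T * fd L + E * `|fy L|) + E * (3 / 4 * Num.sqrt (fdet L)))).
  apply: contD; first by apply: contM => //; exact: contC.
  apply: contN; apply: contD.
    apply: contM; first exact: contC.
    by apply: contD; [mcont|apply: contM => //; exact: contC].
  apply: contM; first exact: contC.
  by apply: contM => //; exact: contC.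
have n9 : \forall L \near (K : form4), 0 < Num.sqrt (fdet L) / 2 -
   ((1 - 3 / 4 * q) * (T * fd L + E * `|fy L|) + E * (3 / 4 * Num.sqrt (fdet L))).
  by apply: (cvgr_gt _ (c9 K)); rewrite subr_gt0.
near=> L.
have m3 : 0 < fd L - fx L by near: L; exact: n3.
have m5 : 0 < T * fd L - Num.sqrt (fdet L) / 2 by near: L; exact: n5.
have m8 : 0 < fdet L * fd m - q * bip L m * fd L by near: L; exact: n8.
have m9 : 0 < Num.sqrt (fdet L) / 2 -
   ((1 - 3 / 4 * q) * (T * fd L + E * `|fy L|) + E * (3 / 4 * Num.sqrt (fdet L))).
  by near: L; exact: n9.
split.
- split; first by near: L; exact: n1.
  by rewrite -(subr_gt0 (fx L)) m3 andbT; near: L; exact: n2.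
- by rewrite -subr_gt0; split=> //; near: L; exact: n4.
- by split; near: L; [exact: n6|exact: n7].
- by rewrite -subr_gt0.
- by rewrite -subr_gt0.
Unshelve. all: by end_near. Qed.

(** T is chosen so that T d(K) is slightly above the threshold sqrt(det K) / 2 and falls below it once d is
    multiplied by 1 - 3 q / 4; q is half of the quantity of [flow_drift], to leave room for
    perturbation, and E is small compared with the remaining slack sl. *)
Lemma gained_start g n K : let m := gm g^-1%g n in let D := Num.sqrt (fdet K) in
  fpos K -> 0 < fx K < fd K -> fdet K < 1 -> tile0 s (gm g K) -> fnull n ->
  near_dir e n (gm g K) -> T0 * fd K <= D / 2 -> 0 < fd m ->
  exists T E q, [/\ T0 <= T, 0 < E, 3 * E ^+ 2 <= 1, 0 <= q <= 1 & gained g n T E q K].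
Proof.
move=> m D pK xK D1 tK n0 nK TD dm.
have m0 : fnull m by exact: null_gm.
have [d0 D0] := pK; have bp := bip_null pK m0.
have D0' : 0 < D by rewrite sqrtr_gt0.
have [q1 [p [p0 pq [q1le q1E] _ _]]] := flow_drift pK m0.
have q10 : 0 < q1 by rewrite q1E divr_gt0 // mulr_gt0.
pose q := q1 / 2; pose T := D / (2 * fd K) * (1 + 3 / 8 * q).
have qp : 0 < q by rewrite /q; lra.
have Td : T * fd K = D / 2 * (1 + 3 / 8 * q).
  by rewrite /T; field; rewrite gt_eqF.
pose sl := D / 2 - (1 - 3 / 4 * q) * (T * fd K).
have sl0 : 0 < sl.
  have -> : sl = D * q * (3 / 16 + 9 / 64 * q) by rewrite /sl Td; field.
  by rewrite !mulr_gt0 // /q; lra.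
pose Y := `|fy K| + D.
have Y0 : 0 < Y by rewrite /Y; have := normr_ge0 (fy K); lra.
pose E := Num.min (1 / 2) (sl / (2 * Y)).
have E0 : 0 < E by rewrite lt_min divr_gt0 //= divr_gt0 // mulr_gt0.
have E2 : E <= 1 / 2 by rewrite ge_min lexx.
have EY : E * Y <= sl / 2.
  have : E <= sl / (2 * Y) by rewrite ge_min lexx orbT.
  by rewrite ler_pdivlMr ?mulr_gt0 // => h; lra.
exists T, E, q; split=> //.
- rewrite -(ler_pM2r d0) Td; apply: (le_trans TD).
  have : 0 < D * q by rewrite mulr_gt0 // /q; lra.
  lra.
- have : E ^+ 2 <= (1 / 2) ^+ 2 by rewrite lerXn2r // nnegrE; lra.
  lra.
- by rewrite /q; apply/andP; split; lra.
split=> //.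
- split=> //; rewrite Td -/D.
  have : 0 < D * q by rewrite mulr_gt0 // /q; lra.
  lra.
- rewrite -/m (_ : fdet K * fd m = q1 * bip K m * fd K); last first.
    by rewrite q1E; field; rewrite !gt_eqF.
  by rewrite ltr_pM2r // ltr_pM2r // /q; lra.
have h1 : 0 <= q * (E * `|fy K|) by rewrite mulr_ge0 ?(ltW qp) // mulr_ge0 // ltW.
have h2 : 0 < E * D by rewrite mulr_gt0.
rewrite -/D; move: EY sl0; rewrite /sl /Y; lra.
Qed.

(** Otherwise the open set of [gained] forms, which does not depend on the tilt, has volume
    O(tilt). *)
Lemma flux_core g K n : S g -> fpos K -> 0 < fx K < fd K -> fdet K < 1 ->
  tile0 s (gm g K) -> n \in ns -> near_dir e n (gm g K) ->
  T0 * fd K <= Num.sqrt (fdet K) / 2 -> fd (gm g^-1%g n) = 0.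
Proof.
move=> Sg pK xK D1 tK nn nK TD.
have [n0 _ _ _] := (nsP n).1 nn; set m := gm g^-1%g n.
have m0 : fnull m by exact: null_gm.
have [_ dm _ _] := m0; apply/eqP; rewrite eq_le dm andbT leNgt; apply/negP => dm'.
have [T [E0 [q [TT E00 E01 /andP[q0 q1] gK]]]] := gained_start pK xK D1 tK n0 nK TD dm'.
have [G [mG nG sG]] := nbhs_measurable (near_gained gK).
have [Z [mZ vZ cov]] := generic_tile0 TS.
have T0' : 0 < T by exact: lt_le_trans TT.
have bound E : 0 < E -> E <= E0 -> (vol R G <= (12 * E / T)%:E)%E.
  move=> Ep EE.
  have E1 : 3 * E ^+ 2 <= 1.
    have : E ^+ 2 <= E0 ^+ 2 by rewrite lerXn2r // nnegrE ltW.
    lra.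
  apply: (vol_gain mZ vZ cov TT Ep E1 mG).
  move=> L /sG [[pL /andP[x0 xd]] [L1 LT] [tL nL] qL lL]; split; last first.
    move=> /(roof_flow0 T0' Ep) [_ _ _]; have : 0 <= E * `|fy L| by rewrite mulr_ge0 // ltW.
    lra.
  have bL : box L by rewrite /box /= (ltW x0).
  have [i [Pi pi bi di [ei fi]]] := flow_lands Sg pL bL nn tL nL.
  exists i => //; split=> //; split=> //; first by rewrite di; lra.
  have [d0 D0] := pL.
  rewrite di ei fi (sqrt4 (ltW D0)).
  have [r [p [p0 pr r1 rE]]] := drift_sum T0' Ep pL m0.
  have qr : q < r.
    by rewrite rE ltr_pdivlMr ?mulr_gt0 ?(bip_null pL m0) // mulrA.
  move=> /le_trans; apply; apply: ltW; apply: le_lt_trans lL.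
  have p1 : p <= 1.
    by rewrite -(@ler_pXn2r _ 2) ?nnegrE // expr1n pr.
  have sD : 0 <= Num.sqrt (fdet L) by exact: sqrtr_ge0.
  have y0 := normr_ge0 (fy L).
  apply: lerD.
    apply: ler_pM; [by lra| |by lra|].
      by rewrite addr_ge0 // mulr_ge0 // ltW.
    by rewrite lerD2l ler_wpM2r.
  apply: ler_pM => //; first exact: ltW.
    by rewrite !mulr_ge0.
  by rewrite ler_piMr // mulr_ge0.
have vG : (0 < vol R G)%E by exact: vol_nbhs_gt0 nG.
have fG : vol R G \is a fin_num.
  by rewrite ge0_fin_numE //; apply: (le_lt_trans (bound E0 E00 (lexx _))); rewrite ltry.
have v0 : 0 < fine (vol R G) by rewrite fine_gt0 // vG ltey_eq fG.
set v := fine (vol R G) in v0.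
pose E := Num.min E0 (v * T / 24).
have Ep : 0 < E by rewrite lt_min E00 /= divr_gt0 // mulr_gt0.
have EE : E <= E0 by rewrite ge_min lexx.
have := bound E Ep EE; rewrite -(fineK fG) -/v lee_fin ler_pdivlMr // => h.
have : E <= v * T / 24 by rewrite ge_min lexx orbT.
have : 0 < v * T by rewrite mulr_gt0.
lra.
Qed.
End Flux.

(** * Tiles high above the cusp end at the cusp *)

Section CuspTiles.
Variable R : realType.
Notation form4 := (R * R * R * R)%type.
Implicit Types (K L H n m : hform R) (g h : PSL2 R).

Lemma fdet_scale c K : fdet (fscale c K) = c ^+ 2 * fdet K.
Proof. by rewrite /fdet !fscaleE; ring. Qed.

Lemma tile0_scale s c K : 0 < c -> tile0 s K -> tile0 s (fscale c K).
Proof.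
move=> c0 [pK sK]; split; first exact/fscaleK_pos.
by move=> h hs; rewrite gm_scale !fscaleE mulr_gt0 // sK.
Qed.

Variables (S : set (PSL2 R)) (s : seq (PSL2 R)).
Hypothesis TS : tessellation S s.
Hypothesis cusp : S (u_ 1).

(** A nearby form with x / d not an integer, moved to the interior of the box. *)
Lemma near_nonint K (P : set form4) : 0 < fd K -> (\forall L \near (K : form4), P L) ->
  exists L (j : int), P L /\ 0 < fx L - j%:~R * fd L < fd L.
Proof.
move=> d0 nP; pose j := Num.floor (fx K / fd K).
have /andP[h1 h2] := mem_rg1_floor (fx K / fd K).
rewrite -/j in h1 h2; move: h1 h2; rewrite ler_pdivlMr // ltr_pdivrMr // mulrDl mul1r => h1 h2.
have [h|h] := ltP (j%:~R * fd K) (fx K).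
  exists K, j; split; first exact: (nbhs_singleton nP).
  by apply/andP; split; lra.
have E : fx K = j%:~R * fd K by lra.
have [r /= r0 sub] := (nbhs_ballP _ _).1 nP.
pose dl := Num.min (r / 2) (fd K / 2).
have l0 : 0 < dl by rewrite lt_min !divr_gt0.
have l1 : dl <= r / 2 by rewrite ge_min lexx.
have l2 : dl <= fd K / 2 by rewrite ge_min lexx orbT.
exists (mkf (fd K) (fy K) (fx K + dl) (fa K)), j; split.
  apply: sub; split; last by rewrite /= /ball /= subrr normr0.
  split; last first.
    by rewrite /= /ball /= opprD addrA subrr sub0r normrN gtr0_norm //; lra.
  by split; rewrite /= /ball /= subrr normr0.
rewrite [fx (mkf _ _ _ _)]/fx [fd (mkf _ _ _ _)]/fd /= E.
by apply/andP; split; lra.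
Qed.

(** [flux_core] needs K to lie in the interior of the box and to have determinant less than
    1; this is arranged by scaling, an arbitrarily small displacement and an integral
    translation, none of which affects the vanishing of d on g^-1 n. *)
Theorem flux : exists2 T, 0 < T & forall g K, S g -> fpos K -> tile0 s (gm g K) ->
  T ^+ 2 * fd K ^+ 2 <= fdet K -> exists2 n, cusp_point s n & fd (gm g^-1%g n) = 0.
Proof.
have [ns [nsu nsP]] := cusp_seq s.
have [e e0 good] := good_eps_ex (fun n nn => (nsP n).1 nn).
have [T0 T00 thinP] := thin TS cusp e0.
have [en [cd [enS cdK]]] := tes_enum TS.
exists (3 * T0); first by rewrite mulr_gt0.
move=> g K Sg pK tK high; have [d0 D0] := pK.
(* Scaling by c brings the determinant below 1. *)
pose c := (1 + fdet K)^-1.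
have c0 : 0 < c by rewrite invr_gt0; lra.
have D1 : fdet (fscale c K) < 1.
  rewrite fdet_scale /c exprVn mulrC ltr_pdivrMr ?exprn_gt0 //; last lra.
  by have := sqr_ge0 (fdet K); lra.
have pcK : fpos (fscale c K) by exact/fscaleK_pos.
have tcK : tile0 s (gm g (fscale c K)) by rewrite gm_scale; exact: tile0_scale.
have hc : 0 < fdet (fscale c K) - 4 * T0 ^+ 2 * fd (fscale c K) ^+ 2.
  rewrite fdet_scale !fscaleE.
  have -> : c ^+ 2 * fdet K - 4 * T0 ^+ 2 * (c * fd K) ^+ 2 =
    c ^+ 2 * (fdet K - 4 * (T0 * fd K) ^+ 2) by ring.
  rewrite mulr_gt0 ?exprn_gt0 //.
  have : 0 < (T0 * fd K) ^+ 2 by rewrite exprn_gt0 // mulr_gt0.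
  rewrite -exprMn in high; lra.
have n1 := near_fpos pcK.
have n2 := cvgr_lt _ (@cont_fdet R (fscale c K)) _ D1.
have n3 := near_gm (near_tile0 tcK).
have c4 : continuous (fun L : form4 => fdet L - 4 * T0 ^+ 2 * fd L ^+ 2).
  by have cD := @cont_fdet R; mcont.
have n4 := cvgr_gt _ (c4 (fscale c K)) _ hc.
have [|L [j [[pL L1 tL hL] /andP[x0 xd]]]] := @near_nonint (fscale c K)
  [set L | [/\ fpos L, fdet L < 1, tile0 s (gm g L) & 0 < fdet L - 4 * T0 ^+ 2 * fd L ^+ 2]] pcK.1.
  near=> L.
  have m1 : fpos L by near: L; exact: n1.
  have m2 : fdet L < 1 by near: L; exact: n2.
  have m3 : tile0 s (gm g L) by near: L; exact: n3.
  have m4 : 0 < fdet L - 4 * T0 ^+ 2 * fd L ^+ 2 by near: L; exact: n4.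
  by [].
pose K2 := gm (u_ (- j%:~R)) L.
have pK2 : fpos K2 by exact: gm_pos.
have dK2 : fd K2 = fd L by rewrite /K2 gm_u.
have DK2 : fdet K2 = fdet L by rewrite /K2 gm_det.
have xK2 : 0 < fx K2 < fd K2.
  rewrite dK2 /K2 gm_u [fx (mkf _ _ _ _)]/fx /=.
  by apply/andP; split; lra.
pose g2 := (g * u_ j%:~R)%g.
have Sg2 : S g2 by apply: (tesM TS) => //; exact: (S_uint TS cusp).
have gK2 : gm g2 K2 = gm g L by rewrite /g2 gmM gm_uK.
have tK2 : tile0 s (gm g2 K2) by rewrite gK2.
have t0 : 0 <= T0 ^+ 2 * fd L ^+ 2 by rewrite mulr_ge0 // sqr_ge0.
have [n cn nK2] : exists2 n, cusp_point s n & near_dir e n (gm g2 K2).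
  apply: thinP => //; last by rewrite dK2 DK2; lra.
  by case: tK2 => p q; split=> // h hs; apply: ltW; exact: q.
exists n => //.
have TD : T0 * fd K2 <= Num.sqrt (fdet K2) / 2.
  have [_ Dp] := pK2; have [dp _] := pK2.
  suff : 2 * T0 * fd K2 <= Num.sqrt (fdet K2) by lra.
  rewrite -(@ler_pXn2r _ 2) ?nnegrE ?sqrtr_ge0 ?mulr_ge0 ?ltW //.
  by rewrite sqr_sqrtr ?ltW // !exprMn dK2 DK2; lra.
have := flux_core TS cusp nsu nsP e0 good T00 thinP enS cdK Sg2 pK2 xK2 _ tK2 ((nsP n).2 cn) nK2 TD.
rewrite DK2 => /(_ L1); rewrite /g2 invgM gmM u_inv gm_u //.
Unshelve. all: by end_near. Qed.
End CuspTiles.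

(** * Vertical lines far from the real axis lie in one tile *)

Section Strip.
Variable R : realType.
Notation gR := (measurableTypeR R).
Notation mform := (gR * gR * gR * gR)%type.
Notation form4 := (R * R * R * R)%type.
Implicit Types (K L H n m : hform R) (g h : PSL2 R).

Lemma near_all (T : eqType) K (l : seq T) (Q : T -> form4 -> Prop) :
  (forall k, k \in l -> \forall L \near (K : form4), Q k L) ->
  \forall L \near (K : form4), forall k, k \in l -> Q k L.
Proof.
move=> H; have [||c _ //] := @seq_near R T form4 (nbhs (K : form4)) _ l (fun _ => Q).
  by [].
by move=> k /H; exists 1.
Qed.

Lemma seq_bound (T : eqType) (l : seq T) (Q : R -> T -> Prop) :
  (forall c c' k, c <= c' -> Q c k -> Q c' k) ->
  (forall k, k \in l -> exists c, Q c k) -> exists c, forall k, k \in l -> Q c k.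
Proof.
move=> mono; elim: l => [|k0 l IH] H; first by exists 0.
have [c Hc] := H k0 (mem_head k0 l).
have [|c' Hc'] := IH; first by move=> k kl; apply: H; rewrite inE kl orbT.
exists (Num.max c c') => k; rewrite inE => /predU1P[->|kl].
  by apply: mono Hc; rewrite le_max lexx.
by apply: mono (Hc' k kl); rewrite le_max lexx orbT.
Qed.

Lemma tile_scale s c K : 0 < c -> tile s (fscale c K) -> tile s K.
Proof.
move=> c0 [/(fscaleK_pos _ c0) pK sK]; split=> // h hs.
by have := sK h hs; rewrite gm_scale !fscaleE pmulr_rge0.
Qed.

Variables (S : set (PSL2 R)) (s : seq (PSL2 R)).
Hypothesis TS : tessellation S s.
Hypothesis cusp : S (u_ 1).
Hypothesis para : forall u (c : R), S u -> 0 < c -> gm u (inf_pt R) = fscale c (inf_pt R) ->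
  exists r, u = u_ r.

Lemma tile_lf (M : R) : finite_set [set g | S g /\ exists2 L, ftr L ^+ 2 <= M * fdet L & tile s (gm g L)].
Proof.
apply: sub_finite_set (finite_image (fun g => g^-1%g) (tes_lf TS M)) => g [Sg [L hL tL]].
exists g^-1%g; last by rewrite invgK.
by split; [exact: (tesV TS)|exists (gm g L); rewrite ?gmK ?gm_det].
Qed.

Definition at_cusp g : Prop := S g /\ exists2 n, cusp_point s n & fd (gm g^-1%g n) = 0.

(** Tiles with a vertex at oo cover almost all high points by [flux], and they are locally
    finite and closed. *)
Lemma cusp_cover : exists2 T : R, 0 < T & forall K, fpos K ->
  T ^+ 2 * fd K ^+ 2 < fdet K -> exists2 g, at_cusp g & tile s (gm g K).
Proof.
have [T T0 fl] := flux TS cusp; exists T => // K pK high.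
apply: contrapT => no; have [d0 D0] := pK.
pose M := ftr K ^+ 2 / fdet K + 1.
have [F FP] := (finite_seqP _).1 (tile_lf M).
have n1 := near_fpos pK.
have cD := @cont_fdet R; have ct := @cont_ftr R.
have c2 : continuous (fun L : form4 => fdet L - T ^+ 2 * fd L ^+ 2) by mcont.
have n2 : \forall L \near (K : form4), 0 < fdet L - T ^+ 2 * fd L ^+ 2.
  by apply: (cvgr_gt _ (c2 K)); rewrite subr_gt0.
have c3 : continuous (fun L : form4 => M * fdet L - ftr L ^+ 2) by mcont.
have n3 : \forall L \near (K : form4), 0 < M * fdet L - ftr L ^+ 2.
  apply: (cvgr_gt _ (c3 K)); rewrite /M mulrDl mul1r divfK ?gt_eqF //; lra.
have n4 : \forall L \near (K : form4), forall g, g \in F -> at_cusp g -> ~ tile s (gm g L).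
  apply: near_all => g gF; have [ag|nag] := pselect (at_cusp g); last by near=> L.
  have pg : fpos (gm g K) by exact: gm_pos.
  have [h hs hK] : exists2 h, h \in s & fx (gm h (gm g K)) < 0.
    apply: contrapT => nh; apply: no; exists g => //; split=> // h hs.
    by rewrite leNgt; apply/negP => lt; apply: nh; exists h.
  have ng := near_gm (cvgr_lt _ (@cont_fxgm R h (gm g K)) _ hK).
  near=> L => _ [_ /(_ h hs)]; apply/negP; rewrite -ltNge.
  by near: L; exact: ng.
have nU : \forall L \near (K : form4), [/\ fpos L, 0 < fdet L - T ^+ 2 * fd L ^+ 2,
    0 < M * fdet L - ftr L ^+ 2 & forall g, g \in F -> at_cusp g -> ~ tile s (gm g L)].
  near=> L.
  have m1 : fpos L by near: L; exact: n1.
  have m2 : 0 < fdet L - T ^+ 2 * fd L ^+ 2 by near: L; exact: n2.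
  have m3 : 0 < M * fdet L - ftr L ^+ 2 by near: L; exact: n3.
  by split=> //; near: L; exact: n4.
have [G [mG nG sG]] := nbhs_measurable nU.
have [Z [mZ vZ cov]] := generic_tile0 TS.
have [L GL nZ] : exists2 L, G L & ~ Z L.
  apply: contrapT => nL; have := vol_nbhs_gt0 mG nG.
  apply/negP; rewrite -leNgt -vZ; apply: le_measure; rewrite ?inE // => L GL.
  by apply: contrapT => nZ; apply: nL; exists L.
have [pL hL ML nt] := sG L GL.
have [g Sg tg] := cov L pL nZ.
have tg' : tile s (gm g L) by case: tg => p q; split=> // h hs; apply: ltW; exact: q.
apply: (nt g) => //.
  suff : [set` F] g by [].
  by rewrite -FP; split=> //; exists L => //; lra.
by split=> //; apply: (fl g L) => //; lra.
Unshelve. all: by end_near. Qed.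

Lemma null_fd0 n : fnull n -> fd n = 0 -> exists2 c, 0 < c & n = fscale c (inf_pt R).
Proof.
move=> n0 d0; have [x0 y0 a0] := null_d n0 d0; exists (fa n) => //.
by apply: hformP; rewrite !fscaleE /inf_pt /npt ?d0 ?x0 ?y0 /fd /fy /fx /fa /= ?mulr0 ?mulr1.
Qed.

(** The boundary is a hemisphere, of bounded radius; a half-space containing oo contains
    everything outside of it. *)
Lemma far_side (A B B' D : R) : 0 < A -> exists C, forall d y x a, 0 < d -> 0 < a * d - x ^+ 2 - y ^+ 2 ->
  C * d <= `|y| -> 0 <= d * D + y * B' + x * B + a * A.
Proof.
move=> A0; pose D' := `|D - B ^+ 2 / (4 * A)|.
have D0 : 0 <= D' by exact: normr_ge0.
pose q := (`|B'| + D') / A; have q0 : 0 <= q by rewrite divr_ge0 ?addr_ge0 // ltW.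
exists (1 + q) => d y x a d0 pos yC.
have qA : q * A = `|B'| + D' by rewrite /q divfK // gt_eqF.
have qd : 0 <= q * d by rewrite mulr_ge0 // ltW.
have y1 : d <= `|y| by lra.
have h1 : A * (1 + q) * d * `|y| <= A * `|y| * `|y|.
  have -> : A * (1 + q) * d * `|y| = (A * `|y|) * ((1 + q) * d) by ring.
  by apply: ler_wpM2l => //; rewrite mulr_ge0 // ltW.
have h2 : D' * d * d <= D' * d * `|y| by apply: ler_wpM2l => //; rewrite mulr_ge0 // ltW.
have h3 : 0 <= A * d * `|y| by rewrite !mulr_ge0 // ltW.
have h4 : - (`|B'| * `|y|) <= B' * y by rewrite -normrM; have := ler_norm (- (B' * y)); rewrite normrN; lra.
have h5 : - D' <= D - B ^+ 2 / (4 * A) by have := ler_norm (- (D - B ^+ 2 / (4 * A))); rewrite normrN /D'; lra.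
have h6 : - D' * d * d <= (D - B ^+ 2 / (4 * A)) * d * d.
  by do 2!(rewrite ler_pM2r //).
have yy : `|y| * `|y| = y ^+ 2 by rewrite -expr2 -normrX ger0_norm // sqr_ge0.
have h7 : - (`|B'| * `|y|) * d <= B' * y * d by rewrite ler_pM2r.
have h8 : A * (x ^+ 2 + y ^+ 2) <= A * (a * d) by rewrite ler_pM2l //; lra.
have h9 : 0 <= A * (x + B * d / (2 * A)) ^+ 2 by rewrite mulr_ge0 ?sqr_ge0 // ltW.
have E : A * (x + B * d / (2 * A)) ^+ 2 = A * x ^+ 2 + B * x * d + B ^+ 2 / (4 * A) * d * d.
  by field; rewrite gt_eqF.
have h10 : A * (1 + q) * d * `|y| = A * d * `|y| + `|B'| * d * `|y| + D' * d * `|y|.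
  by rewrite mulrDr mulr1 [A * q]mulrC qA; ring.
rewrite -(pmulr_rge0 _ d0).
have h11 : A * `|y| * `|y| = A * y ^+ 2 by rewrite -mulrA yy.
rewrite E in h9; rewrite h10 h11 in h1; lra.
Qed.

(** A tile with a vertex at oo is, up to a real translation, one of finitely many, namely the
    one associated with its vertex. Its vertical sides contain, with a point, the vertical
    line through it; the others are handled by [far_side]. *)
Lemma column : exists C : R, forall K, fpos K -> C * fd K < `|fy K| ->
  exists2 g, S g & forall K', fpos K' -> fd K' = fd K -> fy K' = fy K -> fx K' = fx K -> tile s (gm g K').
Proof.
have [T T0 cov] := cusp_cover.
have [ns [_ nsP]] := cusp_seq s.
pose rep (n : form4) : PSL2 R := xget 1%g [set g | S g /\ fd (gm g^-1%g n) = 0].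
pose P (C : R) (i : form4 * PSL2 R) : Prop :=
  0 < fx (gm i.2 (gm (rep i.1) (bas_a R))) -> forall L, fpos L -> C * fd L <= `|fy L| ->
  0 <= fx (gm i.2 (gm (rep i.1) L)).
have [||C CP] := @seq_bound (form4 * PSL2 R)%type (allpairs pair ns s) P.
- move=> c c' i cc Pc A0 L pL yL; apply: Pc => //; apply: le_trans yL.
  by rewrite ler_pM2r //; exact: pL.1.
- move=> i _; have [A0|nA] := pselect (0 < fx (gm i.2 (gm (rep i.1) (bas_a R)))); last by exists 0.
  rewrite -gmM in A0.
  have [C CP] := far_side (fx (gm (i.2 * rep i.1)%g (bas_x R))) (fx (gm (i.2 * rep i.1)%g (bas_y R)))
    (fx (gm (i.2 * rep i.1)%g (bas_d R))) A0.
  exists C => _ L pL yL; have [d0 D0] := pL; rewrite -gmM fx_gm; apply: CP => //.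
exists C => K pK yC; have [d0 D0] := pK.
(* The point above K at a height where the tiles with vertex at oo are known to cover. *)
pose up H := mkf (fd H) (fy H) (fx H) (fa H + (T ^+ 2 + 1) * fd H) : hform R.
have upE : (fd (up K) = fd K) * (fy (up K) = fy K) * (fx (up K) = fx K) by [].
have D1 : fdet (up K) = fdet K + (T ^+ 2 + 1) * fd K ^+ 2.
  have aE : fa (up K) = fa K + (T ^+ 2 + 1) * fd K by [].
  by rewrite /fdet !upE aE; ring.
have d2 : 0 < fd K ^+ 2 by rewrite exprn_gt0.
have hT : 0 <= T ^+ 2 * fd K ^+ 2 by rewrite mulr_ge0 // sqr_ge0.
have pU : fpos (up K) by rewrite /fpos D1 upE; split=> //; lra.
have [|g [Sg [n cn dn]] tg] := cov (up K) pU; first by rewrite D1 upE; lra.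
exists g => // K' pK' dE yE xE.
have [n0 _ npos _] := cn; have nn : n \in ns by exact/nsP.
have [Sh dh] : S (rep n) /\ fd (gm (rep n)^-1%g n) = 0.
  apply: (@xgetPex _ 1%g [set g | S g /\ fd (gm g^-1%g n) = 0]).
  by exists g.
set h := rep n in Sh dh.
have [c c0 cE] := null_fd0 (null_gm g^-1%g n0) dn.
have [c' c'0 cE'] := null_fd0 (null_gm h^-1%g n0) dh.
have [r rE] : exists r, (h^-1 * g)%g = u_ r.
  apply: (@para _ (c' / c)); [by apply: (tesM TS) => //; exact: (tesV TS)|by rewrite divr_gt0|].
  have : gm (h^-1 * g)%g (fscale c (inf_pt R)) = fscale c' (inf_pt R).
    by rewrite -cE gmM gmVK cE'.
  rewrite gm_scale => E; apply: hformP; rewrite !fscaleE.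
  - by have := congr1 (@fd R) E; rewrite !fscaleE => E1; apply: (mulfI (lt0r_neq0 c0)); rewrite E1; field; rewrite gt_eqF.
  - by have := congr1 (@fy R) E; rewrite !fscaleE => E1; apply: (mulfI (lt0r_neq0 c0)); rewrite E1; field; rewrite gt_eqF.
  - by have := congr1 (@fx R) E; rewrite !fscaleE => E1; apply: (mulfI (lt0r_neq0 c0)); rewrite E1; field; rewrite gt_eqF.
  - by have := congr1 (@fa R) E; rewrite !fscaleE => E1; apply: (mulfI (lt0r_neq0 c0)); rewrite E1; field; rewrite gt_eqF.
have gE H : gm g H = gm h (gm (u_ r) H) by rewrite -rE gmM gmVK.
have uE H : (fd (gm (u_ r) H) = fd H) * (fy (gm (u_ r) H) = fy H) *
  (fx (gm (u_ r) H) = fx H + r * fd H) by rewrite gm_u.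
split=> [|k ks]; first exact: gm_pos.
have A0 : 0 <= fx (gm k (gm h (bas_a R))).
  have : 0 <= fx (gm k (gm h (gm h^-1%g n))) by rewrite gmVK; exact: npos.
  by rewrite cE' !gm_scale fscaleE pmulr_rge0.
have := A0; rewrite le_eqVlt => /predU1P[A1|A1]; last first.
  rewrite gE; apply: (CP (n, k)) => //.
  - by apply/allpairsP; exists (n, k).
  - exact: gm_pos.
  - by rewrite !uE dE yE ltW.
have z1 : fx (gm (k * h)%g (bas_a R)) = 0 by rewrite gmM -A1.
have ex H : fx (gm k (gm g H)) = fd H * fx (gm (k * h)%g (bas_d R)) +
    fy H * fx (gm (k * h)%g (bas_y R)) + (fx H + r * fd H) * fx (gm (k * h)%g (bas_x R)).
  by rewrite gE -(gmM k) fx_gm z1 mulr0 addr0; case: (uE H) => [[-> ->] ->].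
have := tg.2 k ks; rewrite (ex K') dE yE xE => le.
by rewrite (ex (up K)) in le.
Qed.
End Strip.

(** * Orbits do not accumulate far from the real axis *)

Section OffStrip.
Variable R : realType.
Notation form4 := (R * R * R * R)%type.
Implicit Types (K L H n m : hform R) (g h : PSL2 R).

Lemma ftr_scale c K : ftr (fscale c K) = c * ftr K.
Proof. by rewrite /ftr !fscaleE mulrDr. Qed.

Variables (S : set (PSL2 R)) (s : seq (PSL2 R)).
Hypothesis TS : tessellation S s.
Hypothesis cusp : S (u_ 1).
Hypothesis para : forall u (c : R), S u -> 0 < c -> gm u (inf_pt R) = fscale c (inf_pt R) ->
  exists r, u = u_ r.

(** Above a neighbourhood of n finitely many tiles occur by [column]: each of them meets the
    bounded set of points raised to a fixed height. Each of them contains finitely many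
    points of the orbit of o, and these stay away from the null form n. *)
Lemma off_strip : exists C : R, forall n o, fnull n -> 0 < fd n -> C * fd n < `|fy n| -> fpos o ->
  \forall L \near (n : form4), forall g c, S g -> 0 < c -> L <> fscale c (gm g o).
Proof.
have [C CP] := column TS cusp para; exists C => n o n0 dn yn po.
have [n00 _ _ tn] := n0; have [od oD] := po.
pose up H := mkf (fd H) (fy H) (fx H) (fa H + fd H) : hform R.
have fup H : fa (up H) = fa H + fd H by [].
have gup H : (fd (up H) = fd H) * (fx (up H) = fx H) * (fy (up H) = fy H) by [].
have Dup H : fdet (up H) = fdet H + fd H ^+ 2.
  by rewrite /fdet fup; case: (gup H) => [[-> ->] ->]; ring.
have tup H : ftr (up H) = ftr H + fd H by rewrite /ftr fup; case: (gup H) => [[-> _] _]; ring.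
pose B := ftr n + 1 + (fd n + 1).
pose M := B ^+ 2 / (fd n / 2) ^+ 2.
have d2 : 0 < (fd n / 2) ^+ 2 by rewrite exprn_gt0 // divr_gt0.
have [F FP] := (finite_seqP _).1 (tile_lf TS M).
have [F2 FP2] := (finite_seqP _).1 (tile_lf TS (ftr o ^+ 2 / fdet o)).
pose Phi := [seq (i.1^-1 * i.2)%g | i <- allpairs pair F F2].
have n1 : \forall L \near (n : form4), fd n / 2 < fd L.
  by apply: (cvgr_gt _ (@cont_fd R n)); lra.
have n2 : \forall L \near (n : form4), fd L < fd n + 1.
  by apply: (cvgr_lt _ (@cont_fd R n)); lra.
have n3 : \forall L \near (n : form4), ftr L < ftr n + 1.
  by apply: (cvgr_lt _ (@cont_ftr R n)); lra.
have c4 : continuous (fun L : form4 => `|fy L| - C * fd L).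
  by apply: contD; [exact: cont_absy|mcont].
have n4 : \forall L \near (n : form4), 0 < `|fy L| - C * fd L.
  by apply: (cvgr_gt _ (c4 n)); lra.
have n5 : \forall L \near (n : form4), forall g, g \in Phi -> fdet L * ftr (gm g o) ^+ 2 < fdet o * ftr L ^+ 2.
  apply: near_all => g _; have ct := @cont_ftr R; have cD := @cont_fdet R.
  have c5 : continuous (fun L : form4 => fdet o * ftr L ^+ 2 - fdet L * ftr (gm g o) ^+ 2) by mcont.
  have n5 : \forall L \near (n : form4), 0 < fdet o * ftr L ^+ 2 - fdet L * ftr (gm g o) ^+ 2.
    by apply: (cvgr_gt _ (c5 n)); rewrite n00 mul0r subr0 mulr_gt0 // exprn_gt0.
  by near=> L; rewrite -subr_gt0; near: L; exact: n5.
near=> L => g c Sg c0 LE.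
have m1 : fd n / 2 < fd L by near: L; exact: n1.
have m2 : fd L < fd n + 1 by near: L; exact: n2.
have m3 : ftr L < ftr n + 1 by near: L; exact: n3.
have m4 : 0 < `|fy L| - C * fd L by near: L; exact: n4.
have m5 : forall g, g \in Phi -> fdet L * ftr (gm g o) ^+ 2 < fdet o * ftr L ^+ 2 by near: L; exact: n5.
have pL : fpos L by rewrite LE; apply/fscaleK_pos => //; exact: gm_pos.
have [h Sh hP] : exists2 h, S h & forall K', fpos K' -> fd K' = fd L -> fy K' = fy L -> fx K' = fx L -> tile s (gm h K').
  by apply: CP => //; lra.
have hF : h \in F.
  suff : [set` F] h by [].
  rewrite -FP; split=> //; exists (up L); last first.
    apply: hP => //; have [dL DL] := pL; split=> //.
    by rewrite Dup; have := sqr_ge0 (fd L); lra.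
  have tL : 0 < ftr L by have := fpos_fa pL; have [dL _] := pL; rewrite /ftr; lra.
  have [dL DL] := pL.
  have h1 : ftr (up L) ^+ 2 <= B ^+ 2.
    by rewrite tup lerXn2r // ?nnegrE /B; lra.
  apply: (le_trans h1); rewrite /M -[X in X <= _]mulr1 -mulrA ler_wpM2l ?sqr_ge0 //.
  rewrite mulrC ler_pdivlMr // mul1r Dup.
  have : (fd n / 2) ^+ 2 <= fd L ^+ 2 by rewrite lerXn2r // ?nnegrE; lra.
  lra.
have hgF : (h * g)%g \in F2.
  suff : [set` F2] (h * g)%g by [].
  rewrite -FP2; split; first exact: (tesM TS).
  exists o; first by rewrite divfK // gt_eqF.
  have := hP L pL erefl erefl erefl; rewrite LE gm_scale gmM.
  exact: tile_scale.
have gPhi : g \in Phi.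
  apply/mapP; exists (h, (h * g)%g); last by rewrite /= mulKg.
  by apply/allpairsP; exists (h, (h * g)%g).
have := m5 g gPhi; rewrite LE fdet_scale gm_det ftr_scale exprMn.
by rewrite [X in X < _](_ : _ = fdet o * (c ^+ 2 * ftr (gm g o) ^+ 2)) ?ltxx //; ring.
Unshelve. all: by end_near. Qed.
End OffStrip.

(** * Topology of the upper half-space and of the space of forms *)

Section CTop.
Variable R : realType.
Notation form4 := (R * R * R * R)%type.
Implicit Types (K L H n m : hform R) (g h : PSL2 R).

Lemma normc_ge_Im (z : R[i]) : `|complex.Im z|%:C <= `|z|.
Proof.
case: z => x y; rewrite normc_def /= lecR -sqrtr_sqr; apply: ler_wsqrtr.
by rewrite lerDr sqr_ge0.
Qed.

Lemma cont_Re : continuous (@complex.Re R : R[i] -> R).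
Proof.
move=> z U /nbhs_ballP[r /= r0 sub]; apply/nbhs_ballP; exists r%:C; first by rewrite /= ltcR.
move=> w; rewrite -ball_normE /= => zw; apply: sub; rewrite -ball_normE /=.
by rewrite -ltcR; apply: le_lt_trans zw; rewrite -raddfB; exact: normc_ge_Re.
Qed.
Lemma cont_Im : continuous (@complex.Im R : R[i] -> R).
Proof.
move=> z U /nbhs_ballP[r /= r0 sub]; apply/nbhs_ballP; exists r%:C; first by rewrite /= ltcR.
move=> w; rewrite -ball_normE /= => zw; apply: sub; rewrite -ball_normE /=.
by rewrite -ltcR; apply: le_lt_trans zw; rewrite -raddfB; exact: normc_ge_Im.
Qed.

Lemma cvg_complex (T : topologicalType) (f g : T -> R) (t : T) :
  {for t, continuous f} -> {for t, continuous g} -> {for t, continuous (fun x => f x +i* g x : R[i])}.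
Proof.
move=> cf cg; apply/cvg_ballP => e e0.
have [r r0 er] : exists2 r, 0 < r & e = r%:C.
  case: e e0 => a b; rewrite ltcE /= => /andP[/eqP b0 a0].
  by exists a => //; rewrite b0.
have r2 : 0 < r / 2 by rewrite divr_gt0.
have nf := cvg_ball cf r2; have ng := cvg_ball cg r2.
near=> x; rewrite -ball_normE /= er.
have bf : ball (f t) (r / 2) (f x) by near: x; exact: nf.
have bg : ball (g t) (r / 2) (g x) by near: x; exact: ng.
move: bf bg; rewrite -!ball_normE /= => bf bg.
have -> : (f t +i* g t) - (f x +i* g x) = (f t - f x)%:C + (0 +i* (g t - g x)) :> R[i].
  by apply/eqP; rewrite eq_complex /= addr0 add0r !eqxx.
apply: le_lt_trans (ler_normD _ _) _.
rewrite !normc_def /= !expr0n /= addr0 add0r !sqrtr_sqr -rmorphD /= ltcR; lra.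
Unshelve. all: by end_near. Qed.

Lemma cont_div (T : topologicalType) (f g : T -> R) (t : T) : continuous f -> continuous g ->
  g t != 0 -> {for t, continuous (fun x => f x / g x)}.
Proof. by move=> cf cg g0; exact: cvgM (cf t) (cvgV g0 (cg t)). Qed.

Lemma cont_kpt : continuous (@kpt R : R[i] * R -> form4).
Proof.
move=> p.
have cr : continuous (fun q : R[i] * R => complex.Re q.1).
  by move=> q; apply: (@continuous_comp _ _ _ fst (@complex.Re R)); [exact: cvg_fst|exact: cont_Re].
have ci : continuous (fun q : R[i] * R => complex.Im q.1).
  by move=> q; apply: (@continuous_comp _ _ _ fst (@complex.Im R)); [exact: cvg_fst|exact: cont_Im].
have ct : continuous (fun q : R[i] * R => q.2) by move=> q; exact: cvg_snd.
have c1 : continuous (fun q : R[i] * R => 1 : R) by exact: contC.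
have c2 : continuous (fun q : R[i] * R => sqnorm q.1 + q.2 ^+ 2 : R) by rewrite /sqnorm; mcont.
exact: (cvg_pair (cvg_pair (cvg_pair (c1 p) (ci p)) (cr p)) (c2 p)).
Qed.

(** The point of H^3 represented by K, a left inverse of [kpt] up to scaling. *)
Definition form_pt K : R[i] * R :=
  ((fx K / fd K) +i* (fy K / fd K), Num.sqrt (fdet K) / fd K).

Lemma form_pt_kpt c p : 0 < c -> H3 R p -> form_pt (fscale c (kpt p)) = p.
Proof.
move=> c0; case: p => [[x y] t] t0; rewrite /H3 /= in t0.
have c1 : c != 0 by rewrite gt_eqF.
have D : fdet (fscale c (kpt ((x +i* y), t))) = (c * t) ^+ 2 by rewrite fdet_scale kpt_det exprMn.
rewrite /form_pt D sqrtr_sqr ger0_norm ?mulr_ge0 ?ltW //.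
congr (_ +i* _, _).
- by change (c * x / (c * 1) = x); field.
- by change (c * y / (c * 1) = y); field.
- by change (c * t / (c * 1) = t); field.
Qed.

Lemma cont_form_pt n : fd n != 0 -> {for (n : form4), continuous (form_pt : form4 -> R[i] * R)}.
Proof.
move=> d0.
have cm (f : form4 -> R) : continuous f -> {for (n : form4), continuous (fun K : form4 => f K / fd K)}.
  by move=> cf; exact: (cont_div cf (@cont_fd R) d0).
have c1 := cm _ (@cont_fx R); have c2 := cm _ (@cont_fy R); have c3 := cm _ (@cont_sqdet R).
exact: (cvg_pair (cvg_complex c1 c2) c3).
Qed.

(** Compact sets large enough to exhaust H^3, or its closure without oo. *)
Definition slab (a b c : R) : set (R[i] * R) :=
  [set p | [/\ `|complex.Re p.1| <= a, `|complex.Im p.1| <= a & b <= p.2 <= c]].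

Lemma compact_slab a b c : compact (slab a b c).
Proof.
have -> : slab a b c = (fun q : R * R * R => (q.1.1 +i* q.1.2, q.2)) @`
    ((`[- a, a]%classic `*` `[- a, a]%classic) `*` `[b, c]%classic).
  apply/seteqP; split.
    move=> [[x y] t] [/= hx hy ht]; exists (x, y, t) => //=.
    by split; [split|] => /=; rewrite in_itv /= -?ler_norml.
  move=> _ [[[x y] t] [[/= hx hy] ht] <-]; move: hx hy ht; rewrite /= !in_itv /= -!ler_norml.
  by move=> hx hy ht; split.
apply: continuous_compact; last first.
  by apply: compact_setX; [apply: compact_setX|]; exact: segment_compact.
apply: continuous_subspaceT => q.
have c1 : continuous (fun q : R * R * R => q.1.1).
  by move=> x; apply: (@continuous_comp _ _ _ fst fst); exact: cvg_fst.
have c2 : continuous (fun q : R * R * R => q.1.2).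
  by move=> x; apply: (@continuous_comp _ _ _ fst snd); [exact: cvg_fst|exact: cvg_snd].
have c3 : continuous (fun q : R * R * R => q.2) by move=> x; exact: cvg_snd.
exact: (cvg_pair (cvg_complex (c1 q) (c2 q)) (c3 q)).
Qed.
End CTop.

(** * The limit set in terms of forms *)

Section LimitForm.
Variable R : realType.
Notation form4 := (R * R * R * R)%type.
Implicit Types (K L H n m : hform R) (g h : PSL2 R).

Lemma fscaleA c c' K : fscale c (fscale c' K) = fscale (c * c') K.
Proof. by apply: hformP; rewrite !fscaleE mulrA. Qed.
Lemma fscale1 K : fscale 1 K = K.
Proof. by apply: hformP; rewrite !fscaleE mul1r. Qed.

Lemma cont_scale c : continuous (fscale c : form4 -> form4).
Proof.
move=> K.
have cd : continuous (fun H : form4 => c * fd H) by mcont.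
have cy : continuous (fun H : form4 => c * fy H) by mcont.
have cx : continuous (fun H : form4 => c * fx H) by mcont.
have ca : continuous (fun H : form4 => c * fa H) by mcont.
exact: (cvg_pair (cvg_pair (cvg_pair (cd K) (cy K)) (cx K)) (ca K)).
Qed.

Definition base_form : hform R := kpt (base_point R).

Lemma base_H3 : H3 R (base_point R).
Proof. by rewrite /H3 /=. Qed.

(** The projective class of n is an accumulation point of an orbit. The scaling factors make
    the notion independent of any normalisation, and treat oo like the other points. *)
Definition limit_form (S : set (PSL2 R)) n : Prop := forall W : set form4, nbhs (n : form4) W ->
  exists g c, [/\ S g, 0 < c & W (fscale c (gm g base_form))].

Lemma limit_form_scale S c n : 0 < c -> limit_form S n -> limit_form S (fscale c n).
Proof.
move=> c0 ln W nW; have [g [c' [Sg c'0 Wg]]] := ln _ (@cont_scale c n W nW).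
by exists g, (c * c'); rewrite mulr_gt0 // -fscaleA.
Qed.

Lemma limit_form_gm (S : set (PSL2 R)) g n : (forall h, S h -> S (g * h)%g) ->
  limit_form S n -> limit_form S (gm g n).
Proof.
move=> Sg ln W nW; have [h [c [Sh c0 Wh]]] := ln _ (@cont_gm R g n W nW).
by exists (g * h)%g, c; rewrite gmM -gm_scale; split=> //; exact: Sg.
Qed.

Lemma orbit_kpt g : exists2 c, 0 < c & kpt (act g (base_point R)) = fscale c (gm g base_form).
Proof.
have := gm_kpt g base_H3; have := gm_pos g (kpt_pos base_H3).
set F := gm g (kpt _) => -[d0 _] E.
exists (fd F)^-1; first by rewrite invr_gt0.
by rewrite /base_form -/F [X in fscale _ X]E fscaleA mulVf ?fscale1 // gt_eqF.
Qed.

Lemma nptE (z : R[i]) : npt (Some z) = kpt (z, 0).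
Proof. by rewrite /npt /kpt /= expr0n addr0. Qed.

Lemma closed_slab a b c : closed (@slab R a b c).
Proof.
have cr : continuous (fun q : R[i] * R => `|complex.Re q.1|).
  move=> q; apply: (@continuous_comp _ _ _ (fun q : R[i] * R => complex.Re q.1) (fun x : R => `|x|)).
    by apply: (@continuous_comp _ _ _ fst (@complex.Re R)); [exact: cvg_fst|exact: cont_Re].
  exact: norm_continuous.
have ci : continuous (fun q : R[i] * R => `|complex.Im q.1|).
  move=> q; apply: (@continuous_comp _ _ _ (fun q : R[i] * R => complex.Im q.1) (fun x : R => `|x|)).
    by apply: (@continuous_comp _ _ _ fst (@complex.Im R)); [exact: cvg_fst|exact: cont_Im].
  exact: norm_continuous.
have ct : continuous (fun q : R[i] * R => q.2) by move=> q; exact: cvg_snd.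
have -> : slab a b c = ((fun q : R[i] * R => `|complex.Re q.1|) @^-1` [set x | x <= a]) `&`
   ((fun q : R[i] * R => `|complex.Im q.1|) @^-1` [set x | x <= a]) `&`
   ((fun q : R[i] * R => q.2) @^-1` [set x | b <= x]) `&`
   ((fun q : R[i] * R => q.2) @^-1` [set x | x <= c]).
  apply/seteqP; split=> q /=; first by move=> [h1 h2 /andP[h3 h4]].
  by move=> [[[h1 h2] h3] h4]; split=> //; apply/andP.
apply: closedI; first apply: closedI; first apply: closedI.
- by apply: (continuous_closedP _).1; [exact: cr|exact: closed_le].
- by apply: (continuous_closedP _).1; [exact: ci|exact: closed_le].
- by apply: (continuous_closedP _).1; [exact: ct|exact: closed_ge].
- by apply: (continuous_closedP _).1; [exact: ct|exact: closed_le].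
Qed.

(** The map [kpt] identifies H^3 and its finite boundary points with rays of forms, with
    inverse [form_pt]; neighbourhoods of the point oo of the compactification correspond to
    neighbourhoods of its null form because 1 + |z|^2 + t^2 = ftr (kpt (z, t)) is proper. *)
Lemma limit_setP (Gamma : groupClosed (PSL2 R)) (xi : boundary R) :
  limit_set Gamma xi <-> limit_form [set` Gamma] (npt xi).
Proof.
case: xi => [z|]; split.
- move=> cl W; rewrite nptE => nW.
  have nV : nbhs (Some (z, 0) : one_point_compactification (R[i] * R)) (Some @` (@kpt R @^-1` W)).
    by apply: one_point_compactification_some_nbhs; exact: (@cont_kpt R (z, 0) W nW).
  have := cl _ nV; move=> [_ [[p [g Gg <-] <-] [q Wq [E]]]]; rewrite /= E in Wq.
  by have [c c0 cE] := orbit_kpt g; exists g, c; rewrite -cE.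
- move=> ln B nB.
  have fn : form_pt (npt (Some z)) = (z, 0).
    rewrite /form_pt nptE [fdet _](_ : _ = 0); last by rewrite /fdet !kptE /sqnorm /=; ring.
    by rewrite !kptE !divr1 sqrtr0; case: z {ln nB}.
  have dn : fd (npt (Some z)) != 0 by rewrite nptE kptE oner_neq0.
  have nB' : nbhs (form_pt (npt (Some z))) (Some @^-1` B) by rewrite fn.
  have [g [c [Sg c0 Bg]]] := ln _ (cont_form_pt dn nB').
  have [c' c'0 cE] := orbit_kpt g.
  have E : form_pt (fscale c (gm g base_form)) = act g (base_point R).
    rewrite -[gm g base_form](fscale1) -(@divff _ c') ?gt_eqF // [c' / c']mulrC -fscaleA -cE fscaleA.
    apply: form_pt_kpt; first by rewrite divr_gt0.
    exact: act_H3 base_H3.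
  exists (Some (act g (base_point R))); split; last by rewrite /= E in Bg.
  by exists (act g (base_point R)) => //; exists g.
- move=> cl W /nbhs_ballP[r /= r0 sub].
  (* Outside the slab of size a, N = 1 + |z|^2 + t^2 satisfies N^-1 < r and N^-1/2 < r. *)
  pose a := 2 / r + 2 / r ^+ 2 + 1.
  have i0 : 0 < 2 / r by rewrite divr_gt0.
  have i1 : 0 < 2 / r ^+ 2 by rewrite divr_gt0 // exprn_gt0.
  have nC : nbhs (None : one_point_compactification (R[i] * R))
      ((Some @` (~` slab a 0 a)) `|` [set None]).
    by exists (slab a 0 a) => //; split; [exact: compact_slab|exact: closed_slab].
  have [_ [[p [g Gg gE] <-] []//]] := cl _ nC.
  move=> [q nq [E]]; rewrite {}E in nq.
  have [c c0 cE] := orbit_kpt g; rewrite gE in cE.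
  have := act_H3 g base_H3; rewrite gE.
  case: p nq cE {gE} => [[x y] t] nq cE t0; rewrite /H3 /= in t0.
  pose N := x ^+ 2 + y ^+ 2 + t ^+ 2 + 1.
  have [x2 y2 t2] : [/\ 0 <= x ^+ 2, 0 <= y ^+ 2 & 0 <= t ^+ 2] by rewrite !sqr_ge0.
  have N0 : 0 < N by rewrite /N; lra.
  have sq (u : R) : u ^+ 2 <= N - 1 -> N <= a -> `|u| <= a.
    move=> h1 h2; rewrite -(@ler_pXn2r _ 2) ?nnegrE //; last by rewrite /a; lra.
    rewrite -normrX ger0_norm ?sqr_ge0 //.
    have : a * 1 <= a * a by rewrite ler_pM2l; rewrite /a; lra.
    rewrite -expr2; lra.
  have Na : a < N.
    rewrite ltNge; apply/negP => Na; apply: nq; split=> /=.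
    - by apply: (sq x) => //; rewrite /N; lra.
    - by apply: (sq y) => //; rewrite /N; lra.
    - rewrite (ltW t0) /=; apply: le_trans (ler_norm _) _; apply: sq => //; rewrite /N; lra.
  have Ni : 0 < N^-1 by rewrite invr_gt0.
  exists g, (N^-1 * c); rewrite mulr_gt0 // -fscaleA -cE; split=> //; apply: sub.
  have small1 : N^-1 < r.
    rewrite -[r]invrK ltf_pV2 ?posrE ?invr_gt0 //.
    apply: le_lt_trans Na; rewrite /a; have := i0; rewrite -[2 / r]/(2 * r^-1); lra.
  have small2 (u : R) : u ^+ 2 <= N - 1 -> `|N^-1 * u| < r.
    move=> uN; rewrite -(@ltr_pXn2r _ 2) ?nnegrE ?(ltW r0) // -normrX ger0_norm ?sqr_ge0 //.
    rewrite exprMn.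
    have h1 : N^-1 ^+ 2 * u ^+ 2 <= N^-1 ^+ 2 * N by rewrite ler_pM2l ?exprn_gt0 //; lra.
    apply: le_lt_trans h1 _; rewrite expr2 -mulrA mulVf ?gt_eqF // mulr1.
    rewrite -[r ^+ 2]invrK ltf_pV2 ?posrE ?invr_gt0 ?exprn_gt0 //.
    apply: le_lt_trans Na; rewrite /a; have := i1; rewrite -[2 / r ^+ 2]/(2 * (r ^+ 2)^-1); lra.
  split; [split; [split|]|]; rewrite -ball_normE /=.
  - by rewrite sub0r normrN mulr1 ger0_norm // ltW.
  - by rewrite sub0r normrN; apply: (small2 y); rewrite /N; lra.
  - by rewrite sub0r normrN; apply: (small2 x); rewrite /N; lra.
  - rewrite /sqnorm /= (_ : 1 - _ = N^-1); first by rewrite ger0_norm // ltW.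
    by rewrite /N; field; rewrite -/N gt_eqF.
- move=> ln B [C [cC _] CB].
  pose N (p : R[i] * R) : R := ftr (kpt p).
  have cN : continuous N.
    move=> p; apply: (@continuous_comp _ _ _ (@kpt R : _ -> form4) (@ftr R : form4 -> R)).
      exact: cont_kpt.
    exact: cont_ftr.
  have /compact_bounded[M [_ MP]] := continuous_compact (continuous_subspaceT cN) cC.
  pose M' := `|M| + 1.
  have bd p : C p -> N p <= M'.
    move=> Cp; apply: le_trans (ler_norm _) _; apply: MP; last by exists p.
    by rewrite /M'; have := ler_norm M; lra.
  have c1 : continuous (fun L : form4 => ftr L - M' * fd L).
    by have ct := @cont_ftr R; mcont.
  have nW : \forall L \near (npt None : form4), 0 < ftr L - M' * fd L.
    by apply: (cvgr_gt _ (c1 _)); rewrite /ftr /npt /fd /fa /= mulr0 addr0 subr0 ltr01.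
  have [g [c [Gg c0 Wg]]] := ln _ nW.
  have [c' c'0 cE] := orbit_kpt g.
  have nC : ~ C (act g (base_point R)).
    move=> /bd; rewrite /N cE; apply/negP; rewrite -ltNge.
    have d1 : c' * fd (gm g base_form) = 1 by rewrite -fscaleE -cE kptE.
    move: Wg; rewrite /= !ftr_scale fscaleE => Wg.
    have : 0 < c * (ftr (gm g base_form) - M' * fd (gm g base_form)) by lra.
    rewrite pmulr_rgt0 // => W2.
    have : 0 < c' * (ftr (gm g base_form) - M' * fd (gm g base_form)) by rewrite mulr_gt0.
    rewrite mulrBr mulrCA d1; lra.
  exists (Some (act g (base_point R))); split.
    by exists (act g (base_point R)) => //; exists g.
  by apply: CB; left; exists (act g (base_point R)).
Qed.
End LimitForm.

(** * The tessellation of a fundamental polyhedron *)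

Section Fundamental.
Variable R : realType.
Notation form4 := (R * R * R * R)%type.
Implicit Types (K L H n m : hform R) (g h : PSL2 R).

Lemma actM g h p : H3 R p -> act (g * h)%g p = act g (act h p).
Proof.
move=> p0; have q0 := act_H3 h p0.
have e1 := gm_kpt (g * h)%g p0; have e2 := gm_kpt h p0; have e3 := gm_kpt g q0.
have [d1 _] := gm_pos (g * h)%g (kpt_pos p0).
set B := fd (gm (g * h)%g _) in e1 d1; rewrite gmM e2 gm_scale e3 fscaleA in e1.
set A := _ * _ in e1; apply: (kpt_inj (act_H3 _ p0) (act_H3 _ q0) (c := B^-1 * A)).
by rewrite -fscaleA e1 fscaleA mulVf ?fscale1 // gt_eqF.
Qed.

Lemma act1 p : H3 R p -> act 1%g p = p.
Proof.
move=> p0; have := gm_kpt 1%g p0; rewrite gm1 => E.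
by apply/esym; apply: (kpt_inj p0 (act_H3 _ p0) E).
Qed.

Lemma fx_gm_kpt g p : H3 R p -> fx (gm g (kpt p)) = fd (gm g (kpt p)) * complex.Re (act g p).1.
Proof. by move=> p0; rewrite [in LHS](gm_kpt g p0) fscaleE kptE. Qed.

Lemma tile_kpt s p : H3 R p -> tile s (kpt p) <-> polyhedron s p.
Proof.
move=> p0; have fxE h : (0 <= fx (gm h (kpt p))) = (0 <= complex.Re (act h p).1).
  by rewrite fx_gm_kpt // pmulr_rge0 //; exact: (gm_pos h (kpt_pos p0)).1.
split=> [[_ H]|[_ H]]; split=> //; try exact: kpt_pos.
  by move=> h hs; have := H h hs; rewrite fxE.
by move=> h hs; rewrite fxE; exact: H.
Qed.

Lemma tile_scaleE s c K : 0 < c -> tile s (fscale c K) <-> tile s K.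
Proof.
move=> c0; split; first exact: tile_scale.
move=> [pK sK]; split; first exact/fscaleK_pos.
by move=> h hs; rewrite gm_scale fscaleE mulr_ge0 ?(ltW c0) // sK.
Qed.

Lemma tile0_interior s p : H3 R p -> tile0 s (kpt p) -> (polyhedron s)° p.
Proof.
move=> p0 tp.
have n1 : \forall q \near p, tile0 s (kpt q) by exact: (@cont_kpt R p _ (near_tile0 tp)).
have c2 : continuous (fun q : R[i] * R => q.2) by move=> q; exact: cvg_snd.
have n2 : \forall q \near p, 0 < q.2 by exact: (cvgr_gt _ (c2 p) _ p0).
suff : \forall q \near p, polyhedron s q by [].
near=> q; have q0 : H3 R q by near: q; exact: n2.
have [pq tq] : tile0 s (kpt q) by near: q; exact: n1.
by apply/tile_kpt => //; split=> // h hs; apply: ltW; exact: tq.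
Unshelve. all: by end_near. Qed.

(** Apply compactness to the filter of sets whose complement in Q meets finitely many A i. *)
Lemma lf_compact (I : choiceType) (D : set I) (T : topologicalType) (A : I -> set T) (Q : set T) : compact Q ->
  (forall p, Q p -> exists2 V, nbhs p V & finite_set [set i | D i /\ V `&` A i !=set0]) ->
  finite_set [set i | D i /\ Q `&` A i !=set0].
Proof.
move=> cQ lf; apply: contrapT => inf.
pose F : set_system T := [set X | finite_set [set i | D i /\ (Q `\` X) `&` A i !=set0]].
have FF : ProperFilter F.
  split; last split.
  - move=> F0; apply: inf; apply: sub_finite_set F0 => i [Di [x [Qx Ax]]].
    by split=> //; exists x; split=> //; split.
  - rewrite /F /= (_ : mkset _ = set0); first exact: finite_set0.
    by apply/seteqP; split=> // i [_ [x [[_ ]]]]; case.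
  - move=> X Y FX FY; have := FY; have := FX; rewrite /F /= => h1 h2.
    have : finite_set ([set i | D i /\ (Q `\` X) `&` A i !=set0] `|` [set i | D i /\ (Q `\` Y) `&` A i !=set0]).
      by rewrite finite_setU.
    apply: sub_finite_set => i [Di [x [[Qx nXY] Ax]]].
    have [Xx|nXx] := pselect (X x).
      by right; split=> //; exists x; split=> //; split=> // Yx; apply: nXY.
    by left; split=> //; exists x.
  - move=> X Y XY; apply: sub_finite_set => i [Di [x [[Qx nY] Ax]]].
    by split=> //; exists x; split=> //; split=> // /XY.
have FQ : F Q.
  rewrite /F /= (_ : mkset _ = set0); first exact: finite_set0.
  by apply/seteqP; split=> // i [_ [x [[Qx nQ] _]]]; case: nQ.
have [p [Qp clp]] := cQ F FF FQ.
have [V nV fV] := lf p Qp.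
have FV : F (~` V).
  apply: sub_finite_set fV => i [Di [x [[_ nV'] Ax]]].
  by split=> //; exists x; split=> //; apply: contrapT.
by have [x []] := clp _ _ FV nV.
Qed.

(** Local finiteness on balls follows from local finiteness at points by compactness. *)
Lemma fundamental_tessellation (Gamma : groupClosed (PSL2 R)) s :
  fundamental_domain Gamma (polyhedron s) -> tessellation [set` Gamma] s.
Proof.
move=> [cov disj lf]; split.
- exact: gpred1.
- by move=> g h; exact: gpredM.
- by move=> g /=; rewrite gpredV.
- move=> K pK; have [p p0 KE] := kpt_ex pK.
  have [g Gg [q Pq qp]] := cov p p0.
  have q0 : H3 R q by case: Pq.
  exists g^-1%g; first by rewrite /= gpredV.
  have d0 := pK.1; rewrite KE gm_scale; apply/tile_scaleE => //.
  rewrite -qp (gm_kpt g^-1%g (act_H3 g q0)); apply/tile_scaleE.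
    exact: (gm_pos g^-1%g (kpt_pos (act_H3 g q0))).1.
  by rewrite -actM // mulVg act1 //; apply/tile_kpt.
- move=> g K Gg tK tgK; have [pK _] := tK; have [p p0 KE] := kpt_ex pK.
  have d0 := pK.1; set d := fd K in KE d0.
  have unsc c L : 0 < c -> tile0 s (fscale c L) -> tile0 s L.
    move=> c0 [/(fscaleK_pos _ c0) pL sL]; split=> // h hs.
    by have := sL h hs; rewrite gm_scale fscaleE pmulr_rgt0.
  apply: contrapT => /eqP g1; have := disj g Gg g1; apply/eqP/set0P.
  exists (act g p); split.
    apply: tile0_interior; first exact: act_H3.
    move: tgK; rewrite KE gm_scale (gm_kpt g p0) fscaleA; apply: unsc.
    by rewrite mulr_gt0 //; exact: (gm_pos g (kpt_pos p0)).1.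
  exists p => //; apply: tile0_interior => //.
  by move: tK; rewrite KE; exact: unsc.
- move=> M; have := @lf_compact _ [set` Gamma] _ (fun g => act g @` polyhedron s) _ (@compact_slab R M M^-1 M).
  have [M0|M0] := leP M 0.
    move=> _; rewrite (_ : mkset _ = set0); first exact: finite_set0.
    apply/seteqP; split=> // g [_ [K [pK _] le]].
    have : 0 < ftr (gm g K) ^+ 2.
      have pg := gm_pos g pK; have := fpos_fa pg; have := pg.1 => h1 h2.
      by rewrite exprn_gt0 // /ftr; lra.
    by have : M * fdet K <= 0; [rewrite mulr_le0_ge0 // ltW //; exact: pK.2|lra].
  move=> H; apply: sub_finite_set (H _).
    move=> g [Gg [K tK le]]; split=> //.
    have [pK _] := tK; have [q q0 KE] := kpt_ex pK.
    exists (act g q); split; last first.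
      exists q => //; apply/tile_kpt => //.
      by move: tK; rewrite KE tile_scaleE //; exact: pK.1.
    have p0 := act_H3 g q0; rewrite -(gm_det g) in le.
    have d0 := pK.1; have d1 := (gm_pos g (kpt_pos q0)).1.
    have gE : gm g K = fscale (fd K * fd (gm g (kpt q))) (kpt (act g q)).
      by rewrite [in LHS]KE gm_scale [in LHS](gm_kpt g q0) fscaleA.
    rewrite gE ftr_scale fdet_scale in le.
    set c := fd K * fd _ in le; have c2 : 0 < c ^+ 2 by rewrite exprn_gt0 // mulr_gt0.
    rewrite exprMn [M * _]mulrCA in le.
    rewrite ler_pM2l // kpt_det /ftr !kptE in le.
    case: (act g q) p0 le => [[x y] t]; rewrite /H3 /sqnorm /slab /= => t0 le.
    have [x2 y2 t2] : [/\ 0 <= x ^+ 2, 0 <= y ^+ 2 & 0 < t ^+ 2] by rewrite !sqr_ge0 exprn_gt0.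
    set N := _ + 1 in le.
    have N1 : 1 <= N by rewrite /N; lra.
    have NN : N <= N ^+ 2 by rewrite expr2 -[X in X <= _]mulr1 ler_pM2l //; lra.
    have tM : t ^+ 2 <= M.
      rewrite -(ler_pM2r t2); apply: le_trans le.
      rewrite -expr2 lerXn2r // ?nnegrE /N; lra.
    have tM' : 1 <= M * t ^+ 2 by lra.
    have MM : 1 <= M ^+ 2.
      rewrite expr2; apply: le_trans tM' _; by rewrite ler_pM2l.
    have M1 : 1 <= M.
      by rewrite -(@ler_pXn2r _ 2) ?nnegrE ?(ltW M0) // expr1n.
    have NM : N ^+ 2 <= M ^+ 2.
      by apply: (le_trans le); rewrite expr2 ler_pM2l.
    have MM1 : M <= M ^+ 2 by rewrite expr2 -[X in X <= _]mulr1 ler_pM2l.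
    have abs (u : R) : u ^+ 2 <= M ^+ 2 -> `|u| <= M.
      by move=> h; rewrite -(@ler_pXn2r _ 2) ?nnegrE ?(ltW M0) // -normrX ger0_norm // sqr_ge0.
    split.
    - by apply: (abs x); apply: le_trans NM; apply: le_trans NN; rewrite /N; lra.
    - by apply: (abs y); apply: le_trans NM; apply: le_trans NN; rewrite /N; lra.
    apply/andP; split; last by apply: le_trans (ler_norm _) _; apply: abs; lra.
    have tm : t <= M by apply: le_trans (ler_norm _) _; apply: abs; lra.
    rewrite leNgt; apply/negP => tl.
    have : M * t < 1 by rewrite -(@mulfV _ M) ?gt_eqF // ltr_pM2l.
    move=> h; have : M * t ^+ 2 < t by rewrite expr2 mulrA -[X in _ < X]mul1r ltr_pM2r.
    have : M^-1 <= 1 by rewrite invf_le1.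
    lra.
  move=> p [_ _ /andP[pM _]]; have p0 : H3 R p by apply: lt_le_trans pM; rewrite invr_gt0.
  have [V nV fV] := lf p p0; exists V => //.
Qed.
End Fundamental.

(** * Normalisation of a rank one parabolic fixed point *)

Section Parabolic.
Variable R : realType.
Implicit Types (K L H n m : hform R) (g h k u : PSL2 R) (z w : R[i]).

(** Conjugation by k changes the quotient ftr^2 / fdet by a bounded factor. *)
Lemma tes_conj S s k : tessellation S s ->
  tessellation [set g | S (k * g * k^-1)%g] [seq (h * k)%g | h <- s].
Proof.
move=> [S1 SM SV cov disj lf].
have tE K : tile [seq (h * k)%g | h <- s] K <-> tile s (gm k K).
  split=> [[pK sK]|[pK sK]]; split.
  - exact: gm_pos.
  - by move=> h hs; rewrite -gmM; apply: sK; apply/mapP; exists h.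
  - by rewrite -(gmK k K); exact: gm_pos.
  - by move=> _ /mapP[h hs ->]; rewrite gmM; exact: sK.
have t0E K : tile0 [seq (h * k)%g | h <- s] K -> tile0 s (gm k K).
  move=> [pK sK]; split; first exact: gm_pos.
  by move=> h hs; rewrite -gmM; apply: sK; apply/mapP; exists h.
have conj g K : gm (k * g * k^-1)%g (gm k K) = gm k (gm g K) by rewrite !gmM gmK.
split.
- by rewrite /= mulg1 mulgV.
- move=> g h /= Sg Sh; rewrite (_ : (_ * _)%g = (k * g * k^-1 * (k * h * k^-1))%g); first exact: SM.
  by rewrite !mulgA mulgVK.
- move=> g /= Sg; rewrite (_ : (_ * _)%g = (k * g * k^-1)^-1%g); first exact: SV.
  by rewrite !invgM invgK !mulgA.
- move=> K pK; have [g Sg tg] := cov _ (gm_pos k pK).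
  exists (k^-1 * g * k)%g; first by rewrite /= !mulgA mulgV mul1g mulgK.
  by apply/tE; rewrite !gmM gmVK.
- move=> g K /= Sg /t0E tK /t0E tgK; rewrite -conj in tgK.
  have := disj _ _ Sg tK tgK => E; apply: (@mulgI _ k); apply: (@mulIg _ k^-1%g).
  by rewrite E mulg1 mulgV.
move=> M; pose b v := ftr (gm k v).
pose c := `|b (bas_d R)| + `|b (bas_y R)| + `|b (bas_x R)| + `|b (bas_a R)|.
have bound H : fpos H -> ftr (gm k H) <= c * ftr H.
  move=> pH; have [d0 D0] := pH; have a0 := fpos_fa pH.
  have tE' : ftr (gm k H) = fd H * b (bas_d R) + fy H * b (bas_y R) + fx H * b (bas_x R) + fa H * b (bas_a R).
    by rewrite /b /ftr fd_gm fa_gm; ring.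
  have t0 : 0 < ftr H by rewrite /ftr; lra.
  have sm (v : R) : v ^+ 2 <= ftr H ^+ 2 -> `|v| <= ftr H.
    by move=> h; rewrite -(@ler_pXn2r _ 2) ?nnegrE ?(ltW t0) // -normrX ger0_norm // sqr_ge0.
  have x2 := sqr_ge0 (fx H); have y2 := sqr_ge0 (fy H).
  have da := mulr_gt0 d0 a0; have dd := mulr_gt0 d0 d0; have aa := mulr_gt0 a0 a0.
  have tt : ftr H ^+ 2 = fd H * fd H + 2 * (fd H * fa H) + fa H * fa H by rewrite /ftr; ring.
  have D0' : 0 < fd H * fa H - fx H ^+ 2 - fy H ^+ 2 by rewrite mulrC.
  have one (v w : R) : `|v| <= ftr H -> v * w <= `|w| * ftr H.
    move=> vt; apply: le_trans (ler_norm _) _; rewrite normrM mulrC.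
    by apply: ler_wpM2l.
  rewrite tE' /c !mulrDl; apply: lerD; first apply: lerD; first apply: lerD.
  - by apply: one; apply: sm; rewrite tt expr2; lra.
  - by apply: one; apply: sm; rewrite tt; lra.
  - by apply: one; apply: sm; rewrite tt; lra.
  - by apply: one; apply: sm; rewrite tt expr2; lra.
apply: sub_finite_set (finite_image (fun g => (k^-1 * g * k)%g) (lf (c ^+ 2 * M))) => g [/= Sg [K tK le]].
exists (k * g * k^-1)%g; last by rewrite !mulgA mulVg mul1g mulgVK.
split=> //; exists (gm k K); first exact/tE.
rewrite conj gm_det.
have pg : fpos (gm g K) by apply: gm_pos; case: tK.
have t0 : 0 < ftr (gm k (gm g K)).
  by have pk := gm_pos k pg; have := fpos_fa pk; have := pk.1; rewrite /ftr; lra.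
apply: (@le_trans _ _ ((c * ftr (gm g K)) ^+ 2)).
  by rewrite lerXn2r ?nnegrE ?(le_trans _ (bound _ pg)) ?(ltW t0) // bound.
rewrite exprMn [X in _ <= X](_ : _ = c ^+ 2 * (M * fdet K)); last by ring.
by apply: ler_wpM2l; first exact: sqr_ge0.
Qed.

Lemma npt_inj (c : R) xi xi' : 0 < c -> npt xi = fscale c (npt xi') -> xi = xi'.
Proof.
case: xi xi' => [[x y]|] [[x' y']|] c0 E //; have := congr1 (@fd R) E; rewrite fscaleE /npt /fd /= => dE.
- have := congr1 (@fx R) E; have := congr1 (@fy R) E; rewrite !fscaleE /npt /fx /fy /=.
  by rewrite mulr1 in dE; rewrite -dE !mul1r => -> ->.
- by move: dE; rewrite mulr0 => /eqP; rewrite oner_eq0.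
- by move: dE; rewrite mulr1 => c1; rewrite -c1 ltxx in c0.
Qed.

Lemma mobiusM g h xi : mobius (g * h)%g xi = mobius g (mobius h xi).
Proof.
have [c1 c10 E1] := gm_npt (g * h)%g xi; have [c2 c20 E2] := gm_npt h xi.
have [c3 c30 E3] := gm_npt g (mobius h xi).
rewrite gmM E2 gm_scale E3 fscaleA in E1.
apply: (@npt_inj (c1^-1 * (c2 * c3))); first by rewrite !mulr_gt0 ?invr_gt0.
by rewrite -fscaleA E1 fscaleA mulVf ?fscale1 // gt_eqF.
Qed.

Lemma mobius1 (xi : boundary R) : mobius 1%g xi = xi.
Proof.
have [c c0 E] := gm_npt 1%g xi; rewrite gm1 in E.
by apply/esym; exact: npt_inj E.
Qed.

Lemma gm_inf_mobius u (c : R) : 0 < c -> gm u (inf_pt R) = fscale c (inf_pt R) -> mobius u None = None.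
Proof.
move=> c0 E; have [c' c'0 E'] := gm_npt u None; rewrite E in E'.
apply/esym; apply: (@npt_inj (c^-1 * c')); first by rewrite mulr_gt0 // invr_gt0.
by rewrite -fscaleA -E' fscaleA mulVf ?fscale1 // gt_eqF.
Qed.

Lemma upper_eq1 z : upper z = 1%g -> z = 0.
Proof.
rewrite -upper0 => /pslP /= [] /matrixP E.
  by have := E 0 1; rewrite !mx2E.
by have := E 0 1; rewrite [RHS]mxE !mx2E oppr0.
Qed.

Lemma upperXz z (j : int) : expgz (upper z) j = upper (j%:~R * z).
Proof.
have nat (n : nat) : (upper z ^+ n)%g = upper (n%:R * z).
  elim: n => [|n IH]; first by rewrite mul0r upper0.
  by rewrite expgS IH upperM -natr1 mulrDl mul1r addrC.
case: j => n; first exact: nat.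
by rewrite /expgz nat upperV NegzE mulrNz mulNr.
Qed.

Lemma mobius_upper z xi : mobius (upper z) xi = if xi is Some w then Some (w + z) else None.
Proof.
rewrite mobius_psl /mobius_mx /= !mx2E; case: xi => [w|]; last by rewrite eqxx.
by rewrite mul0r add0r oner_eq0 mul1r divr1.
Qed.

Fact dg_subproof (w : R[i]) : w != 0 -> \det (mx2 w 0 0 w^-1) = 1.
Proof. by move=> w0; rewrite det_mx2 mulr0 subr0 divff. Qed.
(** Acts as z |-> w^2 z. *)
Definition dg w (w0 : w != 0) : PSL2 R := psl (toSL2 (dg_subproof w0)).

Lemma dg_upper w (w0 : w != 0) z : (upper z * dg w0)%g = (dg w0 * upper (z / w ^+ 2)%R)%g.
Proof.
rewrite -[(upper z * _)%g]/(PSL2_mul _ _) -[(dg w0 * _)%g]/(PSL2_mul _ _) !psl_mul.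
congr (psl _); apply: val_inj => /=.
by rewrite !mulmx2 !(mul1r, mulr1, mul0r, mulr0, addr0, add0r); congr mx2; field.
Qed.

Lemma mobius_dg w (w0 : w != 0) xi : mobius (dg w0) xi = if xi is Some z then Some (w ^+ 2 * z) else None.
Proof.
rewrite mobius_psl /mobius_mx /= !mx2E; case: xi => [z|]; last by rewrite eqxx.
by rewrite mul0r add0r addr0 invr_eq0 (negbTE w0) invrK expr2 mulrAC.
Qed.

(** Conjugate the stabiliser into the translations. If z0 and z are two of them, the rank
    being 1 provides an integral relation between them, so z is a real multiple of z0; a
    further conjugation by z |-> z0 z turns z0 into 1. *)
Lemma cusp_frame (Gamma : groupClosed (PSL2 R)) : has_rank1_parabolic Gamma ->
  exists k, [/\ limit_set Gamma (mobius k None), (k * u_ 1 * k^-1)%g \in Gamma &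
    forall u, (k * u * k^-1)%g \in Gamma -> mobius u None = None -> exists r, u = u_ r].
Proof.
move=> [sg [sl [g0 [g0G g0s] g01] [h hN]] [_ rk]].
have conjE g : (g ^ h)%g = (h^-1 * (g * h))%g by [].
have up g : stabilizer Gamma sg g -> exists z, g = (h * upper z * h^-1)%g.
  move=> gs; have [z _ zE] : N_ R (g ^ h)%g by apply: hN; exists g.
  by exists z; rewrite zE conjgE !mulgA mulgV mul1g mulgK.
have [z0 z0E] := up g0 (conj g0G g0s).
have z00 : z0 != 0.
  by apply: contraNneq g01 => z00; rewrite z0E z00 upper0 mulg1 mulgV.
have sgE : mobius h None = sg.
  have fix1 : mobius (upper z0) (mobius h^-1%g sg) = mobius h^-1%g sg.
    by rewrite -[in RHS]g0s z0E -!mobiusM !mulgA mulVg mul1g.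
  move: fix1; rewrite mobius_upper; case E : (mobius h^-1%g sg) => [w|].
    by case=> /eqP; rewrite -subr_eq0 addrAC subrr add0r (negbTE z00).
  by rewrite -E -mobiusM mulgV mobius1.
have realmul z : stabilizer Gamma sg (h * upper z * h^-1)%g -> exists r : R, z = r%:C * z0.
  move=> zs; pose e (i : 'I_2) := if i == 0 then g0 else (h * upper z * h^-1)%g.
  have es i : stabilizer Gamma sg (e i) by rewrite /e; case: ifP.
  have nind : ~ Z_independent e by move=> ind; have := rk _ e es ind.
  have [kk [kp [i ki]]] : exists kk : 'I_2 -> int, (\prod_(i < 2) expgz (e i) (kk i))%g = 1%g /\
      exists i, kk i != 0.
    apply: contrapT => no; apply: nind => kk kp i; apply: contrapT => ki.
    by apply: no; exists kk; split=> //; exists i; apply/eqP.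
  have ex (w : R[i]) (j : int) : expgz (h * upper w * h^-1)%g j = (h * upper (j%:~R * w)%R * h^-1)%g.
    rewrite -upperXz; have cj g : (h * g * h^-1)%g = (g ^ h^-1)%g by rewrite conjgE invgK mulgA.
    by rewrite !cj; case: j => n; rewrite /expgz ?conjVg conjXg.
  have lin : (kk 0)%:~R * z0 + (kk 1)%:~R * z = 0.
    move: kp; rewrite !big_ord_recl big_ord0 mulg1 /e /= z0E !ex.
    have -> : lift ord0 ord0 = 1 :> 'I_2 by apply: val_inj.
    rewrite !mulgA mulgVK -(mulgA h) upperM => E.
    apply: upper_eq1; apply: (@mulgI _ h); apply: (@mulIg _ h^-1%g).
    by rewrite E mulg1 mulgV.
  have k1 : kk 1 != 0.
    apply/eqP => k1; move: lin; rewrite k1 mul0r addr0 => /eqP.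
    rewrite mulf_eq0 (negbTE z00) orbF intr_eq0 => /eqP k0.
    move: ki; have [->|->] : i = 0 \/ i = 1.
      by case: i => -[|[|//]] ?; [left|right]; apply: val_inj.
    - by rewrite k0.
    - by rewrite k1.
  exists (- (kk 0)%:~R / (kk 1)%:~R).
  have k1' : (kk 1)%:~R != 0 :> R[i] by rewrite intr_eq0.
  apply: (mulfI k1'); rewrite rmorphM rmorphN fmorphV /= !rmorph_int.
  have -> : (kk 1)%:~R * z = - (kk 0)%:~R * z0 by apply/eqP; rewrite mulNr -addr_eq0 addrC lin.
  by field.
pose w := sqrtC z0; have w2 : w ^+ 2 = z0 by rewrite sqrtCK.
have w0 : w != 0 by rewrite sqrtC_eq0.
pose k := (h * dg w0)%g.
have kN : mobius k None = sg by rewrite mobiusM mobius_dg.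
have kconj z : (k * upper (z / z0)%R * k^-1)%g = (h * upper z * h^-1)%g.
  by rewrite /k -w2 -(mulgA h) -dg_upper invgM !mulgA mulgK.
exists k; split.
- by rewrite kN.
- have -> : u_ 1 = upper (z0 / z0) :> PSL2 R by rewrite divff.
  by rewrite kconj -z0E.
move=> u uG uN.
have us : stabilizer Gamma sg (k * u * k^-1)%g.
  split=> //; rewrite -kN -!mobiusM mulgVK.
  by rewrite mobiusM uN.
have [z zE] := up _ us.
have [r rE] : exists r : R, z = r%:C * z0 by apply: realmul; rewrite -zE.
exists r; apply: (@mulgI _ k); apply: (@mulIg _ k^-1%g).
rewrite zE -kconj; congr (_ * upper _ * _)%g.
by rewrite rE mulfK.
Qed.
End Parabolic.

(** * Frames avoiding the limit set *)

Section Dynamics.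
Variable R : realType.
Notation form4 := (R * R * R * R)%type.
Implicit Types (K L H n m : hform R) (g h k u : PSL2 R) (z w : R[i]).

(** The null form of (p : q) where (p, q) = A (r, 1). *)
Lemma fmove_npt (A : 'M[R[i]]_2) (r : R) :
  let p1 := complex.Re (A 0 0) * r + complex.Re (A 0 1) in
  let p2 := complex.Im (A 0 0) * r + complex.Im (A 0 1) in
  let q1 := complex.Re (A 1 0) * r + complex.Re (A 1 1) in
  let q2 := complex.Im (A 1 0) * r + complex.Im (A 1 1) in
  fmove A (npt (Some r%:C)) = mkf (q1 ^+ 2 + q2 ^+ 2) (p2 * q1 - p1 * q2) (p1 * q1 + p2 * q2)
    (p1 ^+ 2 + p2 ^+ 2).
Proof.
rewrite /fmove /npt; case: (A 0 0) => a a'; case: (A 0 1) => b b'.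
case: (A 1 0) => c c'; case: (A 1 1) => d d'; rewrite /fb /fd /fx /fy /fa /sqnorm /=.
by apply: hformP; rewrite /fd /fx /fy /fa /=; ring.
Qed.

Lemma cont_entry (T : topologicalType) (i j : 'I_2) : continuous (fun A : 'M[T]_2 => A i j).
Proof.
move=> A U nU; exists (fun i' j' => if (i' == i) && (j' == j) then U else setT).
  move=> i' j'; case: ifP => [/andP[/eqP-> /eqP->] //|_]; exact: filterT.
by move=> B /(_ i j); rewrite !eqxx.
Qed.

Lemma cont_fmove_npt :
  continuous (fun q : 'M[R[i]]_2 * R => fmove q.1 (npt (Some q.2%:C)) : form4).
Proof.
move=> q0.
have re i j : continuous (fun q : 'M[R[i]]_2 * R => complex.Re (q.1 i j)).
  move=> q; apply: (@continuous_comp _ _ _ (fun q : 'M[R[i]]_2 * R => q.1 i j) (@complex.Re R)).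
    apply: (@continuous_comp _ _ _ fst (fun A : 'M[R[i]]_2 => A i j)); first exact: cvg_fst.
    exact: cont_entry.
  exact: cont_Re.
have im i j : continuous (fun q : 'M[R[i]]_2 * R => complex.Im (q.1 i j)).
  move=> q; apply: (@continuous_comp _ _ _ (fun q : 'M[R[i]]_2 * R => q.1 i j) (@complex.Im R)).
    apply: (@continuous_comp _ _ _ fst (fun A : 'M[R[i]]_2 => A i j)); first exact: cvg_fst.
    exact: cont_entry.
  exact: cont_Im.
have cr : continuous (fun q : 'M[R[i]]_2 * R => q.2) by move=> q; exact: cvg_snd.
pose p1 (q : 'M[R[i]]_2 * R) := complex.Re (q.1 0 0) * q.2 + complex.Re (q.1 0 1).
pose p2 (q : 'M[R[i]]_2 * R) := complex.Im (q.1 0 0) * q.2 + complex.Im (q.1 0 1).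
pose q1 (q : 'M[R[i]]_2 * R) := complex.Re (q.1 1 0) * q.2 + complex.Re (q.1 1 1).
pose q2 (q : 'M[R[i]]_2 * R) := complex.Im (q.1 1 0) * q.2 + complex.Im (q.1 1 1).
have lin (f g : 'M[R[i]]_2 * R -> R) : continuous f -> continuous g -> continuous (fun q => f q * q.2 + g q).
  by move=> cf cg; mcont.
have cp1 : continuous p1 by exact: lin (re 0 0) (re 0 1).
have cp2 : continuous p2 by exact: lin (im 0 0) (im 0 1).
have cq1 : continuous q1 by exact: lin (re 1 0) (re 1 1).
have cq2 : continuous q2 by exact: lin (im 1 0) (im 1 1).
have cd : continuous (fun q => q1 q ^+ 2 + q2 q ^+ 2) by mcont.
have cy : continuous (fun q => p2 q * q1 q - p1 q * q2 q) by mcont.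
have cx : continuous (fun q => p1 q * q1 q + p2 q * q2 q) by mcont.
have ca : continuous (fun q => p1 q ^+ 2 + p2 q ^+ 2) by mcont.
rewrite (_ : (fun q => _) = (fun q => mkf (q1 q ^+ 2 + q2 q ^+ 2) (p2 q * q1 q - p1 q * q2 q)
  (p1 q * q1 q + p2 q * q2 q) (p1 q ^+ 2 + p2 q ^+ 2) : form4)); last first.
  by apply/funext => q; exact: fmove_npt.
exact: (cvg_pair (cvg_pair (cvg_pair (cd q0) (cy q0)) (cx q0)) (ca q0)).
Qed.

Lemma near_not_limit S n : ~ limit_form S n -> \forall m \near (n : form4), ~ limit_form S m.
Proof.
move=> nl.
have [W nW no] : exists2 W : set form4, nbhs (n : form4) W &
    ~ exists g c, [/\ S g, 0 < c & W (fscale c (gm g (base_form R)))].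
  by apply: contrapT => h; apply: nl => W nW; apply: contrapT => no; apply: h; exists W.
have : \forall m \near (n : form4), nbhs (m : form4) W by exact: nbhs_interior.
move=> nn; near=> m => lm; apply: no; apply: lm.
by near: m; exact: nn.
Unshelve. all: by end_near. Qed.

(** None of the points A(r) with r0 <= |r| <= r1 is a limit point. *)
Definition avoids (S : set (PSL2 R)) (r0 r1 : R) (A : 'M[R[i]]_2) : Prop :=
  forall r : R, r0 <= `|r| <= r1 -> ~ limit_form S (fmove A (npt (Some r%:C))).

(** Not being a limit form is an open condition, and r ranges over a compact set. *)
Lemma open_avoids S r0 r1 : 0 < r0 -> r0 <= r1 -> open (avoids S r0 r1).
Proof.
move=> p0 r01; rewrite openE => A aA.
have cC : compact (`[- r1, - r0]%classic `|` `[r0, r1]%classic : set R).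
  by apply: compactU; exact: segment_compact.
have annE (r : R) : (r0 <= `|r| <= r1) <-> (`[- r1, - r0]%classic `|` `[r0, r1]%classic : set R) r.
  rewrite /= !in_itv /=; split.
    have [r00|r00] := ler0P r => /andP[h1 h2]; [left|right]; apply/andP; split; lra.
  by move=> [|] /andP[h1 h2]; [rewrite ler0_norm|rewrite ger0_norm]; try (apply/andP; split); lra.
have := (compact_near_coveringP _).1 cC _ (nbhs A)
  (fun B r => ~ limit_form S (fmove B (npt (Some r%:C)))) (nbhs_filter A).
move=> /(_ _) H; have : \forall B \near A, forall r : R,
    (`[- r1, - r0]%classic `|` `[r0, r1]%classic : set R) r -> ~ limit_form S (fmove B (npt (Some r%:C))).
  apply: H => r /annE hr.
  have nl := near_not_limit (aA r hr).
  have nn := @cont_fmove_npt (A, r) _ nl.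
  move: nn => [[X Y] /= [nX nY] XY]; exists (Y, X) => //= -[r' B] [/= h1 h2].
  by apply: (XY (B, r')).
move=> nB; suff : \forall B \near A, avoids S r0 r1 B by [].
by near=> B => r /annE hr; move: r hr; near: B.
Unshelve. all: by end_near. Qed.

Variable Gamma : groupClosed (PSL2 R).
Notation G := ([set` Gamma] : set (PSL2 R)).

Lemma limit_gm g n : g \in Gamma -> limit_form G (gm g n) <-> limit_form G n.
Proof.
move=> gG; have inv h : h \in Gamma -> forall h', G h' -> G (h * h')%g by move=> hG h' h'G; exact: gpredM.
split; last exact: limit_form_gm (inv _ gG).
have gV : g^-1%g \in Gamma by rewrite gpredV.
by move=> l; have := limit_form_gm (inv _ gV) l; rewrite gmK.
Qed.

Lemma limit_mobius g xi : limit_set Gamma (mobius g xi) <-> limit_form G (gm g (npt xi)).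
Proof.
have [c c0 E] := gm_npt g xi; rewrite limit_setP; split.
  by rewrite E; exact: limit_form_scale.
move=> l; have -> : npt (mobius g xi) = fscale c^-1 (gm g (npt xi)).
  by rewrite E fscaleA mulVf ?fscale1 // gt_eqF.
by apply: limit_form_scale; rewrite ?invr_gt0.
Qed.

Lemma RFM_proj y : RFM Gamma (frame_proj Gamma y) <->
  limit_set Gamma (fwd y) /\ limit_set Gamma (bwd y).
Proof.
split; first by apply.
move=> [f b] y' /frame_projP yy.
have yE : y' = (y' * y^-1 * y)%g by rewrite mulgVK.
rewrite /fwd /bwd yE (mobiusM (y' * y^-1)%g y (Some 0)) (mobiusM (y' * y^-1)%g y None).
rewrite !limit_mobius !limit_gm // -!limit_setP.
by split.
Qed.

(** The condition passes to the quotients because the limit set is invariant under Gamma and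
    forms do not see the sign of a matrix. *)
Lemma open_avoiding r0 r1 : 0 < r0 -> r0 <= r1 -> open [set X : frame_bundle Gamma |
  forall y, frame_proj Gamma y = X -> avoids G r0 r1 (lift_mx y)].
Proof.
move=> p0 r01; have oA := open_avoids (S := G) p0 r01.
have oS : open ((fun A : SL2 R => \val A) @^-1` avoids G r0 r1 : set (SL2 R)).
  by exists (avoids G r0 r1).
have oP : open ([set y : PSL2 R | avoids G r0 r1 (lift_mx y)]).
  rewrite /open /= /quotient_open.
  rewrite (_ : _ @^-1` _ = (fun A : SL2 R => \val A) @^-1` avoids G r0 r1) //.
  apply/seteqP; split=> A /= H r hr; have := H r hr; rewrite -/(psl A).
    by rewrite -[fmove (lift_mx _) _]/(gm (psl A) _) gm_psl.
  by rewrite -[fmove (lift_mx _) _]/(gm (psl A) _) gm_psl.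
rewrite /open /= /quotient_open.
rewrite (_ : _ @^-1` _ = [set y : PSL2 R | avoids G r0 r1 (lift_mx y)]) //.
apply/seteqP; split=> y /= H; first exact: H.
move=> y' /frame_projP yy r hr; have := H r hr; rewrite -!/(gm _ _).
have -> : gm y' (npt (Some r%:C)) = gm (y' * y^-1)%g (gm y (npt (Some r%:C))) by rewrite -gmM mulgVK.
by move=> h; rewrite limit_gm; first exact: h.
Qed.
End Dynamics.

(** * The theorem *)

Section Final.
Variable R : realType.
Notation form4 := (R * R * R * R)%type.
Implicit Types (K L H n m : hform R) (g h k u : PSL2 R) (z w : R[i]).

(** [off_strip] for the conjugate of Gamma, transported back by k. *)
Lemma strip (Gamma : groupClosed (PSL2 R)) : geometrically_finite Gamma -> has_rank1_parabolic Gamma ->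
  exists k (C : R), limit_set Gamma (mobius k None) /\
    forall z, C < `|complex.Im z| -> ~ limit_set Gamma (mobius k (Some z)).
Proof.
move=> [s fdm] /cusp_frame [k [lk ku para]].
have TS := tes_conj k (fundamental_tessellation fdm).
have para' u (c : R) : (k * u * k^-1)%g \in Gamma -> 0 < c -> gm u (inf_pt R) = fscale c (inf_pt R) ->
    exists r, u = u_ r.
  by move=> uG c0 E; apply: para uG _; exact: gm_inf_mobius E.
have [C CP] := off_strip TS ku para'; exists k, C; split=> // z zC.
have po : fpos (gm k^-1%g (base_form R)) by apply: gm_pos; apply: kpt_pos; exact: base_H3.
have := CP (npt (Some z)) _ (npt_null (Some z)).
rewrite /npt [fd _]/(1 : R) [fy _]/(complex.Im z) mulr1 => /(_ _ ltr01 zC po) nn.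
rewrite limit_mobius => l.
pose P (L : form4) := forall g c, (k * g * k^-1)%g \in Gamma -> 0 < c ->
  L <> fscale c (gm g (gm k^-1%g (base_form R))).
have nP : \forall L \near (gm k^-1%g (gm k (npt (Some z))) : form4), P L by rewrite gmK.
have [g [c [gG c0 H]]] := l _ (near_gm nP).
apply: (H (k^-1 * g * k)%g c) => //; first by rewrite !mulgA mulgV mul1g mulgK.
by rewrite gm_scale !gmM gmVK.
Qed.

Lemma mobius_a (s r : R) : mobius (a_ s) (Some r%:C) = Some (expR s * r)%:C.
Proof.
rewrite mobius_psl /mobius_mx /= !mx2E.
have e0 : (expR (- (s / 2)))%:C != 0 :> R[i] by rewrite fmorph_eq0 gt_eqF // expR_gt0.
rewrite mul0r add0r addr0 (negbTE e0); congr Some.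
rewrite -rmorphM /= expRN fmorphV invrK -rmorphM /= mulrAC -expRD; congr (_ * r)%:C.
by rewrite -splitr.
Qed.

(** One of the two endpoints of x differs from the cusp and is k(z) for some z in C. The
    rotation by a right angle makes the points A(r) run along the line z + i R, which is
    transverse to the strip. *)
Lemma avoid_frame (Gamma : groupClosed (PSL2 R)) (x : frame_bundle Gamma) :
  geometrically_finite Gamma -> has_rank1_parabolic Gamma -> RFM Gamma x ->
  exists A (r0 : R), [/\ 0 < r0, RFM Gamma (frame_proj Gamma A) &
    forall r : R, r0 <= `|r| -> ~ limit_set Gamma (mobius A (Some r%:C))].
Proof.
move=> gf rk xR; have [k [C [lk off]]] := strip gf rk.
have [ff bb] : limit_set Gamma (fwd (repr x)) /\ limit_set Gamma (bwd (repr x)).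
  by apply: xR; rewrite /frame_proj reprK.
have inj g xi xi' : mobius g xi = mobius g xi' -> xi = xi'.
  by move=> E; rewrite -(mobius1 xi) -(mobius1 xi') -(mulVg g) !mobiusM E.
have [z lz] : exists z, limit_set Gamma (mobius k (Some z)).
  have sur xi : exists eta, mobius k eta = xi by exists (mobius k^-1%g xi); rewrite -mobiusM mulgV mobius1.
  have [[z|] zE] := sur (fwd (repr x)); first by exists z; rewrite zE.
  have [[z|] zE'] := sur (bwd (repr x)); first by exists z; rewrite zE'.
  by move: zE; rewrite zE' => /inj.
(* dg w0 is the rotation z |-> i z *)
pose w : R[i] := sqrtC 'i; have w2 : w ^+ 2 = 'i by rewrite sqrtCK.
have w0 : w != 0 by rewrite sqrtC_eq0 neq0Ci.
pose A := (k * upper z * dg w0)%g.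
have AE (r : R) : mobius A (Some r%:C) = mobius k (Some ('i * r%:C + z)).
  by rewrite /A !mobiusM mobius_dg w2 mobius_upper.
have AN : mobius A None = mobius k None by rewrite /A !mobiusM mobius_dg mobius_upper.
exists A, (`|C| + `|complex.Im z| + 1); split.
- by have := normr_ge0 C; have := normr_ge0 (complex.Im z); lra.
- apply/RFM_proj; rewrite /fwd /bwd AN; split=> //.
  by have := AE 0; rewrite mulr0 add0r => ->.
move=> r hr; rewrite AE; apply: off.
have -> : complex.Im ('i * r%:C + z) = r + complex.Im z.
  by rewrite raddfD; congr (_ + _); rewrite -complexiE /= mul0r mul1r add0r.
have := ler_norm C; have := ler_normB (r + complex.Im z) (complex.Im z).
rewrite addrK; lra.
Qed.
End Final.

Theorem theorem1p1 (R : realType) (Gamma : groupClosed (PSL2 R))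
    (x : frame_bundle Gamma) :
  discrete_subgroup Gamma ->
  torsion_free Gamma ->
  geometrically_finite Gamma ->
  has_rank1_parabolic Gamma ->
  RFM Gamma x ->
  closure [set right_act x a | a in A_ R] = RFM Gamma ->
  forall K : R, 1 < K -> ~ thick K (return_times x).
Proof.
move=> _ _ gf rk xR dense K K1 th.
have [A [r0 [p0 AR off]]] := avoid_frame gf rk xR.
have r01 : r0 <= K * r0 by rewrite ler_pMl // ltW.
pose N := [set X : frame_bundle Gamma |
  forall y, frame_proj Gamma y = X -> avoids [set` Gamma] r0 (K * r0) (lift_mx y)].
have oN : open N by exact: open_avoiding.
have NA : N (frame_proj Gamma A).
  move=> y /frame_projP yA r /andP[h1 _]; rewrite -/(gm _ _).
  have -> : gm y (npt (Some r%:C)) = gm (y * A^-1)%g (gm A (npt (Some r%:C))) by rewrite -gmM mulgVK.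
  by rewrite limit_gm // -limit_mobius; exact: off.
have : closure [set right_act x a | a in A_ R] (frame_proj Gamma A) by rewrite dense.
move=> /(_ N (open_nbhs_nbhs (conj oN NA))) [_ [[_ [s _ <-] <-] Ns]].
pose g := repr x.
have Na : avoids [set` Gamma] r0 (K * r0) (lift_mx (g * a_ s)%g) by exact: Ns.
have e0 := expR_gt0 s.
(* A return time of x between e^s r0 and K e^s r0 is, for the frame x a_s, one between
   r0 and K r0. *)
have t0 : 0 < expR s * r0 by rewrite mulr_gt0.
have [t [Rt tI]] := th _ t0.
have tn : expR s * r0 <= `|t| <= K * (expR s * r0).
  move: tI; rewrite /= !in_itv /= => -[|] /andP[h1 h2].
    by rewrite ler0_norm; [apply/andP; split; lra|lra].
  by rewrite ger0_norm; [apply/andP; split; lra|lra].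
pose r := t / expR s.
have tE : t = expR s * r by rewrite /r mulrC divfK // gt_eqF.
have rI : r0 <= `|r| <= K * r0.
  move: tn; rewrite tE normrM (gtr0_norm e0) ler_pM2l // mulrCA ler_pM2l //.
apply: (Na r rI); rewrite -/(gm _ _) -limit_mobius mobiusM mobius_a -tE.
have [ft _] := Rt (g * u_ t)%g erefl.
move: ft; rewrite /fwd mobiusM mobius_upper add0r; exact.
Qed.
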